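(* Let $\beta,\gamma,h>0$ satisfy the criticality condition $\gamma=\cosh^2(\gamma h)/\tanh(\beta)$, let $T>0$, and consider the $2N$-spin process in random environment $\underline\eta$ with the stationary-type i.i.d. initial condition described in the context. Define $$\begin{aligned} r_N(t)&=N^{1/2}m_N^{\eta},\\ \bar x_N(t)&=N^{1/4}\big[\cosh(\gamma h)\,m_N^{\sigma}(t)+\sinh(\beta)\,m_N^{\omega}(t)\big],\\ \bar y_N(t)&=N^{1/4}\big[(\cosh(\gamma h)-\cosh(\beta))\,m_N^{\sigma\eta}(t)+\sinh(\beta)\,m_N^{\omega\eta}(t)\\ &\qquad\quad-(\cosh(\gamma h)-\cosh(\beta))\tanh(\beta)\tanh(\gamma h)-\sinh(\beta)\tanh(\gamma h)\big],\\ \bar z_N(t)&=N^{1/4}\big[m_N^{\omega\eta}(t)-\tanh(\gamma h)\big],\\ \bar u_N(t)&=N^{1/4}\Big[m_N^{\sigma\omega}(t)-\tanh(\gamma h)\,m_N^{\sigma\eta}(t)+\tanh(\beta)\tanh(\gamma h)\,m_N^{\omega\eta}(t)\\ &\qquad\quad-\frac{\tanh(\beta)\tanh(\gamma h)\sinh(\gamma h)+\sinh(\beta)}{\cosh(\beta)+\cosh(\gamma h)}\Big],\\ \bar v_N(t)&=N^{1/4}\big[2\cosh(\beta)\sinh(\gamma h)(\cosh(\beta)+2\cosh(\gamma h))\,m_N^{\sigma}(t)\\ &\qquad\quad-2\sinh(\beta)\sinh(\gamma h)(\cosh(\beta)+2\cosh(\gamma h))\,m_N^{\omega}(t)\big],\\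 \bar w_N(t)&=N^{1/4}\big[-\tanh(\beta)\sinh(\gamma h)(\cosh(\beta)+2\cosh(\gamma h))\,m_N^{\omega}(t)+(\cosh(\beta)+\cosh(\gamma h))^2\,m_N^{\sigma\omega\eta}(t)\big]. \end{aligned}$$ Then, for $t\in[0,T]$ and as $N\to+\infty$: $r_N(t)$ converges (in law) to a standard Gaussian random variable $\mathscr H$; the processes $\bar y_N(N^{1/4}t)$, $\bar z_N(N^{1/4}t)$, $\bar u_N(N^{1/4}t)$, $\bar v_N(N^{1/4}t)$, $\bar w_N(N^{1/4}t)$ collapse to zero; and $\bar x_N(N^{1/4}t)$ converges, in the sense of weak convergence of stochastic processes, to the Gaussian process $$\widetilde x(t)=2\,\mathscr H\,\sinh(\beta)\,\sinh(\gamma h)\,t .$$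
   Context: Let $\mathscr S=\{-1,+1\}$ and let $\underline\eta=(\eta_j)_{j=1}^N$ be i.i.d. with $P(\eta_j=\pm1)=1/2$. Given $\underline\eta$, $(\underline\sigma(t),\underline\omega(t))=(\sigma_j(t),\omega_j(t))_{j=1}^N$, $t\ge0$, is the continuous-time Markov chain on $\mathscr S^{2N}$ with generator $$L_Nf(\underline\sigma,\underline\omega)=\sum_{j=1}^Ne^{-\beta\sigma_j\omega_j}[f(\underline\sigma^j,\underline\omega)-f(\underline\sigma,\underline\omega)]+\sum_{j=1}^Ne^{-\gamma\omega_j(m^{\underline\sigma}_N+h\eta_j)}[f(\underline\sigma,\underline\omega^j)-f(\underline\sigma,\underline\omega)],$$ where $m_N^{\underline\sigma}=\frac1N\sum_j\sigma_j$ and $\underline\sigma^j$ (resp. $\underline\omega^j$) is obtained by flipping the sign of the $j$-th component. Laws are taken jointly in the dynamics and the environment $\underline\eta$. Initial condition: the triples $(\sigma_j(0),\omega_j(0),\eta_j)$, $j=1,\dots,N$, are i.i.d. with a common law (not depending on $N$) on $\mathscr S^3$ whose $\eta$-marginal is uniform and such that $$E[\sigma]=0,\quad E[\omega]=0,\quad E[\sigma\omega]=\frac{\tanh(\beta)\tanh(\gamma h)\sinh(\gamma h)+\sinh(\beta)}{\cosh(\beta)+\cosh(\gamma h)},$$ $$E[\sigma\eta]=\tanh(\beta)\tanh(\gamma h),\quad E[\omega\eta]=\tanh(\gamma h),\quad E[\sigma\omega\eta]=0 .$$ Empirical averages: $m_N^\eta=\frac1N\sum_j\eta_j$, $m_N^\sigma(t)=\frac1N\sum_j\sigma_j(t)$,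 $m_N^\omega(t)=\frac1N\sum_j\omega_j(t)$, $m_N^{\sigma\omega}(t)=\frac1N\sum_j\sigma_j(t)\omega_j(t)$, $m_N^{\sigma\eta}(t)=\frac1N\sum_j\sigma_j(t)\eta_j$, $m_N^{\omega\eta}(t)=\frac1N\sum_j\omega_j(t)\eta_j$, $m_N^{\sigma\omega\eta}(t)=\frac1N\sum_j\sigma_j(t)\omega_j(t)\eta_j$. A sequence of processes $\{X_n(t)\}_n$, $t\in[0,T]$, collapses to zero if for every $\varepsilon>0$, $\lim_{n\to+\infty}P(\sup_{t\in[0,T]}|X_n(t)|>\varepsilon)=0$. *)

(* Defs.v *)
From HB Require Import structures.
From mathcomp Require Import all_boot all_order all_algebra.
From mathcomp Require Import all_classical all_reals all_analysis.
Set Implicit Arguments.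
Unset Strict Implicit.
Unset Printing Implicit Defensive.
Import Order.TTheory GRing.Theory Num.Theory.
Import numFieldNormedType.Exports.
Local Open Scope classical_set_scope.
Local Open Scope ring_scope.

Section hyperbolic.
Context {R : realType}.
Definition sinh (x : R) : R := (expR x - expR (- x)) / 2.
Definition cosh (x : R) : R := (expR x + expR (- x)) / 2.
Definition tanh (x : R) : R := sinh x / cosh x.
End hyperbolic.

(* A spin is stored as a boolean: true is +1 and false is -1. *)
Definition spin {R : realType} (b : bool) : R := if b then 1 else -1.

Definition config (N : nat) := {ffun 'I_N -> bool}.

(* A state x is the pair (sigma, omega) = (x.1, x.2). *)
Definition state (N : nat) := (config N * config N)%type.

Definition flip N (j : 'I_N) (c : config N) : config N :=
  [ffun i => if i == j then ~~ c i else c i].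

Section empirical_averages.
Context {R : realType} {N : nat}.
Implicit Types (e : config N) (x : state N).

Definition average (g : 'I_N -> R) : R := N%:R^-1 * \sum_(j < N) g j.

Definition m_eta e : R := average (fun j => spin (e j)).
Definition m_sigma x : R := average (fun j => spin (x.1 j)).
Definition m_omega x : R := average (fun j => spin (x.2 j)).
Definition m_sigma_omega x : R :=
  average (fun j => spin (x.1 j) * spin (x.2 j)).
Definition m_sigma_eta e x : R :=
  average (fun j => spin (x.1 j) * spin (e j)).
Definition m_omega_eta e x : R :=
  average (fun j => spin (x.2 j) * spin (e j)).
Definition m_sigma_omega_eta e x : R :=
  average (fun j => spin (x.1 j) * spin (x.2 j) * spin (e j)).

End empirical_averages.

Section dynamics.
Context {R : realType} (beta gamma h : R) {N : nat}.
Implicit Types (e : config N) (x : state N).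

Definition generator e (f : state N -> R) x : R :=
  \sum_(j < N) expR (- beta * spin (x.1 j) * spin (x.2 j)) *
    (f (flip j x.1, x.2) - f x) +
  \sum_(j < N) expR (- gamma * spin (x.2 j) * (m_sigma x + h * spin (e j))) *
    (f (x.1, flip j x.2) - f x).

(* exp (t L) f, as the sum over k of t^k / k! L^k f *)
Definition semigroup e (t : R) (f : state N -> R) x : R :=
  limn (series (fun k => t ^+ k / k`!%:R * iter k (generator e) f x)).

Definition transition e (t : R) x y : R :=
  semigroup e t (fun z => (z == y)%:R) x.

(* Given eta, X is the continuous-time Markov chain with generator L_N on the
   finite state space; its paths are right continuous with left limits for the
   discrete topology.  The last clause says that, conditionally on eta = e, the
   finite-dimensional laws of X are those of the Markov chain with transition
   semigroup exp (t L_N), started from X_0; both sides are multiplied by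
   P(eta = e). *)
Record spin_chain d (Omega : measurableType d) (P : probability Omega R)
    (eta : Omega -> config N) (X : R -> Omega -> state N) : Prop := SpinChain {
  spin_chain_env_measurable :
    forall e, measurable [set w | eta w = e];
  spin_chain_measurable :
    forall (t : R) x, 0 <= t -> measurable [set w | X t w = x];
  spin_chain_right_continuous :
    forall w (t : R), 0 <= t -> \forall s \near t^'+, X s w = X t w;
  spin_chain_left_limits :
    forall w (t : R), 0 < t -> exists x, \forall s \near t^'-, X s w = x;
  spin_chain_fdd :
    forall e (n : nat) (t : nat -> R) (s : nat -> state N),
      t 0%N = 0 -> (forall i, (i < n)%N -> t i < t i.+1) ->
      P [set w | eta w = e /\ forall i, (i <= n)%N -> X (t i) w = s i] =
      (P [set w | eta w = e /\ X 0%R w = s 0%N] *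
        (\prod_(i < n) transition e (t i.+1 - t i) (s i) (s i.+1))%:E)%E
}.

End dynamics.

(* mu (a, b, c) is the probability of (sigma, omega, eta) = (a, b, c). *)
Definition mean {R : realType} (mu : bool * bool * bool -> R)
    (g : R -> R -> R -> R) : R :=
  \sum_x mu x * g (spin x.1.1) (spin x.1.2) (spin x.2).

Record initial_law {R : realType} (beta gamma h : R)
    (mu : bool * bool * bool -> R) : Prop := InitialLaw {
  initial_law_ge0 : forall x, 0 <= mu x;
  initial_law_sum1 : \sum_x mu x = 1;
  initial_law_eta : forall c, \sum_a \sum_b mu (a, b, c) = 1 / 2;
  initial_law_sigma : mean mu (fun s o e => s) = 0;
  initial_law_omega : mean mu (fun s o e => o) = 0;
  initial_law_sigma_omega : mean mu (fun s o e => s * o) =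
    (tanh beta * tanh (gamma * h) * sinh (gamma * h) + sinh beta) /
    (cosh beta + cosh (gamma * h));
  initial_law_sigma_eta :
    mean mu (fun s o e => s * e) = tanh beta * tanh (gamma * h);
  initial_law_omega_eta : mean mu (fun s o e => o * e) = tanh (gamma * h);
  initial_law_sigma_omega_eta : mean mu (fun s o e => s * o * e) = 0
}.

(* The triples (sigma_j(0), omega_j(0), eta_j) are i.i.d. with law mu. *)
Definition iid_start {R : realType} (mu : bool * bool * bool -> R) N
    d (Omega : measurableType d) (P : probability Omega R)
    (eta : Omega -> config N) (X : R -> Omega -> state N) : Prop :=
  forall (s o e : config N),
    P [set w | X 0 w = (s, o) /\ eta w = e] =
    (\prod_(j < N) mu (s j, o j, e j))%:E.

Section fluctuations.
Context {R : realType} (beta gamma h : R) {N : nat}.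
Variables (e : config N) (x : state N).

Let N4 : R := N%:R `^ (1 / 4).
Let ch := cosh (gamma * h).
Let sh := sinh (gamma * h).
Let th := tanh (gamma * h).

Definition fluct_r : R := N%:R `^ (1 / 2) * m_eta e.

Definition fluct_x : R := N4 * (ch * m_sigma x + sinh beta * m_omega x).

Definition fluct_y : R := N4 *
  ((ch - cosh beta) * m_sigma_eta e x + sinh beta * m_omega_eta e x
   - (ch - cosh beta) * tanh beta * th - sinh beta * th).

Definition fluct_z : R := N4 * (m_omega_eta e x - th).

Definition fluct_u : R := N4 *
  (m_sigma_omega x - th * m_sigma_eta e x + tanh beta * th * m_omega_eta e x
   - (tanh beta * th * sh + sinh beta) / (cosh beta + ch)).

Definition fluct_v : R := N4 *
  (2 * cosh beta * sh * (cosh beta + 2 * ch) * m_sigma x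
   - 2 * sinh beta * sh * (cosh beta + 2 * ch) * m_omega x).

Definition fluct_w : R := N4 *
  (- tanh beta * sh * (cosh beta + 2 * ch) * m_omega x
   + (cosh beta + ch) ^+ 2 * m_sigma_omega_eta e x).

End fluctuations.

Section convergence.
Context {R : realType}.

Definition sup_norm (T : R) (x : R -> R) : \bar R :=
  ereal_sup [set `|x t|%:E | t in `[0, T]].

Definition collapses_to_zero (T : R) (d : nat -> measure_display)
    (Omega : forall N, measurableType (d N))
    (P : forall N, probability (Omega N) R)
    (X : forall N, R -> Omega N -> R) : Prop :=
  forall eps : R, 0 < eps ->
    (fun N => P N [set w | (eps%:E < sup_norm T (X N ^~ w))%E])
      @ \oo --> 0%E.

Definition cvg_in_law (d : nat -> measure_display)
    (Omega : forall N, measurableType (d N))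
    (P : forall N, probability (Omega N) R) (X : forall N, Omega N -> R)
    d' (Omega' : measurableType d') (P' : probability Omega' R)
    (Y : Omega' -> R) : Prop :=
  forall f : R -> R, continuous f -> (exists M : R, forall a, `|f a| <= M) ->
    (fun N => ('E_(P N)[fun w => f (X N w)])%E) @ \oo
      --> ('E_P'[fun w => f (Y w)])%E.

(* The Skorokhod (J1) space D([0, T]).  A path is a function on R of which only
   the restriction to [0, T] matters. *)
Definition cadlag (T : R) (x : R -> R) : Prop :=
  (forall t : R, 0 <= t < T -> x s @[s --> t^'+] --> x t) /\
  (forall t : R, 0 < t <= T -> cvg (x s @[s --> t^'-])).

Definition time_change (T : R) (lam : R -> R) : Prop :=
  [/\ lam 0 = 0, lam T = T, {in `[0, T] &, {homo lam : s t / s < t}} &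
      {within `[0, T], continuous lam}].

Definition skorokhod_dist (T : R) (x y : R -> R) : \bar R :=
  ereal_inf [set e%:E | e in [set e : R | exists2 lam, time_change T lam &
    forall t : R, 0 <= t <= T ->
      `|lam t - t| <= e /\ `|x t - y (lam t)| <= e]].

Definition skorokhod_continuous (T : R) (F : (R -> R) -> R) : Prop :=
  forall x, cadlag T x -> forall eps : R, 0 < eps ->
    exists2 delta : R, 0 < delta & forall y, cadlag T y ->
      (skorokhod_dist T x y < delta%:E)%E -> `|F x - F y| < eps.

(* Weak convergence of the laws on D([0, T]). *)
Definition weak_cvg (T : R) (d : nat -> measure_display)
    (Omega : forall N, measurableType (d N))
    (P : forall N, probability (Omega N) R) (X : forall N, R -> Omega N -> R)
    d' (Omega' : measurableType d') (P' : probability Omega' R)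
    (Y : R -> Omega' -> R) : Prop :=
  forall F : (R -> R) -> R, skorokhod_continuous T F ->
    (exists M : R, forall x, cadlag T x -> `|F x| <= M) ->
    (fun N => ('E_(P N)[fun w => F (X N ^~ w)])%E) @ \oo
      --> ('E_P'[fun w => F (Y ^~ w)])%E.

End convergence.

(* Main.v *)
Require Import Defs.
From HB Require Import structures.
From mathcomp Require Import all_boot all_order all_algebra.
From mathcomp Require Import all_classical all_reals all_analysis.
From mathcomp Require Import measurable_realfun ring lra.
Import Order.TTheory GRing.Theory Num.Theory.
Import numFieldNormedType.Exports.
Local Open Scope classical_set_scope.
Local Open Scope ring_scope.

(* Of the six coordinates of the deviation from the stationary averages, five
   are contracted by the generator.  The linear drift of the sixth one, x,
   vanishes by the criticality condition and leaves the constant drift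
   2 sinh beta sinh (gamma h) m_eta.  With eps = N^(-1/4) one has m_eta of order
   eps^2, so over times of order 1/eps the variable x moves by an amount of order
   eps, while the other deviations stay small compared with eps.

   This is made rigorous with the exit function
     (x - 2 sinh beta sinh (gamma h) m_eta t)^2 / (rho eps)^2 + V / (kappa eps)^2,
   V a positive combination of the squares of the contracted deviations: as long
   as it is at most 1 its drift is at most a small multiple of eps, and a maximal
   inequality bounds the probability that it exceeds 1 before time T/eps.  The
   maximal inequality follows from the finite-dimensional laws alone, by passing
   to the limit along dyadic grids and using the right continuity of the paths.

   Hence, uniformly on [0, T], N^(1/4) x at time N^(1/4) t is close in probability
   to 2 sinh beta sinh (gamma h) t r_N, a continuous function of r_N, and it
   remains to prove the central limit theorem for r_N, which is done by
   Lindeberg's method, with Stein's identity for the Gaussian law. *)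

(** The delicate term of the drift of x is sinh (gamma m_sigma) times [dev_z]. If both factors are
    only known to be of order eps, it contributes order eps over a time T/eps, which is the size of
    x itself. This is why the exit region has a second scale: the contracted deviations must stay
    below kappa eps. The term then costs a multiple of kappa and keeping V in its region costs a
    multiple of eps / kappa^2, so kappa is fixed small before N grows. The other errors are
    harmless: the remaining nonlinear terms of x are of order eps^3, and the noise adds order 1/N =
    eps^4 per unit of time to the squares, hence eps^3 in total against (rho eps)^2.

    The contracted coordinates are z, v, p, q, w, where p and q are the plain deviations of the
    averages of sigma eta and sigma omega. Their linear drift is triangular (z drives p, p drives q,
    v drives w). The eigen-directions y and u would make it diagonal, but y becomes a multiple of z
    when cosh beta = cosh (gamma h), and then p cannot be recovered from y and z. The collapse of y
    and u follows from that of z, p and q by linear combination. *)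

Section real_estimates.
Context {R : realType}.
Implicit Types (f df : R -> R) (x y t M B : R).

(** The bound on [df] is asked only within distance [|t|] of [x], so that a bound which itself grows
    with the distance can be fed back in: each application gains one power of the increment, and
    this yields the Taylor bounds below. *)
Lemma le_norm_MVT f df M x t : (forall s, is_derive s (1 : R) f (df s)) ->
  (forall s, `|s - x| <= `|t| -> `|df s| <= M) ->
  `|f (x + t) - f x| <= M * `|t|.
Proof.
move=> fdf dfM.
have cf : continuous f.
  by move=> s; apply: differentiable_continuous; apply/derivable1_diffP.
have wcf a b : {within `[a, b], continuous f} by exact: continuous_subspaceT.
have [t0|t0] := leP 0 t.
  have [|c] := @MVT_segment R f df x (x + t) _ (fun s _ => fdf s) (wcf _ _).
    by rewrite lerDl.
  rewrite in_itv/= => /andP[xc cxt] ->; rewrite normrM addrAC subrr add0r.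
  rewrite ler_wpM2r// dfM// ger0_norm ?subr_ge0// ger0_norm//; lra.
have [|c] := @MVT_segment R f df (x + t) x _ (fun s _ => fdf s) (wcf _ _).
  by rewrite gerDl ltW.
rewrite in_itv/= => /andP[xc cxt]; rewrite distrC => ->.
rewrite normrM opprD addrA subrr add0r normrN.
by rewrite ler_wpM2r// dfM// ler0_norm ?subr_le0// ltr0_norm//; lra.
Qed.

Lemma le_norm_MVT0 f df M x : (forall s, is_derive s (1 : R) f (df s)) ->
  (forall s, `|s| <= `|x| -> `|df s| <= M) -> `|f x - f 0| <= M * `|x|.
Proof.
move=> fdf dfM; rewrite -{1}[x]add0r; apply: (le_norm_MVT _ _ _ _ _ fdf) => s.
by rewrite subr0; exact: dfM.
Qed.

Lemma taylor2_bound f f1 f2 B x t : (forall s, is_derive s (1 : R) f (f1 s)) ->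
  (forall s, is_derive s (1 : R) f1 (f2 s)) -> (forall s, `|f2 s| <= B) ->
  `|f (x + t) - f x - t * f1 x| <= B * t ^+ 2.
Proof.
move=> d1 d2 f2B.
pose g s := f s - s * f1 x.
have -> : f (x + t) - f x - t * f1 x = g (x + t) - g x by rewrite /g; ring.
rewrite -real_normK ?num_real// expr2 mulrA.
apply: (@le_norm_MVT g (fun s => f1 s - f1 x)) => s.
  have ? := d1 s; rewrite /g; apply: is_derive_eq.
  by rewrite /GRing.scale/=; ring.
move=> sx; rewrite -{1}(subrKC x s) (le_trans (le_norm_MVT _ _ B _ _ d2 _))//.
by rewrite ler_wpM2l// (le_trans (normr_ge0 _) (f2B 0)).
Qed.

Lemma taylor3_bound f f1 f2 f3 B x t : (forall s, is_derive s (1 : R) f (f1 s)) ->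
  (forall s, is_derive s (1 : R) f1 (f2 s)) ->
  (forall s, is_derive s (1 : R) f2 (f3 s)) -> (forall s, `|f3 s| <= B) ->
  `|f (x + t) - f x - t * f1 x - t ^+ 2 / 2 * f2 x| <= B * `|t| ^+ 3.
Proof.
move=> d1 d2 d3 f3B.
pose g s := f s - s * f1 x - (s - x) ^+ 2 / 2 * f2 x.
have -> : f (x + t) - f x - t * f1 x - t ^+ 2 / 2 * f2 x = g (x + t) - g x.
  by rewrite /g; field.
rewrite exprSr mulrA.
apply: (@le_norm_MVT g (fun s => f1 s - f1 x - (s - x) * f2 x)) => s.
  have ? := d1 s; rewrite /g; apply: is_derive_eq.
  by rewrite /GRing.scale/=; field.
move=> sx; rewrite -{1}(subrKC x s).
rewrite (le_trans (taylor2_bound _ _ _ _ _ _ d2 d3 f3B))//.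
rewrite ler_wpM2l// ?(le_trans (normr_ge0 _) (f3B 0))//.
by rewrite -[leLHS]real_normK ?num_real// lerXn2r// nnegrE.
Qed.

End real_estimates.

(** * Hyperbolic functions *)

Section hyperbolic_facts.
Context {R : realType}.
Implicit Types x y : R.

Lemma cosh_ge1 x : 1 <= cosh x.
Proof.
rewrite /cosh ler_pdivlMr// mul1r expRN.
have e0 : 0 < expR x by exact: expR_gt0.
rewrite -(ler_pM2l e0) [leRHS]mulrDr mulfV ?gt_eqF//.
have := sqr_ge0 (expR x - 1); nra.
Qed.

Lemma cosh_gt0 x : 0 < cosh x.
Proof. exact: lt_le_trans (cosh_ge1 x). Qed.

Lemma sinh_gt0 x : 0 < x -> 0 < sinh x.
Proof. by move=> x0; rewrite /sinh divr_gt0// subr_gt0 ltr_expR; lra. Qed.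

Lemma cosh2_sinh2 x : cosh x ^+ 2 - sinh x ^+ 2 = 1.
Proof.
rewrite /cosh /sinh expRN; have : expR x != 0 by rewrite gt_eqF ?expR_gt0.
by move=> e0; field.
Qed.

Lemma coshD x y : cosh (x + y) = cosh x * cosh y + sinh x * sinh y.
Proof. by rewrite /cosh /sinh opprD !expRD; field. Qed.

Lemma sinhD x y : sinh (x + y) = sinh x * cosh y + cosh x * sinh y.
Proof. by rewrite /cosh /sinh opprD !expRD; field. Qed.

Lemma coshN x : cosh (- x) = cosh x.
Proof. by rewrite /cosh opprK addrC. Qed.

Lemma sinhN x : sinh (- x) = - sinh x.
Proof. by rewrite /sinh opprK; field. Qed.

Lemma expR_cosh_sinh x : expR x = cosh x + sinh x.
Proof. by rewrite /cosh /sinh; field. Qed.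

Lemma is_derive_sinh x : is_derive x (1 : R) (@sinh R) (cosh x).
Proof.
rewrite /sinh; apply: is_derive_eq.
by rewrite /cosh /GRing.scale/=; field.
Qed.

Lemma is_derive_cosh x : is_derive x (1 : R) (@cosh R) (sinh x).
Proof.
rewrite /cosh; apply: is_derive_eq.
by rewrite /sinh /GRing.scale/=; field.
Qed.

Lemma cosh_bound x : `|x| <= 1 -> `|cosh x| <= expR 1.
Proof.
rewrite ler_norml => /andP[x1 x2]; rewrite ger0_norm ?(ltW (cosh_gt0 x))//.
have h1 : expR x <= expR 1 by rewrite ler_expR.
have h2 : expR (- x) <= expR 1 by rewrite ler_expR; lra.
by rewrite /cosh; lra.
Qed.

Lemma sinh0 : sinh (0 : R) = 0.
Proof. by rewrite /sinh oppr0 subrr mul0r. Qed.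

Lemma cosh0 : cosh (0 : R) = 1.
Proof. by rewrite /cosh oppr0 expR0 divff. Qed.

Lemma sinh_bound x : `|x| <= 1 -> `|sinh x| <= expR 1 * `|x|.
Proof.
move=> x1; rewrite -[sinh x]subr0 -sinh0.
apply: (le_norm_MVT0 _ _ _ _ is_derive_sinh) => s sx.
exact/cosh_bound/(le_trans sx).
Qed.

Lemma cosh1_bound x : `|x| <= 1 -> `|cosh x - 1| <= expR 1 * x ^+ 2.
Proof.
move=> x1; rewrite -[X in _ - X]cosh0 -[x ^+ 2]real_normK ?num_real// expr2 mulrA.
apply: (le_norm_MVT0 _ _ _ _ is_derive_cosh) => s sx.
rewrite (le_trans (sinh_bound _ (le_trans sx x1)))//.
by rewrite ler_wpM2l ?expR_ge0.
Qed.

Lemma sinh_id_bound x : `|x| <= 1 -> `|sinh x - x| <= expR 1 * `|x| ^+ 3.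
Proof.
move=> x1; have -> : sinh x - x = sinh x - x - (sinh 0 - 0).
  by rewrite sinh0 !subr0.
rewrite exprSr mulrA.
apply: (@le_norm_MVT0 _ (fun s => sinh s - s) (fun s => cosh s - 1)) => s.
  have ? := is_derive_sinh s; exact: is_derive_eq.
move=> sx; rewrite (le_trans (cosh1_bound _ (le_trans sx x1)))//.
rewrite ler_wpM2l ?expR_ge0// -[leLHS]real_normK ?num_real//.
by rewrite lerXn2r// nnegrE.
Qed.

End hyperbolic_facts.

(** * A maximal inequality for finite Markov chains *)

Section operator_exponential.
Context {R : realType} {S : finType}.
Variables (L : (S -> R) -> S -> R) (Lam : R).
Hypothesis L_linear : forall c f g x,
  L (fun y => c * f y + g y) x = c * L f x + L g x.
Hypothesis L_bound : forall f M, (forall x, `|f x| <= M) ->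
  forall x, `|L f x| <= Lam * M.
Hypothesis Lam_ge0 : 0 <= Lam.
Implicit Types (f g : S -> R) (x y : S) (t M : R).

(** The definition of [semigroup] for an abstract linear operator, bounded by [Lam] in the supremum
    norm. For the generator the two are convertible. *)
Definition expL t f x : R :=
  limn (series (fun k => t ^+ k / k`!%:R * iter k L f x)).

Lemma iter_linear k c f g x :
  iter k L (fun y => c * f y + g y) x = c * iter k L f x + iter k L g x.
Proof.
elim: k f g x => //= k IH f g x; rewrite -L_linear; congr (L _ x).
by apply/funext => y; rewrite IH.
Qed.

Lemma iter_bound k f M x : (forall y, `|f y| <= M) ->
  `|iter k L f x| <= Lam ^+ k * M.
Proof.
move=> fM; elim: k x => [|k IH] x /=; first by rewrite expr0 mul1r.
by rewrite exprS -mulrA; exact: L_bound.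
Qed.

Lemma expL_term_bound k t f M x : 0 <= t -> (forall y, `|f y| <= M) ->
  `|t ^+ k / k`!%:R * iter k L f x| <= M * exp_coeff (t * Lam) k.
Proof.
move=> t0 fM; rewrite normrM ger0_norm ?divr_ge0 ?exprn_ge0//.
apply: le_trans (ler_wpM2l _ (iter_bound k f M x fM)) _.
  by rewrite divr_ge0 ?exprn_ge0.
by rewrite /exp_coeff/= exprMn; lra.
Qed.

Lemma fun_bounded f : exists2 M, 0 <= M & forall y, `|f y| <= M.
Proof.
exists (\sum_y `|f y|); first by apply: sumr_ge0.
by move=> y; rewrite (bigD1 y)//= lerDl sumr_ge0.
Qed.

Lemma is_cvg_expL t f x : 0 <= t ->
  cvgn (series (fun k => t ^+ k / k`!%:R * iter k L f x)).
Proof.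
move=> t0; have [M M0 fM] := fun_bounded f.
apply: normed_cvg; apply: (@series_le_cvg R _ (fun k => M * exp_coeff (t * Lam) k)).
- by move=> n /=.
- by move=> n; rewrite mulr_ge0 // exp_coeff_ge0// mulr_ge0.
- by move=> n /=; exact: expL_term_bound.
- rewrite (_ : series _ = (fun n => M * series (exp_coeff (t * Lam)) n)).
    by apply: is_cvgMr; exact: is_cvg_series_exp_coeff.
  by apply/funext => n; rewrite /series/= mulr_sumr.
Qed.

Lemma expL_linear t c f g x : 0 <= t ->
  expL t (fun y => c * f y + g y) x = c * expL t f x + expL t g x.
Proof.
move=> t0; apply: cvg_lim => //.
rewrite (_ : series _ = (fun n =>
    c * series (fun k => t ^+ k / k`!%:R * iter k L f x) n +
    series (fun k => t ^+ k / k`!%:R * iter k L g x) n)); last first.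
  apply/funext => n; rewrite /series/= mulr_sumr -big_split/=.
  by apply: eq_bigr => i _; rewrite iter_linear; ring.
by apply: cvgD; [apply: cvgMr|]; exact: is_cvg_expL.
Qed.

Lemma expL0 t x : 0 <= t -> expL t (fun=> 0) x = 0.
Proof.
move=> t0; have := @expL_linear t (-1) (fun=> 0) (fun=> 0) x t0.
under [in X in expL _ X]eq_fun do rewrite mulr0 addr0.
by move=> ->; rewrite mulN1r addNr.
Qed.

(** Expectations under the transition function are values of the semigroup: [f] is expanded over the
    indicators of the states. *)
Lemma expL_sum t f x : 0 <= t ->
  \sum_y expL t (fun z => (z == y)%:R) x * f y = expL t f x.
Proof.
move=> t0.
have -> : f = fun z => \sum_y f y * (z == y)%:R.
  apply/funext => z; rewrite (bigD1 z)//= eqxx mulr1 big1 ?addr0// => y yz.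
  by rewrite eq_sym (negbTE yz) mulr0.
suff H (r : seq S) : expL t (fun z => \sum_(y <- r) f y * (z == y)%:R) x =
    \sum_(y <- r) f y * expL t (fun z => (z == y)%:R) x.
  rewrite H; apply: eq_bigr => y _; rewrite mulrC (bigD1 y)//= eqxx mulr1.
  rewrite big1 ?addr0// => z zy.
  by rewrite eq_sym (negbTE zy) mulr0.
elim: r => [|y r IH].
  rewrite big_nil; under [in X in expL _ X]eq_fun do rewrite big_nil.
  exact: expL0.
rewrite big_cons -IH -expL_linear//; congr (expL t _ x).
by apply/funext => z; rewrite big_cons.
Qed.

(** Since t <= 1, a factor t^2 can be taken out of every term of order at least two, and what
    remains is dominated by the series of [expR Lam]. *)
Lemma expL_expansion t f M x : 0 <= t <= 1 -> (forall y, `|f y| <= M) ->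
  `|expL t f x - f x - t * L f x| <= M * expR Lam * t ^+ 2.
Proof.
move=> /andP[t0 t1] fM; have M0 : 0 <= M := le_trans (normr_ge0 _) (fM x).
set u := fun k => t ^+ k / k`!%:R * iter k L f x.
have cu : cvgn (series u) by exact: is_cvg_expL.
have main n : `|series u n.+2 - f x - t * L f x| <= M * expR Lam * t ^+ 2.
  rewrite /series/= big_nat_recl// big_nat_recl//= /u/=.
  rewrite expr0 !fact0 divr1 mul1r expr1 divr1.
  rewrite (_ : _ - _ - _ = \sum_(0 <= i < n) u i.+2); last first.
    by rewrite /u/=; ring.
  rewrite (le_trans (ler_norm_sum _ _ _))//.
  have : series (exp_coeff Lam) n.+2 <= expR Lam.
    apply: nondecreasing_cvgn_le; last exact: is_cvg_series_exp_coeff.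
    by apply/nondecreasing_seqP => k; rewrite /series/= big_nat_recr//= lerDl exp_coeff_ge0.
  rewrite /series/= big_nat_recl// big_nat_recl//= => eL.
  apply: (@le_trans _ _ (\sum_(0 <= i < n) M * t ^+ 2 * exp_coeff Lam i.+2)).
    apply: ler_sum => i _.
    rewrite (le_trans (expL_term_bound _ _ _ _ _ t0 fM))//.
    rewrite -mulrA ler_wpM2l//.
    rewrite /exp_coeff/= exprMn mulrA ler_wpM2r// ler_wpM2r ?exprn_ge0//.
    by rewrite !exprS expr0 mulr1 mulrA ler_piMr ?mulr_ge0// exprn_ile1.
  rewrite -mulr_sumr mulrAC ler_wpM2r ?sqr_ge0// ler_wpM2l//.
  by apply: le_trans eL; rewrite addrA lerDr addr_ge0// exp_coeff_ge0.
have c1 : `|series u n.+2 - f x - t * L f x| @[n --> \oo] -->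
    `|expL t f x - f x - t * L f x|.
  apply: cvg_norm; apply: cvgB; last exact: cvg_cst.
  apply: cvgB; last exact: cvg_cst.
  rewrite (_ : (fun n => _) = (fun n => series u (n + 2)%N)); last first.
    by apply/funext => n; rewrite addn2.
  by apply: cvg_comp; [exact: cvg_addnr|].
rewrite -(cvg_lim _ c1)//; apply: limr_le; first exact: cvgP c1.
by near=> n; exact: main.
Unshelve. all: by end_near. Qed.

End operator_exponential.

Section finite_valued.
Context {R : realType} {S : finType} {d} {Omega : measurableType d}.
Variable Y : Omega -> S.
Hypothesis Y_measurable : forall x, measurable [set w | Y w = x].

Lemma preimage_bigcup (A : pred S) :
  [set w | A (Y w)] = \bigcup_(x in A) [set w | Y w = x].
Proof.
by apply/seteqP; split=> [w Aw|w [x Ax /= ->]] //; exists (Y w).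
Qed.

Lemma preimage_measurable (A : pred S) : measurable [set w | A (Y w)].
Proof.
by rewrite preimage_bigcup; apply: fin_bigcup_measurable => // x _.
Qed.

Lemma total_measure (mu : {measure set Omega -> \bar R}) (A : pred S) B :
  measurable B ->
  mu (B `&` [set w | A (Y w)]) =
  (\sum_(x | A x) mu (B `&` [set w | Y w = x]))%E.
Proof.
move=> mB; rewrite preimage_bigcup setI_bigcupr measure_fin_bigcup//=.
- rewrite (_ : (A : set S) = [set` [seq x <- enum S | A x]]).
    rewrite -fsbig_seq; last exact/filter_uniq/fintype.enum_uniq.
    by rewrite big_filter big_enum_cond.
  by apply/funext => x /=; rewrite mem_filter mem_enum andbT.
- by apply: trivIset_setIl; apply/trivIsetP => x y _ _ /eqP xy;
    apply/seteqP; split => // w [/= -> /xy].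
- by move=> x _; exact: measurableI.
Qed.

End finite_valued.

Section chain_maximal_inequality.
Context {R : realType} {S : finType} {d} {Omega : measurableType d}.
Variable P : probability Omega R.
Variables (E : set Omega) (X : R -> Omega -> S) (Q : R -> S -> S -> R).
Hypothesis E_measurable : measurable E.
Hypothesis X_measurable :
  forall (t : R) x, 0 <= t -> measurable [set w | X t w = x].
Hypothesis fdd : forall n (t : nat -> R) (s : nat -> S),
  t 0%N = 0 -> (forall i, (i < n)%N -> t i < t i.+1) ->
  P [set w | E w /\ forall i, (i <= n)%N -> X (t i) w = s i] =
  (P [set w | E w /\ X 0 w = s 0%N] *
    (\prod_(i < n) Q (t i.+1 - t i) (s i) (s i.+1))%:E)%E.

Section skeleton.
Variables (del : R) (good : nat -> pred S).
Hypothesis del_gt0 : 0 < del.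

Let grid i : R := i%:R * del.
Let grid_ge0 i : 0 <= grid i. Proof. by rewrite mulr_ge0// ltW. Qed.
Let mX i x : measurable [set w | X (grid i) w = x].
Proof. exact: X_measurable. Qed.

(** The condition stops strictly before j. The state at time j is still free, so [mass j] below
    counts the paths that leave at step j as well as those that go on. *)
Definition alive j : set Omega :=
  [set w | E w /\ forall i, (i < j)%N -> good i (X (i%:R * del) w)].

Lemma alive0 : alive 0 = E.
Proof. by apply/seteqP; split=> [w []|w]. Qed.

Lemma aliveS j :
  alive j.+1 = alive j `&` [set w | good j (X (j%:R * del) w)].
Proof.
apply/seteqP; split=> [w [Ew H]|w [[Ew H] gw]]; split => //.
- by split=> // i ij; apply: H; exact: ltnW.
- exact: H.
- by move=> i; rewrite ltnS leq_eqVlt => /predU1P[->//|]; exact: H.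
Qed.

Lemma alive_measurable j : measurable (alive j).
Proof.
elim: j => [|j IH]; first by rewrite alive0.
by rewrite aliveS; apply: measurableI => //; exact: (preimage_measurable _ (mX j)).
Qed.

(** The hypothesis [fdd] speaks only of events that prescribe the state at every grid time. These
    events interpolate: survival before j, prescribed states from j to n. Freeing one more time is a
    sum over the good states at that time, which allows an induction on j. *)
Let path_event j (s : nat -> S) n : set Omega :=
  alive j `&` [set w | forall i, (j <= i <= n)%N -> X (grid i) w = s i].

Definition mass j x : R := fine (P (alive j `&` [set w | X (j%:R * del) w = x])).

Lemma mass_ge0 j x : 0 <= mass j x. Proof. exact: fine_ge0. Qed.

Lemma massE j x :
  P (alive j `&` [set w | X (j%:R * del) w = x]) = (mass j x)%:E.
Proof.
rewrite fineK// fin_num_measure//.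
by apply: measurableI; [exact: alive_measurable|exact: mX].
Qed.

Let upd (s : nat -> S) (j : nat) x := fun i : nat => if i == j then x else s i.

Let path_event_step j s n : (j < n)%N ->
  P (path_event j.+1 s n) =
  (\sum_(x | good j x) P (path_event j (upd s j x) n))%E.
Proof.
move=> jn; pose B := alive j `&`
  [set w | forall i, (j < i <= n)%N -> X (grid i) w = s i].
have mB : measurable B.
  apply: measurableI; first exact: alive_measurable.
  rewrite (_ : [set w | _] =
    \bigcap_(i in [set i | (j < i <= n)%N]) [set w | X (grid i) w = s i]).
  by apply: bigcap_measurableType => i _; exact: mX.
  by apply/seteqP; split=> w.
rewrite /path_event aliveS -setIA [X in _ `&` X]setIC setIA.
rewrite (total_measure _ (mX j) P (good j) _ mB); apply: eq_bigr => x gx.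
congr (P _); apply/seteqP; split=> [w [[aw sw] /= Xw]|w [aw sw]].
  split=> // i /andP[ji ni]; rewrite /upd; case: eqP => [->//|/eqP ij].
  by apply: sw; rewrite ni andbT ltn_neqAle eq_sym ij.
split; last by rewrite /= (sw j) ?leqnn 1?ltnW// /upd eqxx.
split=> // i /andP[ji ni]; rewrite (sw i) ?ni 1?ltnW//.
by rewrite /upd gtn_eqF.
Qed.

Let path_eventE j s n : (j <= n)%N ->
  P (path_event j s n) =
  (mass j (s j) * \prod_(j <= i < n) Q del (s i) (s i.+1))%:E.
Proof.
have gridS i : grid i.+1 - grid i = del by rewrite /grid -natr1; ring.
elim: j s n => [|j IH] s n jn.
  rewrite (_ : path_event 0 s n =
      [set w | E w /\ forall i, (i <= n)%N -> X (grid i) w = s i]); last first.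
    by rewrite /path_event alive0; apply/seteqP; split=> w.
  rewrite fdd ?/grid ?mul0r// => [|i _]; last by rewrite ltr_pM2r// ltr_nat.
  rewrite EFinM; congr (_ * _)%E; first by rewrite -massE alive0 mul0r.
  by rewrite big_mkord; congr EFin; apply: eq_bigr => i _; rewrite gridS.
have step s' n' : (j < n')%N -> P (path_event j.+1 s' n') =
    ((\sum_(x | good j x) mass j x * Q del x (s' j.+1)) *
      \prod_(j.+1 <= i < n') Q del (s' i) (s' i.+1))%:E.
  move=> jn'; rewrite path_event_step// mulr_suml -sumEFin; apply: eq_bigr => x gx.
  rewrite IH 1?ltnW// /upd eqxx big_ltn// eqxx gtn_eqF// mulrA.
  congr (_ * _)%:E; apply: eq_big_nat => i /andP[ji _].
  by rewrite !gtn_eqF// ltnW.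
rewrite step//; congr (_ * _)%:E.
apply: EFin_inj; rewrite -massE -[RHS]mul1e.
have -> : alive j.+1 `&` [set w | X (j.+1%:R * del) w = s j.+1] =
    path_event j.+1 s j.+1.
  rewrite /path_event; congr (_ `&` _); apply/seteqP; split=> w /= Xw.
    by move=> i; rewrite -eqn_leq => /eqP <-.
  by apply: Xw; rewrite leqnn.
by rewrite mul1e step// big_geq// mulr1.
Qed.

(** The forward equation of the chain killed when it leaves the good sets. *)
Lemma massS j y : mass j.+1 y = \sum_(x | good j x) mass j x * Q del x y.
Proof.
apply: EFin_inj; rewrite -massE.
have -> : alive j.+1 `&` [set w | X (j.+1%:R * del) w = y] =
    path_event j.+1 (fun=> y) j.+1.
  rewrite /path_event; congr (_ `&` _); apply/seteqP; split=> w /= Xw.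
    by move=> i; rewrite -eqn_leq => /eqP <-.
  by apply: (Xw j.+1); rewrite leqnn.
rewrite path_event_step// -sumEFin; apply: eq_bigr => x gx.
by rewrite path_eventE//= big_nat1 /upd eqxx gtn_eqF.
Qed.

Lemma mass_sum_le j (A : pred S) : \sum_(x | A x) mass j x <= fine (P E).
Proof.
rewrite -lee_fin fineK ?fin_num_measure// -sumEFin.
under eq_bigr do rewrite -massE.
rewrite -(total_measure _ (mX j))//; last exact: alive_measurable.
apply: le_measure; rewrite ?inE//.
  apply: measurableI; first exact: alive_measurable.
  exact: (preimage_measurable _ (mX j)).
by move=> w [[]].
Qed.

Definition exits n : set Omega :=
  [set w | E w /\ exists2 i, (i <= n)%N & ~~ good i (X (i%:R * del) w)].

Lemma exits_measurable n : measurable (exits n).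
Proof.
rewrite (_ : exits n = E `&` \bigcup_(i in `I_n.+1)
   [set w | ~~ good i (X (grid i) w)]).
  apply: measurableI => //; apply: fin_bigcup_measurable => // i _.
  exact: (preimage_measurable _ (mX i) (fun x => ~~ good i x)).
by apply/seteqP; split=> w [Ew [i ? ?]]; split => //; exists i.
Qed.

(** An exit is classified by its first bad time i; up to that time the path is alive, so it is
    counted by [mass i]. *)
Lemma exits_le n :
  fine (P (exits n)) <= \sum_(0 <= i < n.+1) \sum_(x | ~~ good i x) mass i x.
Proof.
pose first_exit i := alive i `&` [set w | ~~ good i (X (grid i) w)].
have mf i : measurable (first_exit i).
  apply: measurableI; first exact: alive_measurable.
  exact: (preimage_measurable _ (mX i) (fun x => ~~ good i x)).
rewrite -lee_fin fineK ?fin_num_measure//; last exact: exits_measurable.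
have -> : exits n = \big[setU/set0]_(i < n.+1) first_exit i.
  rewrite -bigcup_mkord; apply/seteqP; split=> w.
    move=> [Ew [i ni gi]].
    have [k kP kmin] := ex_minnP (ex_intro (fun i => ~~ good i (X (grid i) w)) i gi).
    exists k; first by rewrite /= ltnS (leq_trans (kmin _ gi)).
    split => //; split => // l lk; apply/negPn/negP => /kmin.
    by rewrite leqNgt lk.
  by move=> [i ni [[Ew _] gi]]; split => //; exists i.
rewrite (le_trans (Boole_inequality _ _))// big_mkord -sumEFin.
apply: lee_sum => i _; rewrite -sumEFin le_eqVlt.
under [X in _ == X]eq_bigr do rewrite -massE.
by rewrite -(total_measure _ (mX i) P (fun x => ~~ good i x)) ?eqxx//;
  exact: alive_measurable.
Qed.

Variables (G : nat -> S -> R) (c : R).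
Hypothesis G_ge0 : forall i x, 0 <= G i x.
Hypothesis G_ge1 : forall i x, ~~ good i x -> 1 <= G i x.

(* The mass that has left the good region by time i, plus the G-mass that is
   still inside it, grows by at most c at each step. *)
Lemma skeleton_maximal n : 0 <= c ->
  (forall i x, (i < n)%N -> good i x ->
    \sum_y Q del x y * G i.+1 y <= G i x + c) ->
  fine (P (exits n)) <= \sum_x mass 0 x * G 0 x + n%:R * c * fine (P E).
Proof.
move=> c0 QG.
have exitG i : \sum_(x | ~~ good i x) mass i x + \sum_(x | good i x) mass i x * G i x
    <= \sum_x mass i x * G i x.
  rewrite [leRHS](bigID (good i))/= [leLHS]addrC lerD2l; apply: ler_sum => x gx.
  by rewrite ler_peMr ?mass_ge0// G_ge1.
suff : \sum_(0 <= i < n.+1) \sum_(x | ~~ good i x) mass i x +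
    \sum_(x | good n x) mass n x * G n x <=
    \sum_x mass 0 x * G 0 x + n%:R * c * fine (P E).
  apply: le_trans; apply: (le_trans (exits_le n)).
  by rewrite lerDl sumr_ge0// => x _; rewrite mulr_ge0 ?mass_ge0.
elim: n QG => [|n IH] QG; first by rewrite big_nat1 mul0r mul0r addr0.
have {}IH := IH (fun i x ij => QG i x (ltnW ij)).
rewrite big_nat_recr//= -addrA (le_trans (lerD (lexx _) (exitG n.+1)))//.
have step : \sum_x mass n.+1 x * G n.+1 x <=
    \sum_(x | good n x) mass n x * G n x + c * fine (P E).
  apply: (@le_trans _ _ (\sum_(x | good n x) mass n x * (G n x + c))).
    under eq_bigr do rewrite massS mulr_suml.
    rewrite exchange_big/=; apply: ler_sum => x gx.
    under eq_bigr do rewrite -mulrA.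
    by rewrite -mulr_sumr ler_wpM2l ?mass_ge0// QG.
  under eq_bigr do rewrite mulrDr.
  rewrite big_split/= lerD2l -mulr_suml mulrC ler_wpM2l//.
  exact: mass_sum_le.
rewrite (le_trans (lerD (lexx _) step))// addrA -natr1; lra.
Qed.

End skeleton.

Section continuous_time.
Variables (G : R -> S -> R) (tau c B : R).
Hypothesis X_right_continuous : forall w (t : R), 0 <= t ->
  \forall s \near t^'+, X s w = X t w.
Hypothesis tau_gt0 : 0 < tau.
Hypotheses (c_ge0 : 0 <= c) (B_ge0 : 0 <= B).
Hypothesis G_ge0 : forall t x, 0 <= G t x.
Hypothesis G_continuous : forall x, continuous (G ^~ x).
Hypothesis QG : forall t del x, 0 <= t -> 0 < del <= 1 -> t + del <= tau ->
  G t x <= 1 ->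
  \sum_y Q del x y * G (t + del) y <= G t x + c * del + B * del ^+ 2.

Let mesh m : R := tau / (2 ^ m)%:R.
Let good m i x := G (i%:R * mesh m) x <= 1.
Let D m := exits (mesh m) (good m) (2 ^ m).

Let pow2_gt0 m : 0 < (2 ^ m)%:R :> R.
Proof. by rewrite ltr0n expn_gt0. Qed.

Let mesh_gt0 m : 0 < mesh m.
Proof. by rewrite divr_gt0. Qed.

Let D_measurable m : measurable (D m).
Proof. exact: exits_measurable. Qed.

Let meshS m i : (i * 2)%:R * mesh m.+1 = i%:R * mesh m.
Proof.
rewrite /mesh expnSr !natrM; have := pow2_gt0 m; move: (2 ^ m)%:R => a a0.
by field; rewrite gt_eqF.
Qed.

Let D_homo : {homo D : m n / (m <= n)%N >-> (m <= n)%O}.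
Proof.
apply: homo_leq => [m|x y z|m]; [exact: lexx|exact: le_trans|].
apply/subsetPset => w [Ew [i im gi]]; split => //; exists (i * 2)%N.
  by rewrite expnSr leq_mul2r im.
by move: gi; rewrite /good meshS.
Qed.

Let bound : R := \sum_x fine (P (E `&` [set w | X 0 w = x])) * G 0 x
  + c * tau * fine (P E).

Let mesh_small e : 0 < e -> \forall m \near \oo, mesh m < e.
Proof.
move=> e0; have h1 : `|2^-1 : R| < 1.
  by rewrite ger0_norm ?invr_ge0// invf_lt1// ltr1n.
have := @cvg_geometric R tau _ h1; move=> /cvgr_lt /(_ e e0).
by apply: filterS => m; rewrite /= /mesh natrX exprVn.
Qed.

Let D_le_mesh m : mesh m <= 1 ->
  fine (P (D m)) <= bound + B * tau * fine (P E) * mesh m.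
Proof.
move=> m1.
apply: le_trans (skeleton_maximal (mesh m) (good m) (mesh_gt0 m)
  (fun i => G (i%:R * mesh m)) (c * mesh m + B * mesh m ^+ 2) _ _ (2 ^ m) _ _) _.
- by move=> i x; exact: G_ge0.
- by move=> i x; rewrite /good -ltNge => /ltW.
- by rewrite addr_ge0// mulr_ge0 ?sqr_ge0// ltW.
- move=> i x im gi; rewrite -natr1 mulrDl mul1r addrA; apply: QG => //.
  + by rewrite mulr_ge0// ltW.
  + by rewrite mesh_gt0.
  + rewrite -{2}[mesh m]mul1r -mulrDl natr1 /mesh mulrCA ler_piMr//; first exact: ltW.
    by rewrite ler_pdivrMr// mul1r ler_nat.
rewrite /bound mul0r; under eq_bigr do rewrite /mass alive0 mul0r.
rewrite -addrA lerD2l; have -> : (2 ^ m)%:R = tau / mesh m.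
  by rewrite /mesh invf_div mulrCA divff ?mulr1// gt_eqF.
rewrite le_eqVlt; apply/orP; left; apply/eqP; field.
by rewrite gt_eqF.
Qed.

(** The mesh error disappears because [D m] is contained in [D n] for every finer grid n, to which
    the previous bound applies with a mesh as small as desired. In particular no uniformity is asked
    of [B]. *)
Let D_le m : fine (P (D m)) <= bound.
Proof.
apply/ler_addgt0Pr => e e0; set K := B * tau * fine (P E).
have K0 : 0 <= K by rewrite /K !mulr_ge0 ?fine_ge0// ltW.
have e1 : 0 < e / (K + 1) by rewrite divr_gt0// ltr_pwDr.
near \oo => n.
have mn : (m <= n)%N by near: n; exact: nbhs_infty_ge.
have n1 : mesh n <= 1 by apply: ltW; near: n; exact: mesh_small.
have ne : mesh n < e / (K + 1) by near: n; exact: mesh_small.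
apply: (@le_trans _ _ (fine (P (D n)))).
  rewrite fine_le ?fin_num_measure// le_measure ?inE//.
  exact/subsetPset/D_homo.
rewrite (le_trans (D_le_mesh _ n1))// lerD2l -/K.
move: ne; rewrite ltr_pdivlMr ?ltr_pwDr// => ne.
by have := mesh_gt0 n; nra.
Unshelve. all: by end_near. Qed.

(* For each state the set of times at which G exceeds 1 is open, so a right
   continuous path that makes G exceed 1 does so at a dyadic time. *)
Lemma chain_maximal_inequality : exists2 D : set Omega, measurable D /\
    (P D <= (\sum_x fine (P (E `&` [set w | X 0 w = x])) * G 0 x
             + c * tau * fine (P E))%:E)%E &
  forall w t, E w -> 0 <= t <= tau -> 1 < G t (X t w) -> D w.
Proof.
exists (\bigcup_m D m).
  split; first exact: bigcup_measurable.
  have cvD := @nondecreasing_cvg_mu _ _ _ P D D_measurable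
    (bigcup_measurable (fun k _ => D_measurable k)) D_homo.
  rewrite -(cvg_lim _ cvD)//; apply: lime_le; first exact: cvgP cvD.
  near=> m; rewrite /= -[X in (X <= _)%E]fineK ?fin_num_measure// lee_fin.
  exact: D_le.
move=> w t Ew /andP[t0 ttau] Gt; have [teq|tlt] := eqVneq t tau.
  (* A right neighbourhood of tau lies outside the time interval, but tau is itself the last point
     of every grid; the coarsest one, with a single step, is used. *)
  exists 0%N => //; split => //; exists 1%N => //.
  by rewrite /good /mesh expn0 divr1 mul1r -ltNge -teq.
have {}tlt : t < tau by rewrite lt_neqAle tlt.
have Gn : \forall s \near t, 1 < G s (X t w).
  by have /cvgr_gt := G_continuous (X t w) t; apply.
have : \forall s \near t^'+, [/\ s < tau, X s w = X t w & 1 < G s (X t w)].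
  near=> s; split.
  - by near: s; exact: nbhs_right_lt.
  - by near: s; exact: X_right_continuous.
  - by near: s; exact: cvg_within Gn.
move=> /nbhs_ballP[r /= r0 Hr].
near \oo => m.
have mr : mesh m < r by near: m; exact: mesh_small.
(* The grid point that follows t falls into the right neighbourhood where the state is still [X t w]
   and [G] still exceeds 1. *)
have /truncn_itv : 0 <= t / mesh m by rewrite divr_ge0// ltW.
set i := Num.trunc _ => /andP[it ti].
have s1 : t < i.+1%:R * mesh m by rewrite -ltr_pdivrMr.
have s2 : i%:R * mesh m <= t by rewrite -ler_pdivlMr.
have [|//|stau Xs Gs] := Hr (i.+1%:R * mesh m).
  rewrite /ball/= ltr_distlC -natr1; apply/andP; split; lra.
exists m => //; split => //; exists i.+1; last by rewrite /good Xs -ltNge.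
have : i.+1%:R * mesh m < (2 ^ m)%:R * mesh m.
  by rewrite [ltRHS]mulrCA mulfV ?mulr1// gt_eqF.
by rewrite ltr_pM2r// ltr_nat => /ltnW.
Unshelve. all: by end_near. Qed.

End continuous_time.
End chain_maximal_inequality.

(** * Drifts of the deviations *)

Section order_bounds.
Context {R : realType}.
Variable eps : R.
Hypothesis eps01 : 0 < eps <= 1.
Implicit Types (x y A B : R) (i j k : nat).

Definition order_le k A x := `|x| <= A * eps ^+ k.

Let eps_ge0 : 0 <= eps. Proof. by have /andP[/ltW] := eps01. Qed.

Lemma order_le_cst k A B x : A <= B -> order_le k A x -> order_le k B x.
Proof.
by move=> AB /le_trans; apply; rewrite ler_wpM2r// exprn_ge0.
Qed.

Lemma order_leD k A B x y : order_le k A x -> order_le k B y ->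
  order_le k (A + B) (x + y).
Proof.
move=> xA yB; rewrite /order_le mulrDl.
by rewrite (le_trans (ler_normD _ _))// lerD.
Qed.

Lemma order_leM i j A B x y : order_le i A x -> order_le j B y ->
  order_le (i + j) (A * B) (x * y).
Proof.
move=> xA yB; rewrite /order_le normrM exprD mulrACA.
by rewrite ler_pM.
Qed.

Lemma order_leZ k c A x : order_le k A x -> order_le k (`|c| * A) (c * x).
Proof.
by move=> xA; rewrite /order_le normrM -mulrA ler_wpM2l.
Qed.

(** The constant becomes [|A|] because no sign is known for the constants that the bookkeeping
    produces. *)
Lemma order_leW k j A x : (k <= j)%N -> order_le j A x -> order_le k `|A| x.
Proof.
move=> kj /le_trans; apply; rewrite (le_trans (ler_wpM2r _ (ler_norm A)))//.
  by rewrite exprn_ge0.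
rewrite ler_wpM2l// -(subnK kj) exprD ler_piMl ?exprn_ge0//.
by apply: exprn_ile1 => //; have /andP[] := eps01.
Qed.

End order_bounds.

Section drift_estimates.
Context {R : realType}.
Variables (beta gamma h : R).
Hypothesis beta_gt0 : 0 < beta.
Hypothesis gamma_gt0 : 0 < gamma.
Hypothesis h_gt0 : 0 < h.

Let cb := cosh beta.
Let sb := sinh beta.
Let tb := tanh beta.
Let ch := cosh (gamma * h).
Let sh := sinh (gamma * h).
Let th := tanh (gamma * h).
Let qeq := (tb * th * sh + sb) / (cb + ch).

(* The nonlinear remainders of the drifts: c1, S and S3 stand for
   cosh (gamma a) - 1, sinh (gamma a) and sinh (gamma a) - gamma a. *)
Section remainders.
Variables (a b p z q s H c1 S S3 : R).
(** The part of the remainder that is of order eps^3. The product S z and the linear term in H are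
    added in [rem_b] only: in the drift of x, H gives the limiting slope, and S z calls for the
    finer control of z. *)
Definition rem_x0 := (- 2 * ch) * (c1 * b) + (2 / ch) * S3 + (2 * sh) * (c1 * H).
Definition rem_b := rem_x0 + (- 2 * sh) * (S * z) + (2 * sh) * H.
Definition rem_z := (- 2 * ch) * (c1 * z) + (- 2 * sh) * (S * b) + (2 * ch) * (S * H).
Definition rem_q := (- 2 * ch) * (c1 * q) + (2 * sh) * (c1 * p)
  + (- 2 * sh) * (S * s) + (2 * ch) * (S * a)
  + (2 * (sh * tb * th - ch * qeq)) * c1.
Definition rem_s := (- 2 * ch) * (c1 * s) + (2 * sb) * H
  + (2 * (ch * tb * th - sh * qeq)) * S3
  + (- 2 * sh) * (S * q) + (2 * ch) * (S * p) + (2 * sh) * (c1 * a).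
Definition rem_w := (- tb * sh * (cb + 2 * ch)) * rem_b + (cb + ch) ^+ 2 * rem_s.
End remainders.

(** The tactic follows the syntax of a remainder, a sum of multiples of small quantities or of
    products of two of them; this dictates how the [rem] definitions are written. The constant of
    the final bound is an existential variable, instantiated along the way. *)
Ltac order_tac eps01 := first
  [ eapply order_leD; order_tac eps01
  | eapply order_leZ; eapply (order_leW _ eps01);
    [ | first [eassumption | eapply order_leM; eassumption]]; reflexivity ].

Definition small (M eps a b p z q s H c1 S S3 : R) :=
  [/\ order_le eps 1 M a, order_le eps 1 M b, order_le eps 1 M p,
      order_le eps 1 M z & order_le eps 1 M q] /\
  [/\ order_le eps 1 M s, order_le eps 2 M H, order_le eps 2 M c1,
      order_le eps 1 M S & order_le eps 3 M S3].

Section remainder_bounds.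
Variable M : R.

Lemma rem_x0_order : exists K, forall eps a b p z q s H c1 S S3,
  0 < eps <= 1 -> small M eps a b p z q s H c1 S S3 ->
  order_le eps 3 K (rem_x0 b H c1 S3).
Proof.
eexists => eps a b p z q s H c1 S S3 eps01 [[? ? ? ? ?] [? ? ? ? ?]].
by rewrite /rem_x0; order_tac eps01.
Qed.

Lemma rem_b_order : exists K, forall eps a b p z q s H c1 S S3,
  0 < eps <= 1 -> small M eps a b p z q s H c1 S S3 ->
  order_le eps 2 K (rem_b b z H c1 S S3).
Proof.
eexists => eps a b p z q s H c1 S S3 eps01 [[? ? ? ? ?] [? ? ? ? ?]].
by rewrite /rem_b /rem_x0; order_tac eps01.
Qed.

Lemma rem_z_order : exists K, forall eps a b p z q s H c1 S S3,
  0 < eps <= 1 -> small M eps a b p z q s H c1 S S3 ->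
  order_le eps 2 K (rem_z b z H c1 S).
Proof.
eexists => eps a b p z q s H c1 S S3 eps01 [[? ? ? ? ?] [? ? ? ? ?]].
by rewrite /rem_z; order_tac eps01.
Qed.

Lemma rem_q_order : exists K, forall eps a b p z q s H c1 S S3,
  0 < eps <= 1 -> small M eps a b p z q s H c1 S S3 ->
  order_le eps 2 K (rem_q a p q s c1 S).
Proof.
eexists => eps a b p z q s H c1 S S3 eps01 [[? ? ? ? ?] [? ? ? ? ?]].
by rewrite /rem_q; order_tac eps01.
Qed.

Lemma rem_s_order : exists K, forall eps a b p z q s H c1 S S3,
  0 < eps <= 1 -> small M eps a b p z q s H c1 S S3 ->
  order_le eps 2 K (rem_s a p q s H c1 S S3).
Proof.
eexists => eps a b p z q s H c1 S S3 eps01 [[? ? ? ? ?] [? ? ? ? ?]].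
by rewrite /rem_s; order_tac eps01.
Qed.

End remainder_bounds.
End drift_estimates.

(** * The generator on empirical averages *)

Section averages.
Context {R : realType} {N : nat}.
Implicit Types f g : 'I_N -> R.

Lemma averageD f g : average (fun j => f j + g j) = average f + average g.
Proof. by rewrite /average big_split/= mulrDr. Qed.

Lemma averageZ c f : average (fun j => c * f j) = c * average f.
Proof. by rewrite /average -mulr_sumr mulrCA. Qed.

Lemma eq_average f g : f =1 g -> average f = average g.
Proof. by move=> fg; congr average; apply/funext. Qed.

Lemma average_cst (c : R) : (0 < N)%N -> average (fun _ : 'I_N => c) = c.
Proof.
move=> N0; rewrite /average sumr_const card_ord -[c *+ N]mulr_natl mulrA mulVf ?mul1r//.
by rewrite pnatr_eq0 -lt0n.
Qed.

Lemma average_abs_le f M : (0 < N)%N -> (forall j, `|f j| <= M) ->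
  `|average f| <= M.
Proof.
move=> N0 fM; rewrite -(average_cst M N0) /average normrM ger0_norm ?invr_ge0//.
rewrite ler_wpM2l ?invr_ge0// (le_trans (ler_norm_sum _ _ _))//.
exact: ler_sum.
Qed.

End averages.

Lemma spinN {R : realType} b : spin (~~ b) = - spin b :> R.
Proof. by case: b; rewrite /spin /= ?opprK. Qed.

Lemma spin_norm {R : realType} b : `|spin b : R| = 1.
Proof. by case: b; rewrite /spin ?normrN normr1. Qed.

Section flips.
Context {R : realType} {N : nat}.
Implicit Types (x : state N) (f : state N -> R) (K : R).

Definition flip_sigma j x : state N := (flip j x.1, x.2).
Definition flip_omega j x : state N := (x.1, flip j x.2).

Definition flip_lipschitz K f := forall j x,
  `|f (flip_sigma j x) - f x| <= K / N%:R /\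
  `|f (flip_omega j x) - f x| <= K / N%:R.

Lemma flip_lipschitzD K1 K2 f1 f2 : flip_lipschitz K1 f1 -> flip_lipschitz K2 f2 ->
  flip_lipschitz (K1 + K2) (fun x => f1 x + f2 x).
Proof.
move=> l1 l2 j x; have [a1 b1] := l1 j x; have [a2 b2] := l2 j x.
by split; rewrite opprD addrACA mulrDl (le_trans (ler_normD _ _))// lerD.
Qed.

Lemma flip_lipschitzZ K c f : flip_lipschitz K f ->
  flip_lipschitz (`|c| * K) (fun x => c * f x).
Proof.
move=> l j x; have [a1 b1] := l j x.
by split; rewrite -mulrBr normrM -mulrA ler_wpM2l.
Qed.

Lemma flip_lipschitz_cst c : flip_lipschitz 0 (fun=> c).
Proof. by move=> j x; rewrite subrr normr0 mul0r. Qed.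

Variable e : config N.
Variable g : bool -> bool -> bool -> R.

Definition obs x : R := average (fun j => g (x.1 j) (x.2 j) (e j)).

Lemma obs_flip_sigma j x : obs (flip_sigma j x) - obs x =
  N%:R^-1 * (g (~~ x.1 j) (x.2 j) (e j) - g (x.1 j) (x.2 j) (e j)).
Proof.
rewrite /obs /average -mulrBr; congr (_ * _); rewrite (bigD1 j)//= [in X in _ - X](bigD1 j)//=.
rewrite ffunE eqxx opprD addrACA [X in _ + X](_ : _ = 0) ?addr0//.
rewrite -sumrB big1// => i ij.
by rewrite ffunE (negbTE ij) subrr.
Qed.

Lemma obs_flip_omega j x : obs (flip_omega j x) - obs x =
  N%:R^-1 * (g (x.1 j) (~~ x.2 j) (e j) - g (x.1 j) (x.2 j) (e j)).
Proof.
rewrite /obs /average -mulrBr; congr (_ * _); rewrite (bigD1 j)//= [in X in _ - X](bigD1 j)//=.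
rewrite ffunE eqxx opprD addrACA [X in _ + X](_ : _ = 0) ?addr0//.
rewrite -sumrB big1// => i ij.
by rewrite ffunE (negbTE ij) subrr.
Qed.

Lemma obs_lipschitz : (forall s o c, `|g s o c| <= 1) -> flip_lipschitz 2 obs.
Proof.
move=> g1 j x; rewrite obs_flip_sigma obs_flip_omega !normrM ger0_norm ?invr_ge0//.
rewrite ![N%:R^-1 * _]mulrC !ler_wpM2r ?invr_ge0//;
  by rewrite (le_trans (ler_normB _ _))// (_ : 2 = 1 + 1)// lerD.
Qed.

End flips.

Section generator_calculus.
Context {R : realType} (beta gamma h : R) {N : nat} (e : config N).
Hypothesis beta_gt0 : 0 < beta.
Hypothesis gamma_gt0 : 0 < gamma.
Hypothesis h_gt0 : 0 < h.
Hypothesis N_gt0 : (0 < N)%N.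
Notation L := (generator beta gamma h e).
Implicit Types (x : state N) (f g : state N -> R).

Let rate_sigma (j : 'I_N) x := expR (- beta * spin (x.1 j) * spin (x.2 j)) : R.
Let rate_omega (j : 'I_N) x :=
  expR (- gamma * spin (x.2 j) * (m_sigma x + h * spin (e j))) : R.

Definition rate_bound : R := expR beta + expR (gamma * (1 + h)).

Lemma generator_linear c f g x :
  L (fun y => c * f y + g y) x = c * L f x + L g x.
Proof.
rewrite /generator mulrDr addrACA !mulr_sumr -!big_split/=.
by apply: eq_bigr => j _; ring.
Qed.

Lemma generatorZ c f x : L (fun y => c * f y) x = c * L f x.
Proof.
rewrite /generator mulrDr !mulr_sumr.
by congr (_ + _); apply: eq_bigr => j _; ring.
Qed.

Lemma generatorD f g x : L (fun y => f y + g y) x = L f x + L g x.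
Proof.
rewrite /generator addrACA -!big_split/=.
by apply: eq_bigr => j _; ring.
Qed.

Lemma generator_cst c x : L (fun=> c) x = 0.
Proof.
by rewrite /generator !big1 ?addr0// => j _; rewrite subrr mulr0.
Qed.

Lemma m_sigma_le1 x : `|m_sigma x : R| <= 1.
Proof. by apply: average_abs_le => // j; rewrite spin_norm. Qed.

Lemma rate_sigma_le j x : rate_sigma j x <= expR beta.
Proof.
rewrite ler_expR (le_trans (ler_norm _))// !normrM normrN !spin_norm !mulr1.
by rewrite ger0_norm// ltW.
Qed.

Lemma rate_omega_le j x : rate_omega j x <= expR (gamma * (1 + h)).
Proof.
rewrite ler_expR (le_trans (ler_norm _))// !normrM normrN spin_norm mulr1.
rewrite (ger0_norm (ltW gamma_gt0)) ler_wpM2l ?(ltW gamma_gt0)//.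
rewrite (le_trans (ler_normD _ _))// lerD ?m_sigma_le1//.
by rewrite normrM spin_norm mulr1 ger0_norm// ltW.
Qed.

Lemma sum_rate_le (f g : 'I_N -> R) M x :
  (forall j, `|f j| <= M) -> (forall j, `|g j| <= M) ->
  `|\sum_j rate_sigma j x * f j + \sum_j rate_omega j x * g j| <=
  N%:R * rate_bound * M.
Proof.
move=> fM gM; rewrite (le_trans (ler_normD _ _))// /rate_bound mulrDr mulrDl.
have sumM c : N%:R * c * M = \sum_(j < N) c * M.
  by rewrite sumr_const card_ord -mulrA mulr_natl.
rewrite !sumM lerD// (le_trans (ler_norm_sum _ _ _))// ler_sum// => j _;
  rewrite normrM ler_pM// ger0_norm ?expR_ge0//.
- exact: rate_sigma_le.
- exact: rate_omega_le.
Qed.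

Lemma rate_bound_ge0 : 0 <= rate_bound.
Proof. by rewrite addr_ge0 ?expR_ge0. Qed.

Lemma generator_bound f M : (forall x, `|f x| <= M) ->
  forall x, `|L f x| <= N%:R * rate_bound * 2 * M.
Proof.
move=> fM x; rewrite -mulrA; apply: sum_rate_le => j.
  by rewrite (le_trans (ler_normB _ _))// mulr_natl mulr2n lerD.
by rewrite (le_trans (ler_normB _ _))// mulr_natl mulr2n lerD.
Qed.

(* L(f^2) - 2 f L f is the sum of the squared jumps of f weighted by their rates. *)
Lemma generator_sqr K f x : flip_lipschitz K f ->
  L (fun y => f y ^+ 2) x <=
  2 * f x * L f x + rate_bound * K ^+ 2 / N%:R.
Proof.
move=> fK; rewrite -lerBlDl (le_trans (ler_norm _))//.
rewrite (_ : _ - _ =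
    \sum_j rate_sigma j x * (f (flip_sigma j x) - f x) ^+ 2 +
    \sum_j rate_omega j x * (f (flip_omega j x) - f x) ^+ 2); last first.
  rewrite /generator mulrDr !mulr_sumr opprD addrACA -!sumrB.
  by congr (_ + _); apply: eq_bigr => j _;
    rewrite /rate_sigma /rate_omega /flip_sigma /flip_omega; ring.
rewrite (_ : _ / _ = N%:R * rate_bound * (K / N%:R) ^+ 2); last first.
  by field; rewrite pnatr_eq0 -lt0n.
apply: sum_rate_le => j; have [f1 f2] := fK j x.
- by rewrite normrX lerXn2r ?nnegrE// (le_trans _ f1).
- by rewrite normrX lerXn2r ?nnegrE// (le_trans _ f2).
Qed.

Lemma generator_obs (g : bool -> bool -> bool -> R) x :
  L (obs e g) x = average (fun j =>
    rate_sigma j x * (g (~~ x.1 j) (x.2 j) (e j) - g (x.1 j) (x.2 j) (e j)) +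
    rate_omega j x * (g (x.1 j) (~~ x.2 j) (e j) - g (x.1 j) (x.2 j) (e j))).
Proof.
rewrite averageD /generator /average !mulr_sumr; congr (_ + _);
  apply: eq_bigr => j _; rewrite [RHS]mulrCA; congr (_ * _).
- by rewrite -(obs_flip_sigma e g).
- by rewrite -(obs_flip_omega e g).
Qed.

Let cb := cosh beta.
Let sb := sinh beta.
Let ch := cosh (gamma * h).
Let sh := sinh (gamma * h).
Let C x := cosh (gamma * m_sigma x).
Let S x := sinh (gamma * m_sigma x).

(** For a sign s, exp (s u) = cosh u + s sinh u, so the rates are polynomials in the spins with
    coefficients depending on [m_sigma] alone. This is what closes the drifts on the seven empirical
    averages. *)
Let rate_sigmaE j x :
  rate_sigma j x = cb - spin (x.1 j) * spin (x.2 j) * sb.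
Proof.
rewrite /rate_sigma expR_cosh_sinh /cb /sb.
case: (x.1 j); case: (x.2 j); rewrite /spin ?(mulr1, mulrN, mulNr, opprK) ?coshN ?sinhN; ring.
Qed.

Let rate_omegaE j x : rate_omega j x =
  C x * ch + spin (e j) * S x * sh
  - spin (x.2 j) * (S x * ch + spin (e j) * C x * sh).
Proof.
have -> : rate_omega j x =
    expR (- (spin (x.2 j) * (gamma * m_sigma x + gamma * h * spin (e j)))).
  by congr expR; ring.
rewrite expR_cosh_sinh /C /S /ch /sh.
case: (x.2 j); case: (e j); rewrite /spin ?(mulr1, mulrN, mulNr, mul1r, opprK);
  rewrite ?opprD ?opprK !(coshD, sinhD) ?(coshN, sinhN); ring.
Qed.

(** Constant terms of the drifts are written as averages of constants. Each identity below then
    compares two averages and is checked at a single site, for the eight values of (sigma, omega,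
    eta). *)
Let one : R := average (fun _ : 'I_N => 1).
Let mul_one t : t = t * one.
Proof. by rewrite /one average_cst// mulr1. Qed.

Ltac generator_tac x :=
  rewrite generator_obs /one /m_eta /m_sigma /m_omega /m_sigma_eta /m_omega_eta
    /m_sigma_omega /m_sigma_omega_eta -?averageZ -?averageD;
  apply: eq_average;
  let j := fresh "j" in intro j; rewrite rate_sigmaE rate_omegaE;
  case: (x.1 j); case: (x.2 j); case: (e j); rewrite /spin /=; ring.

Lemma generator_m_sigma x :
  L m_sigma x = - 2 * cb * m_sigma x + 2 * sb * m_omega x.
Proof. rewrite -[m_sigma]/(obs e (fun s _ _ => spin s)); generator_tac x. Qed.

Lemma generator_m_omega x :
  L m_omega x = - 2 * C x * ch * m_omega x - 2 * S x * sh * m_omega_eta e x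
    + 2 * S x * ch + 2 * C x * sh * m_eta e.
Proof.
rewrite [2 * S x * ch]mul_one -!mulNr.
rewrite -[m_omega]/(obs e (fun _ o _ => spin o)); generator_tac x.
Qed.

Lemma generator_m_sigma_eta x :
  L (m_sigma_eta e) x = - 2 * cb * m_sigma_eta e x + 2 * sb * m_omega_eta e x.
Proof.
rewrite -[m_sigma_eta e]/(obs e (fun s _ c => spin s * spin c)).
generator_tac x.
Qed.

Lemma generator_m_omega_eta x :
  L (m_omega_eta e) x = - 2 * C x * ch * m_omega_eta e x
    - 2 * S x * sh * m_omega x + 2 * S x * ch * m_eta e + 2 * C x * sh.
Proof.
rewrite [2 * C x * sh]mul_one -!mulNr.
rewrite -[m_omega_eta e]/(obs e (fun _ o c => spin o * spin c)).
generator_tac x.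
Qed.

Lemma generator_m_sigma_omega x :
  L m_sigma_omega x = - 2 * (cb + C x * ch) * m_sigma_omega x + 2 * sb
    - 2 * S x * sh * m_sigma_omega_eta e x + 2 * S x * ch * m_sigma x
    + 2 * C x * sh * m_sigma_eta e x.
Proof.
rewrite [2 * sb]mul_one -!mulNr.
rewrite -[m_sigma_omega]/(obs e (fun s o _ => spin s * spin o)).
generator_tac x.
Qed.

Lemma generator_m_sigma_omega_eta x :
  L (m_sigma_omega_eta e) x =
    - 2 * (cb + C x * ch) * m_sigma_omega_eta e x + 2 * sb * m_eta e
    - 2 * S x * sh * m_sigma_omega x + 2 * S x * ch * m_sigma_eta e x
    + 2 * C x * sh * m_sigma x.
Proof.
rewrite -!mulNr.
rewrite -[m_sigma_omega_eta e]/(obs e (fun s o c => spin s * spin o * spin c)).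
generator_tac x.
Qed.

End generator_calculus.

Section deviations.
Context {R : realType} (beta gamma h : R) {N : nat} (e : config N).
Hypothesis beta_gt0 : 0 < beta.
Hypothesis gamma_gt0 : 0 < gamma.
Hypothesis h_gt0 : 0 < h.
Hypothesis critical : gamma = cosh (gamma * h) ^+ 2 / tanh beta.
Hypothesis N_gt0 : (0 < N)%N.
Notation L := (generator beta gamma h e).
Implicit Types x : state N.

Let cb := cosh beta.
Let sb := sinh beta.
Let tb := tanh beta.
Let ch := cosh (gamma * h).
Let sh := sinh (gamma * h).
Let th := tanh (gamma * h).
Let qeq := (tb * th * sh + sb) / (cb + ch).

(** With [dev_v], these are the left eigenvectors of the linearised drift of ([m_sigma], [m_omega])
    at criticality, for the eigenvalues 0 and -2 (cosh beta + cosh (gamma h)). *)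
Definition dev_x x := ch * m_sigma x + sb * m_omega x.
Definition dev_v x := cb * m_sigma x - sb * m_omega x.
Definition dev_z x := m_omega_eta e x - th.
Definition dev_p x := m_sigma_eta e x - tb * th.
Definition dev_q x := m_sigma_omega x - qeq.
(** The multiple of [m_omega] removes the neutral direction x from the linear drift, which leaves
    [dev_v] as the only driving term. *)
Definition dev_w x := - tb * sh * (cb + 2 * ch) * m_omega x
  + (cb + ch) ^+ 2 * m_sigma_omega_eta e x.

Let c1 x := cosh (gamma * m_sigma x) - 1.
Let S x := sinh (gamma * m_sigma x).
Let S3 x := sinh (gamma * m_sigma x) - gamma * m_sigma x.
Let H : R := m_eta e.

Let cb0 : cb != 0. Proof. by rewrite gt_eqF ?cosh_gt0. Qed.
Let ch0 : ch != 0. Proof. by rewrite gt_eqF ?cosh_gt0. Qed.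
Let sb0 : sb != 0. Proof. by rewrite gt_eqF ?sinh_gt0. Qed.
Let cbch0 : cb + ch != 0. Proof. by rewrite gt_eqF ?addr_gt0 ?cosh_gt0. Qed.
Let sh2 : sh ^+ 2 = ch ^+ 2 - 1.
Proof. by have := cosh2_sinh2 (gamma * h); rewrite -/ch -/sh; lra. Qed.
Let tbE : tb = sb / cb. Proof. by []. Qed.
Let thE : th = sh / ch. Proof. by []. Qed.
Let gammaE : gamma = ch ^+ 2 * cb / sb.
Proof. by rewrite critical -/ch -/tb tbE; field; rewrite cb0 sb0. Qed.

Let rb x := rem_b gamma h (m_omega x) (dev_z x) H (c1 x) (S x) (S3 x).

(** The criticality condition acts here. Once cosh and sinh of gamma [m_sigma] are generalised to
    variables, gamma is replaced by its critical value, and the claim is an identity of rational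
    functions modulo sh^2 = ch^2 - 1. *)
Ltac drift_tac x :=
  rewrite -/cb -/sb -/ch -/sh -/th -/tb -/H ?thE ?tbE;
  move: (cosh (gamma * m_sigma x)) (sinh (gamma * m_sigma x)) => C S';
  rewrite ?gammaE; field: sh2; rewrite ?cb0 ?ch0 ?sb0 ?cbch0//.

Let generator_omega x :
  L m_omega x = - 2 * ch * m_omega x + 2 * gamma / ch * m_sigma x + rb x.
Proof.
rewrite generator_m_omega// /rb /rem_b /rem_x0 /dev_z /c1 /S /S3.
rewrite -/ch -/sh -/th -/H; drift_tac x.
Qed.

Lemma generator_dev_x x : L dev_x x = 2 * sb * sh * H +
  sb * (rem_x0 gamma h (m_omega x) H (c1 x) (S3 x) + (- 2 * sh) * (S x * dev_z x)).
Proof.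
rewrite generator_linear (generatorZ _ _ _ _ sb) generator_m_sigma// generator_omega.
rewrite /rb /rem_b /rem_x0 /dev_z /c1 /S /S3.
rewrite -/cb -/sb -/ch -/sh -/th -/H; drift_tac x.
Qed.

Lemma generator_dev_v x : L dev_v x = - 2 * (cb + ch) * dev_v x - sb * rb x.
Proof.
rewrite (_ : dev_v = fun x => cb * m_sigma x + (- sb) * m_omega x); last first.
  by apply/funext => y; rewrite mulNr.
rewrite generator_linear (generatorZ _ _ _ _ (- sb)) generator_m_sigma// generator_omega.
rewrite /dev_v; move: (rb x) => r; drift_tac x.
Qed.

Lemma generator_dev_z x : L dev_z x = - 2 * ch * dev_z x +
  rem_z gamma h (m_omega x) (dev_z x) H (c1 x) (S x).
Proof.
rewrite generatorD generator_cst addr0 generator_m_omega_eta//.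
rewrite /rem_z /dev_z /c1 /S -/ch -/sh -/th -/H; drift_tac x.
Qed.

Lemma generator_dev_p x : L dev_p x = - 2 * cb * dev_p x + 2 * sb * dev_z x.
Proof.
rewrite generatorD generator_cst addr0 generator_m_sigma_eta//.
rewrite /dev_z /dev_p -/cb -/sb -/th -/tb; drift_tac x.
Qed.

Lemma generator_dev_q x : L dev_q x = - 2 * (cb + ch) * dev_q x + 2 * sh * dev_p x
  + rem_q beta gamma h (m_sigma x) (dev_p x) (dev_q x) (m_sigma_omega_eta e x)
      (c1 x) (S x).
Proof.
rewrite generatorD generator_cst addr0 (generator_m_sigma_omega _ _ _ e)//.
rewrite /rem_q /dev_q /dev_p /c1 /S /qeq -/cb -/sb -/ch -/sh -/th -/tb; drift_tac x.
Qed.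

Lemma generator_dev_w x : L dev_w x = - 2 * (cb + ch) * dev_w x
  + 2 * sh * (cb + 2 * ch) * dev_v x
  + rem_w beta gamma h (m_sigma x) (m_omega x) (dev_p x) (dev_z x) (dev_q x)
      (m_sigma_omega_eta e x) H (c1 x) (S x) (S3 x).
Proof.
rewrite generator_linear generatorZ generator_m_sigma_omega_eta// generator_omega.
rewrite /rem_w -/(rb x); move: (rb x) => r.
rewrite /rem_s /dev_q /dev_p /dev_w /dev_v /c1 /S /S3 -/cb -/sb -/ch -/sh -/th -/tb -/H.
rewrite -/qeq /qeq; drift_tac x.
Qed.

End deviations.

(** * A quadratic Lyapunov function *)

Section lyapunov.
Context {R : realType} (beta gamma h : R).
Hypothesis beta_gt0 : 0 < beta.
Hypothesis gamma_gt0 : 0 < gamma.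
Hypothesis h_gt0 : 0 < h.
Hypothesis critical : gamma = cosh (gamma * h) ^+ 2 / tanh beta.

Let cb := cosh beta.
Let sb := sinh beta.
Let tb := tanh beta.
Let ch := cosh (gamma * h).
Let sh := sinh (gamma * h).
Let th := tanh (gamma * h).

(** The weights go back along the chains z, p, q and v, w of influences: each is large enough for
    the weighted square of the term that a coordinate feeds into the next drift to be at most twice
    the weighted square of that coordinate, which is what its contraction supplies. *)
Let wp := 1 + 2 * sh ^+ 2.
Let wv := 1 + (2 * sh * (cb + 2 * ch)) ^+ 2.
Let wz := 1 + 2 * wp * sb ^+ 2.

Definition lyapunov {N} (e : config N) (x : state N) : R :=
  wz * dev_z gamma h e x ^+ 2 + wv * dev_v beta x ^+ 2 +
  wp * dev_p beta gamma h e x ^+ 2 + dev_q beta gamma h x ^+ 2 +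
  dev_w beta gamma h e x ^+ 2.

Let wp_ge1 : 1 <= wp. Proof. by rewrite lerDl mulr_ge0// sqr_ge0. Qed.
Let wv_ge1 : 1 <= wv. Proof. by rewrite lerDl sqr_ge0. Qed.
Let wz_ge1 : 1 <= wz.
Proof. by have := sqr_ge0 sb; have := wp_ge1; rewrite /wz; nra. Qed.
Let cb1 : 1 <= cb. Proof. exact: cosh_ge1. Qed.
Let ch1 : 1 <= ch. Proof. exact: cosh_ge1. Qed.
Let sb_gt0 : 0 < sb. Proof. exact: sinh_gt0. Qed.
Let sh_gt0 : 0 < sh. Proof. by apply: sinh_gt0; exact: mulr_gt0. Qed.

Lemma lyapunov_ge0 N (e : config N) (x : state N) : 0 <= lyapunov e x.
Proof.
by rewrite !addr_ge0// ?sqr_ge0// mulr_ge0 ?sqr_ge0//;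
  [exact: le_trans wz_ge1|exact: le_trans wv_ge1|exact: le_trans wp_ge1].
Qed.

Lemma lyapunov_devs N (e : config N) (x : state N) (r : R) : 0 <= r ->
  lyapunov e x <= r ^+ 2 ->
  [/\ `|dev_z gamma h e x| <= r, `|dev_v beta x| <= r,
      `|dev_p beta gamma h e x| <= r, `|dev_q beta gamma h x| <= r &
      `|dev_w beta gamma h e x| <= r].
Proof.
move=> r0; rewrite /lyapunov.
move: (dev_z _ _ _ _) (dev_v _ _) (dev_p _ _ _ _ _) (dev_q _ _ _ _) (dev_w _ _ _ _ _).
move=> z v p q w Vr.
have z2 := sqr_ge0 z; have v2 := sqr_ge0 v; have p2 := sqr_ge0 p.
have q2 := sqr_ge0 q; have w2 := sqr_ge0 w.
have h1 := ler_wpM2r z2 wz_ge1; have h2 := ler_wpM2r v2 wv_ge1.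
have h3 := ler_wpM2r p2 wp_ge1.
have sq (y : R) : y ^+ 2 <= r ^+ 2 -> `|y| <= r.
  by rewrite -[y ^+ 2]real_normK ?num_real// ler_pXn2r// nnegrE.
by split; apply: sq; lra.
Qed.

(** The averages of sigma and omega are recovered from [dev_x] and [dev_v], and that of sigma omega
    eta from [dev_w]. The denominators cosh beta + cosh (gamma h) are at least 1 and are dropped;
    sinh beta is kept in [Mb]. The threshold on eps ensures |gamma [m_sigma]| <= 1, the range of the
    bounds on the hyperbolic functions. [M] is a sum of nonnegative terms, so it dominates each of
    the constants found. *)
Lemma small_region (M0 : R) : exists M eps0 : R, 0 < eps0 /\
  forall N (e : config N) (x : state N) (eps : R),
  0 < eps <= 1 -> eps <= eps0 ->
  `|dev_x beta gamma h x| <= M0 * eps -> lyapunov e x <= eps ^+ 2 ->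
  `|m_eta e : R| <= M0 * eps ^+ 2 ->
  small M eps (m_sigma x) (m_omega x) (dev_p beta gamma h e x)
    (dev_z gamma h e x) (dev_q beta gamma h x) (m_sigma_omega_eta e x)
    (m_eta e) (cosh (gamma * m_sigma x) - 1) (sinh (gamma * m_sigma x))
    (sinh (gamma * m_sigma x) - gamma * m_sigma x).
Proof.
pose Ma := `|M0| + 1; pose Mb := (cb * `|M0| + ch) / sb.
pose Ms := 1 + tb * sh * (cb + 2 * ch) * Mb.
pose E := expR 1 : R.
exists (1 + Ma + Mb + Ms + E * gamma ^+ 2 * Ma ^+ 2 + E * gamma * Ma
  + E * gamma ^+ 3 * Ma ^+ 3 + `|M0|).
have Ma0 : 0 < Ma by rewrite ltr_wpDl.
exists (gamma * Ma)^-1; split; first by rewrite invr_gt0 mulr_gt0.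
move=> N e x eps /andP[eps0 eps1] epsM xM Ve HM.
have [z1 v1 p1 q1 w1] := lyapunov_devs _ _ _ _ (ltW eps0) Ve.
have xM' : `|dev_x beta gamma h x| <= `|M0| * eps.
  by rewrite (le_trans xM)// ler_wpM2r ?(ltW eps0)// ler_norm.
set a := m_sigma x; set b := m_omega x; set s := m_sigma_omega_eta e x.
have divD (y D A : R) : 1 <= D -> `|y| <= A -> `|y / D| <= A.
  move=> D1 yA; have D0 : 0 < D := lt_le_trans ltr01 D1.
  rewrite normrM normfV (ger0_norm (ltW D0)) ler_pdivrMr// (le_trans yA)//.
  by rewrite ler_peMr// (le_trans (normr_ge0 y)).
have chcb1 : 1 <= ch + cb by have := cb1; have := ch1; lra.
have chcb0 : ch + cb != 0 by rewrite gt_eqF//; lra.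
have aM : `|a| <= Ma * eps.
  have -> : a = (dev_x beta gamma h x + dev_v beta x) / (ch + cb).
    by rewrite /dev_x /dev_v -/cb -/sb -/ch -/a; field.
  by apply: divD => //; rewrite (le_trans (ler_normD _ _))// mulrDl mul1r lerD.
have bM : `|b| <= Mb * eps.
  have -> : b = (cb * dev_x beta gamma h x - ch * dev_v beta x) / sb / (ch + cb).
    rewrite /dev_x /dev_v -/cb -/sb -/ch -/a -/b; field.
    by rewrite chcb0 gt_eqF.
  apply: divD => //; rewrite normrM normfV (gtr0_norm sb_gt0) /Mb [leRHS]mulrAC.
  rewrite ler_wpM2r ?invr_ge0 ?(ltW sb_gt0)// (le_trans (ler_normB _ _))//.
  rewrite (normrM cb) (normrM ch) (ger0_norm (le_trans ler01 cb1)) (ger0_norm (le_trans ler01 ch1)).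
  have := ler_wpM2l (le_trans ler01 cb1) xM'.
  by have := ler_wpM2l (le_trans ler01 ch1) v1; lra.
have tb_ge0 : 0 <= tb.
  exact: divr_ge0 (ltW sb_gt0) (le_trans ler01 cb1).
have Kw0 : 0 <= tb * sh * (cb + 2 * ch).
  apply: mulr_ge0; first exact: mulr_ge0 (ltW sh_gt0).
  by have := cb1; have := ch1; lra.
have sM : `|s| <= Ms * eps.
  have -> : s = (dev_w beta gamma h e x + tb * sh * (cb + 2 * ch) * b) / (cb + ch) ^+ 2.
    rewrite /dev_w -/cb -/tb -/ch -/sh -/b -/s; field.
    by rewrite addrC.
  apply: divD; first by apply: exprn_ege1; rewrite addrC.
  rewrite (le_trans (ler_normD _ _))// (normrM (tb * sh * (cb + 2 * ch))).
  by rewrite (ger0_norm Kw0) /Ms; have := ler_wpM2l Kw0 bM; lra.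
have ga : `|gamma * a| <= gamma * Ma * eps.
  by rewrite normrM (gtr0_norm gamma_gt0) -mulrA ler_wpM2l// ltW.
have ga1 : `|gamma * a| <= 1.
  rewrite (le_trans ga)//.
  by rewrite -(@ler_pM2r _ (gamma * Ma)^-1) ?invr_gt0 ?mulr_gt0//
    mulrAC mulfV ?mul1r ?gt_eqF ?mulr_gt0.
have gM0 : gamma * Ma * eps \is Num.nneg.
  by rewrite nnegrE (le_trans (normr_ge0 _) ga).
have E0 : 0 <= E by exact: expR_ge0.
have Mb0 : 0 <= Mb.
  apply: divr_ge0 (ltW sb_gt0).
  have := mulr_ge0 (le_trans ler01 cb1) (normr_ge0 M0).
  by have := ch1; lra.
have Ms0 : 0 <= Ms by rewrite addr_ge0// mulr_ge0.
have Ea : 0 <= E * gamma * Ma by rewrite !mulr_ge0// ltW.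
have Ea2 : 0 <= E * gamma ^+ 2 * Ma ^+ 2.
  exact: mulr_ge0 (mulr_ge0 E0 (sqr_ge0 _)) (sqr_ge0 _).
have Ea3 : 0 <= E * gamma ^+ 3 * Ma ^+ 3.
  by rewrite (mulr_ge0 (mulr_ge0 E0 _))// exprn_ge0// ltW.
have M00 : 0 <= `|M0| by exact: normr_ge0.
have eps01 : 0 < eps <= 1 by rewrite eps0.
have Ma0' := ltW Ma0.
have le_one k (A y B : R) : A <= B -> `|y| <= A * eps ^+ k -> order_le eps k B y.
  by move=> AB yA; exact: (order_le_cst _ eps01 k A).
split; split.
- by apply: (le_one _ Ma); [lra|rewrite expr1].
- by apply: (le_one _ Mb); [lra|rewrite expr1].
- by apply: (le_one _ 1); [lra|rewrite mul1r expr1].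
- by apply: (le_one _ 1); [lra|rewrite mul1r expr1].
- by apply: (le_one _ 1); [lra|rewrite mul1r expr1].
- by apply: (le_one _ Ms); [lra|rewrite expr1].
- apply: (le_one _ `|M0|); first lra.
  by rewrite (le_trans HM)// ler_wpM2r ?sqr_ge0// ler_norm.
- apply: (le_one _ (E * gamma ^+ 2 * Ma ^+ 2)); first lra.
  rewrite (_ : _ * eps ^+ 2 = E * (gamma * Ma * eps) ^+ 2); last by ring.
  rewrite (le_trans (cosh1_bound _ ga1))// ler_wpM2l//.
  by rewrite -[leLHS]real_normK ?num_real// lerXn2r.
- apply: (le_one _ (E * gamma * Ma)); first lra.
  rewrite (le_trans (sinh_bound _ ga1))//.
  by rewrite (_ : _ * eps ^+ 1 = E * (gamma * Ma * eps)) ?ler_wpM2l//; ring.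
- apply: (le_one _ (E * gamma ^+ 3 * Ma ^+ 3)); first lra.
  rewrite (_ : _ * eps ^+ 3 = E * (gamma * Ma * eps) ^+ 3); last by ring.
  by rewrite (le_trans (sinh_id_bound _ ga1))// ler_wpM2l// lerXn2r.
Qed.

Let small_state (M eps : R) {N : nat} (e : config N) (x : state N) :=
  small M eps (m_sigma x) (m_omega x) (dev_p beta gamma h e x)
    (dev_z gamma h e x) (dev_q beta gamma h x) (m_sigma_omega_eta e x)
    (m_eta e) (cosh (gamma * m_sigma x) - 1) (sinh (gamma * m_sigma x))
    (sinh (gamma * m_sigma x) - gamma * m_sigma x).

Let lipschitz_m N (e : config N) :
  [/\ flip_lipschitz 2 (@m_sigma R N), flip_lipschitz 2 (@m_omega R N),
      flip_lipschitz 2 (@m_sigma_omega R N), flip_lipschitz 2 (@m_sigma_eta R N e) &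
      flip_lipschitz 2 (@m_omega_eta R N e)] /\
  flip_lipschitz 2 (@m_sigma_omega_eta R N e).
Proof.
split; first split.
- apply: (obs_lipschitz e (fun s _ _ => spin s)) => *;
    by rewrite ?normrM !spin_norm ?mulr1.
- apply: (obs_lipschitz e (fun _ o _ => spin o)) => *;
    by rewrite ?normrM !spin_norm ?mulr1.
- apply: (obs_lipschitz e (fun s o _ => spin s * spin o)) => *;
    by rewrite ?normrM !spin_norm ?mulr1.
- apply: (obs_lipschitz e (fun s _ c => spin s * spin c)) => *;
    by rewrite ?normrM !spin_norm ?mulr1.
- apply: (obs_lipschitz e (fun _ o c => spin o * spin c)) => *;
    by rewrite ?normrM !spin_norm ?mulr1.
- apply: (obs_lipschitz e (fun s o c => spin s * spin o * spin c)) => *;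
    by rewrite ?normrM !spin_norm ?mulr1.
Qed.

Ltac lipschitz_tac := first
  [ apply: flip_lipschitz_cst | eassumption
  | eapply flip_lipschitzD; lipschitz_tac
  | eapply flip_lipschitzZ; lipschitz_tac ].

Lemma dev_x_lipschitz : exists K, forall N : nat,
  flip_lipschitz K (@dev_x R beta gamma h N).
Proof.
eexists => N; have [[? ? ? ? ?] ?] := lipschitz_m N [ffun=> true].
by rewrite /dev_x; lipschitz_tac.
Qed.

Lemma dev_v_lipschitz : exists K, forall N : nat,
  flip_lipschitz K (@dev_v R beta N).
Proof.
eexists => N; have [[? ? ? ? ?] ?] := lipschitz_m N [ffun=> true].
rewrite (_ : @dev_v R beta N = fun x => cb * m_sigma x + (- sb) * m_omega x).
  by lipschitz_tac.
by apply/funext => y; rewrite mulNr.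
Qed.

Lemma dev_z_lipschitz : exists K, forall N (e : config N),
  flip_lipschitz K (dev_z gamma h e).
Proof.
eexists => N e; have [[? ? ? ? ?] ?] := lipschitz_m N e.
by rewrite /dev_z; lipschitz_tac.
Qed.

Lemma dev_p_lipschitz : exists K, forall N (e : config N),
  flip_lipschitz K (dev_p beta gamma h e).
Proof.
eexists => N e; have [[? ? ? ? ?] ?] := lipschitz_m N e.
by rewrite /dev_p; lipschitz_tac.
Qed.

Lemma dev_q_lipschitz : exists K, forall N : nat,
  flip_lipschitz K (@dev_q R beta gamma h N).
Proof.
eexists => N; have [[? ? ? ? ?] ?] := lipschitz_m N [ffun=> true].
by rewrite /dev_q; lipschitz_tac.
Qed.

Lemma dev_w_lipschitz : exists K, forall N (e : config N),
  flip_lipschitz K (dev_w beta gamma h e).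
Proof.
eexists => N e; have [[? ? ? ? ?] ?] := lipschitz_m N e.
by rewrite /dev_w; lipschitz_tac.
Qed.

(* Both cross terms are absorbed, by 2 f g <= f^2 + g^2, into the contraction. *)
Let stable_sqr N (e : config N) (f : state N -> R) (x : state N) (K k g r A eps : R) :
  (0 < N)%N -> N%:R^-1 = eps ^+ 4 -> 1 <= k ->
  flip_lipschitz K f ->
  generator beta gamma h e f x = - 2 * k * f x + g + r ->
  order_le eps 2 A r ->
  generator beta gamma h e (fun y => f y ^+ 2) x <=
  - 2 * f x ^+ 2 + g ^+ 2 + (A ^+ 2 + rate_bound beta gamma h * K ^+ 2) * eps ^+ 4.
Proof.
move=> N0 Neps k1 fK Lf rA.
have := generator_sqr beta gamma h e beta_gt0 gamma_gt0 h_gt0 N0 K f x fK.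
rewrite Lf Neps => /le_trans; apply.
have r2 : r ^+ 2 <= A ^+ 2 * eps ^+ 4.
  rewrite -[r ^+ 2]real_normK ?num_real// (exprM eps 2 2) -exprMn.
  by rewrite lerXn2r// nnegrE (le_trans (normr_ge0 _) rA).
have h1 := sqr_ge0 (f x - g); have h2 := sqr_ge0 (f x - r).
have h3 := ler_wpM2r (sqr_ge0 (f x)) k1.
lra.
Qed.

(** Once the contraction has absorbed the cross terms, only squares of remainders and of jumps are
    left. Remainders of order eps^2 are therefore enough to reach eps^4. *)
Lemma lyapunov_drift (M : R) : exists C : R,
  forall N (e : config N) (x : state N) (eps : R),
  (0 < N)%N -> N%:R^-1 = eps ^+ 4 -> 0 < eps <= 1 -> small_state M eps e x ->
  generator beta gamma h e (lyapunov e) x <= C * eps ^+ 4.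
Proof.
have [Kv lv] := dev_v_lipschitz; have [Kz lz] := dev_z_lipschitz.
have [Kp lp] := dev_p_lipschitz; have [Kq lq] := dev_q_lipschitz.
have [Kw lw] := dev_w_lipschitz.
have [Ab rb] := rem_b_order gamma h M; have [Az rz] := rem_z_order gamma h M.
have [Aq rq] := rem_q_order beta gamma h M.
have [As rs] := rem_s_order beta gamma h M.
eexists => N e x eps N0 Neps eps01 sm.
have {}rb := rb _ _ _ _ _ _ _ _ _ _ _ eps01 sm.
have {}rz := rz _ _ _ _ _ _ _ _ _ _ _ eps01 sm.
have {}rq := rq _ _ _ _ _ _ _ _ _ _ _ eps01 sm.
have {}rs := rs _ _ _ _ _ _ _ _ _ _ _ eps01 sm.
set Rb := rem_b _ _ _ _ _ _ _ _ in rb; set Rz := rem_z _ _ _ _ _ _ _ in rz.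
set Rq := rem_q _ _ _ _ _ _ _ _ _ in rq.
set Rs := rem_s _ _ _ _ _ _ _ _ _ _ _ in rs.
have rv := order_leZ _ _ (- sb) _ _ rb.
have rw := order_leD _ _ _ _ _ _
  (order_leZ _ _ (- tb * sh * (cb + 2 * ch)) _ _ rb)
  (order_leZ _ _ ((cb + ch) ^+ 2) _ _ rs).
have r0 : order_le eps 2 0 (0 : R) by rewrite /order_le normr0 mul0r.
have cbch1 : 1 <= cb + ch by have := cb1; have := ch1; lra.
have dz : generator beta gamma h e (dev_z gamma h e) x =
    - 2 * ch * dev_z gamma h e x + 0 + Rz.
  by rewrite addr0; exact: generator_dev_z.
have dv : generator beta gamma h e (dev_v beta) x =
    - 2 * (cb + ch) * dev_v beta x + 0 + - sb * Rb.
  by rewrite addr0 (mulNr sb); exact: generator_dev_v.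
have dp : generator beta gamma h e (dev_p beta gamma h e) x =
    - 2 * cb * dev_p beta gamma h e x + 2 * sb * dev_z gamma h e x + 0.
  by rewrite addr0; exact: generator_dev_p.
have dq : generator beta gamma h e (dev_q beta gamma h) x =
    - 2 * (cb + ch) * dev_q beta gamma h x + 2 * sh * dev_p beta gamma h e x + Rq.
  exact: generator_dev_q.
have dw : generator beta gamma h e (dev_w beta gamma h e) x =
    - 2 * (cb + ch) * dev_w beta gamma h e x
    + 2 * sh * (cb + 2 * ch) * dev_v beta x
    + (- tb * sh * (cb + 2 * ch) * Rb + (cb + ch) ^+ 2 * Rs).
  exact: generator_dev_w.
have {}dz := stable_sqr _ _ _ _ _ _ _ _ _ _ N0 Neps ch1 (lz N e) dz rz.
have {}dv := stable_sqr _ _ _ _ _ _ _ _ _ _ N0 Neps cbch1 (lv N) dv rv.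
have {}dp := stable_sqr _ _ _ _ _ _ _ _ _ _ N0 Neps cb1 (lp N e) dp r0.
have {}dq := stable_sqr _ _ _ _ _ _ _ _ _ _ N0 Neps cbch1 (lq N) dq rq.
have {}dw := stable_sqr _ _ _ _ _ _ _ _ _ _ N0 Neps cbch1 (lw N e) dw rw.
rewrite /lyapunov !generatorD (generatorZ _ _ _ _ wz) (generatorZ _ _ _ _ wv).
rewrite (generatorZ _ _ _ _ wp).
have {}dz := ler_wpM2l (le_trans ler01 wz_ge1) dz.
have {}dv := ler_wpM2l (le_trans ler01 wv_ge1) dv.
have {}dp := ler_wpM2l (le_trans ler01 wp_ge1) dp.
apply: (le_trans (lerD (lerD (lerD (lerD dz dv) dp) dq) dw)).
have z2 := sqr_ge0 (dev_z gamma h e x); have v2 := sqr_ge0 (dev_v beta x).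
have p2 := sqr_ge0 (dev_p beta gamma h e x).
have q2 := sqr_ge0 (dev_q beta gamma h x); have w2 := sqr_ge0 (dev_w beta gamma h e x).
rewrite !expr0n/= !addr0.
have e1 : wp * (2 * sb * dev_z gamma h e x) ^+ 2 <= 2 * wz * dev_z gamma h e x ^+ 2.
  by rewrite /wz; have := z2; nra.
have e2 : (2 * sh * dev_p beta gamma h e x) ^+ 2 <= 2 * wp * dev_p beta gamma h e x ^+ 2.
  by rewrite /wp; have := p2; nra.
have e3 : (2 * sh * (cb + 2 * ch) * dev_v beta x) ^+ 2 <= 2 * wv * dev_v beta x ^+ 2.
  rewrite exprMn /wv; have := v2; have := sqr_ge0 (2 * sh * (cb + 2 * ch)); nra.
set r := rate_bound beta gamma h; set e4 := eps ^+ 4.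
apply: (@le_trans _ _ (wz * ((Az ^+ 2 + r * Kz ^+ 2) * e4) +
  wv * (((`|- sb| * Ab) ^+ 2 + r * Kv ^+ 2) * e4) +
  wp * ((0 ^+ 2 + r * Kp ^+ 2) * e4) + (Aq ^+ 2 + r * Kq ^+ 2) * e4 +
  ((`|- tb * sh * (cb + 2 * ch)| * Ab + `|(cb + ch) ^+ 2| * As) ^+ 2 +
    r * Kw ^+ 2) * e4)).
  rewrite !expr0n /= in e1 e2 e3 *; lra.
(* The constant [C], left open since [eexists], is read off as the coefficient of eps^4. *)
rewrite !mulrA -!mulrDl; exact: lexx.
Qed.

(** The term in [dev_z] is kept explicit, since bounding it by eps^2 would lose the factor kappa
    available in the exit region. *)
Lemma dev_x_drift (M : R) : exists2 C : R, 0 <= C &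
  forall N (e : config N) (x : state N) (eps : R),
  (0 < N)%N -> 0 < eps <= 1 -> small_state M eps e x ->
  `|generator beta gamma h e (dev_x beta gamma h) x - 2 * sb * sh * m_eta e| <=
  C * eps ^+ 3 + C * eps * `|dev_z gamma h e x|.
Proof.
have [A rx] := rem_x0_order gamma h M.
exists (sb * (`|A| + 2 * sh * `|M|)).
  rewrite mulr_ge0 ?(ltW sb_gt0)// addr_ge0// mulr_ge0// mulr_ge0//.
  exact: ltW sh_gt0.
move=> N e x eps N0 eps01 sm.
have {}rx := rx _ _ _ _ _ _ _ _ _ _ _ eps01 sm.
rewrite generator_dev_x// -/sb -/sh addrAC subrr add0r.
have [eps0 eps1] := andP eps01.
have [_ [_ _ _ SM _]] := sm.
rewrite (normrM sb) (gtr0_norm sb_gt0).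
rewrite (_ : sb * _ * eps ^+ 3 + _ = sb * ((`|A| + 2 * sh * `|M|) *
  (eps ^+ 3 + eps * `|dev_z gamma h e x|))); last by ring.
apply: (ler_wpM2l (ltW sb_gt0)).
apply: (le_trans (ler_normD _ _)).
rewrite (normrM (- 2 * sh)) (normrM (sinh (gamma * m_sigma x))) (normrM (- 2)).
rewrite normrN (gtr0_norm sh_gt0) (@ger0_norm _ 2)//.
have hx : `|rem_x0 gamma h (m_omega x) (m_eta e) (cosh (gamma * m_sigma x) - 1)
    (sinh (gamma * m_sigma x) - gamma * m_sigma x)| <= `|A| * eps ^+ 3.
  by rewrite (le_trans rx)// ler_wpM2r ?exprn_ge0 ?(ltW eps0)// ler_norm.
have hS : `|sinh (gamma * m_sigma x)| <= `|M| * eps.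
  by move: SM; rewrite /order_le expr1 => /le_trans; apply;
    rewrite ler_wpM2r ?(ltW eps0)// ler_norm.
have z0 := normr_ge0 (dev_z gamma h e x).
have hSz := ler_wpM2r z0 hS.
have hSz2 := ler_wpM2l (ltW sh_gt0) hSz.
have p1 : 0 <= `|A| * eps * `|dev_z gamma h e x|.
  by rewrite !mulr_ge0// ltW.
have p2 : 0 <= sh * `|M| * eps ^+ 3.
  exact: mulr_ge0 (mulr_ge0 (ltW sh_gt0) (normr_ge0 M)) (exprn_ge0 3 (ltW eps0)).
lra.
Qed.

End lyapunov.

(** * Exit probabilities *)

Section quadratic_drift.
Context {R : realType} {S : finType}.
Variables (L : (S -> R) -> S -> R) (Lam : R).
Hypothesis L_linear : forall c f g x,
  L (fun y => c * f y + g y) x = c * L f x + L g x.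
Hypothesis L_bound : forall f M, (forall x, `|f x| <= M) ->
  forall x, `|L f x| <= Lam * M.
Hypothesis L_cst : forall c x, L (fun=> c) x = 0.
Hypothesis Lam_ge0 : 0 <= Lam.
Variables (D V : S -> R) (mu a0 a c tau : R).
Hypotheses (a0_ge0 : 0 <= a0) (a_ge0 : 0 <= a) (V_ge0 : forall x, 0 <= V x).

Let G (t : R) x := a0 * (D x - mu * t) ^+ 2 + a * V x.

Hypothesis drift : forall t x, 0 <= t <= tau -> G t x <= 1 ->
  a0 * (L (fun y => (D y - mu * t) ^+ 2) x - 2 * mu * (D x - mu * t)) + a * L V x <= c.

Let LD t x : L (fun y => D y - mu * t) x = L D x.
Proof.
have := L_linear 1 D (fun=> - (mu * t)) x; rewrite L_cst addr0 mul1r => <-.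
by congr (L _ x); apply/funext => y; rewrite mul1r.
Qed.

Let LG t del x : L (G (t + del)) x =
  a0 * (L (fun y => (D y - mu * t) ^+ 2) x - 2 * mu * del * L D x) + a * L V x.
Proof.
have -> : G (t + del) = fun y => a0 * (D y - mu * t) ^+ 2 +
    (- (2 * a0 * mu * del) * (D y - mu * t) + (a * V y + a0 * (mu * del) ^+ 2)).
  by apply/funext => y; rewrite /G; ring.
by rewrite !L_linear L_cst LD; ring.
Qed.

(** First order expansion in del of the mean of G (t + del) after a time del: the coefficient is L G
    plus the time derivative of G, that is, the left-hand side of [drift]. The constant [B] of the
    second order term depends on the operator, hence on N; it disappears in the limit along dyadic
    grids. *)
Lemma quadratic_drift : exists2 B, 0 <= B & forall t del x,
  0 <= t -> 0 < del <= 1 -> t + del <= tau -> G t x <= 1 ->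
  \sum_y expL L del (fun z => (z == y)%:R) x * G (t + del) y <=
  G t x + c * del + B * del ^+ 2.
Proof.
have [MD MD0 DM] := fun_bounded D; have [MV MV0 VM] := fun_bounded V.
pose M := a0 * (MD + `|mu| * `|tau|) ^+ 2 + a * MV.
have M0 : 0 <= M by rewrite addr_ge0// mulr_ge0// sqr_ge0.
exists (M * expR Lam + a0 * (mu ^+ 2 + 2 * `|mu| * (Lam * MD))).
  rewrite addr_ge0 ?mulr_ge0 ?expR_ge0// addr_ge0 ?sqr_ge0//.
  by rewrite !mulr_ge0.
move=> t del x t0 /andP[del0 del1] tdel Gt.
rewrite (@expL_sum _ _ L Lam)//; last exact: ltW.
have GM y : `|G (t + del) y| <= M.
  rewrite ger0_norm; last by rewrite addr_ge0// mulr_ge0// sqr_ge0.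
  rewrite lerD ?ler_wpM2l//; last by rewrite (le_trans (ler_norm _)).
  rewrite -[leLHS]real_normK ?num_real// lerXn2r ?nnegrE ?addr_ge0 ?mulr_ge0//.
  rewrite (le_trans (ler_normB _ _))// lerD// normrM ler_wpM2l//.
  by rewrite !ger0_norm//; lra.
have del01 : 0 <= del <= 1 by rewrite ltW.
have := @expL_expansion _ _ L Lam L_bound Lam_ge0 del (G (t + del)) M x del01 GM.
rewrite ler_norml => /andP[_]; rewrite lerBlDr lerBlDr => /le_trans; apply.
rewrite LG.
have ttau : 0 <= t <= tau by rewrite t0/=; lra.
have dr := ler_wpM2l (ltW del0) (drift t x ttau Gt).
have LDM := L_bound D MD DM x.
have hL : - (2 * mu * L D x) <= 2 * `|mu| * (Lam * MD).
  rewrite (le_trans (ler_norm _))// normrN !normrM ger0_norm//.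
  by rewrite -!mulrA ler_wpM2l// ler_wpM2l.
have hL2 := ler_wpM2l (sqr_ge0 del) (ler_wpM2l a0_ge0 hL).
rewrite /G; lra.
Qed.

End quadratic_drift.

Section exit_estimate.
Context {R : realType} (beta gamma h : R).
Hypothesis beta_gt0 : 0 < beta.
Hypothesis gamma_gt0 : 0 < gamma.
Hypothesis h_gt0 : 0 < h.
Hypothesis critical : gamma = cosh (gamma * h) ^+ 2 / tanh beta.

Let lam := 2 * sinh beta * sinh (gamma * h).

Let lam_gt0 : 0 < lam.
Proof.
by apply: mulr_gt0; [apply: mulr_gt0 => //; exact: sinh_gt0|
  apply: sinh_gt0; exact: mulr_gt0].
Qed.

Definition exit_function (rho kap eps : R) {N} (e : config N) (t : R) (x : state N) : R :=
  (rho * eps) ^- 2 * (dev_x beta gamma h x - lam * m_eta e * t) ^+ 2 +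
  (kap * eps) ^- 2 * lyapunov beta gamma h e x.

Variables (T rho K : R).
Hypotheses (T_gt0 : 0 < T) (rho_gt0 : 0 < rho) (K_gt0 : 0 < K).

Lemma exit_function_le1 kap eps N (e : config N) t (x : state N) :
  0 < kap -> 0 < eps -> exit_function rho kap eps e t x <= 1 ->
  `|dev_x beta gamma h x - lam * m_eta e * t| <= rho * eps /\
  lyapunov beta gamma h e x <= (kap * eps) ^+ 2.
Proof.
move=> kap0 eps0 G1.
have re0 : 0 < rho * eps by exact: mulr_gt0.
have ke0 : 0 < kap * eps by exact: mulr_gt0.
have h1 : 0 <= (rho * eps) ^- 2 * (dev_x beta gamma h x - lam * m_eta e * t) ^+ 2.
  by rewrite mulr_ge0 ?sqr_ge0// invr_ge0 sqr_ge0.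
have h2 : 0 <= (kap * eps) ^- 2 * lyapunov beta gamma h e x.
  by rewrite mulr_ge0 ?lyapunov_ge0// invr_ge0 sqr_ge0.
move: G1; rewrite /exit_function => G1; split.
  rewrite -(@ler_pXn2r _ 2)// ?nnegrE ?(ltW re0)// real_normK ?num_real//.
  rewrite -[leRHS]mul1r -ler_pdivrMr ?exprn_gt0// mulrC; lra.
rewrite -[leRHS]mul1r -ler_pdivrMr ?exprn_gt0// mulrC; lra.
Qed.

(** The three error terms are drifts integrated over a time T/eps: kap comes from the product S z in
    the drift of x, eps from the order eps^3 remainder and the squared jumps of x, and eps / kap^2
    from the drift of the Lyapunov function divided by (kap eps)^2. Neither [C] nor [eps0] depends
    on kap. *)
Lemma exit_bound : exists C eps0 : R, [/\ 0 <= C, 0 < eps0 &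
  forall N (e : config N) (eps kap : R) d (Omega : measurableType d)
    (P : probability Omega R) (eta : Omega -> config N) (X : R -> Omega -> state N),
  (0 < N)%N -> N%:R^-1 = eps ^+ 4 -> 0 < eps <= 1 -> eps <= eps0 ->
  0 < kap <= 1 -> `|m_eta e : R| <= K * eps ^+ 2 ->
  spin_chain beta gamma h P eta X ->
  exists2 D : set Omega, measurable D /\
    (P D <= (\sum_x fine (P [set w | eta w = e /\ X 0 w = x]) *
               exit_function rho kap eps e 0 x
             + C * (kap + eps + eps / kap ^+ 2) * fine (P [set w | eta w = e]))%:E)%E &
  forall w t, eta w = e -> 0 <= t <= T / eps ->
    1 < exit_function rho kap eps e t (X t w) -> D w].
Proof.
(* Inside the exit region |x| <= rho eps + lam K eps^2 (T / eps); the last summand [K] lets the same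
   constant serve as the bound on [m_eta]. *)
have [M [eps0 [eps00 region]]] :=
  small_region beta gamma h beta_gt0 gamma_gt0 h_gt0 (rho + lam * K * T + K).
have [Cx Cx0 driftx] :=
  dev_x_drift beta gamma h beta_gt0 gamma_gt0 h_gt0 critical M.
have [Cv driftv] :=
  lyapunov_drift beta gamma h beta_gt0 gamma_gt0 h_gt0 critical M.
have [Kx lx] := dev_x_lipschitz beta gamma h.
set r := rate_bound beta gamma h.
have r0 : 0 <= r by exact: rate_bound_ge0.
pose C0 := 2 * Cx / rho + r * Kx ^+ 2 / rho ^+ 2 + `|Cv|.
have f1 : 0 <= 2 * Cx / rho by rewrite divr_ge0 ?(ltW rho_gt0)// mulr_ge0.
have f2 : 0 <= r * Kx ^+ 2 / rho ^+ 2.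
  by rewrite divr_ge0 ?sqr_ge0// mulr_ge0// sqr_ge0.
have C00 : 0 <= C0 by rewrite addr_ge0// addr_ge0.
exists (C0 * T), eps0; split => //; first by rewrite mulr_ge0// ltW.
move=> N e eps kap d Omega P eta X N0 Neps eps01 epseps0 /andP[kap0 kap1] HK chain.
have /andP[eps_gt0 eps1] := eps01.
pose mu := lam * m_eta e : R.
pose c := C0 * (kap * eps + eps ^+ 2 + eps ^+ 2 / kap ^+ 2).
pose tau := T / eps.
have tau0 : 0 < tau by rewrite divr_gt0.
have re0 : 0 < rho * eps by exact: mulr_gt0.
have ke0 : 0 < kap * eps by exact: mulr_gt0.
have s2 : 0 <= eps ^+ 2 / kap ^+ 2.
  by rewrite divr_ge0 ?sqr_ge0.
have a00 : 0 <= (rho * eps) ^- 2 by rewrite invr_ge0 sqr_ge0.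
have a0 : 0 <= (kap * eps) ^- 2 by rewrite invr_ge0 sqr_ge0.
have V0 x : 0 <= lyapunov beta gamma h e x by exact: lyapunov_ge0.
have Lam0 : 0 <= N%:R * r * 2 by rewrite !mulr_ge0.
have mu_le : `|mu| <= lam * K * eps ^+ 2.
  by rewrite normrM (gtr0_norm lam_gt0) -mulrA ler_wpM2l// ltW.
have drift t x : 0 <= t <= tau -> exit_function rho kap eps e t x <= 1 ->
    (rho * eps) ^- 2 * (generator beta gamma h e
       (fun y => (dev_x beta gamma h y - mu * t) ^+ 2) x
      - 2 * mu * (dev_x beta gamma h x - mu * t)) +
    (kap * eps) ^- 2 * generator beta gamma h e (lyapunov beta gamma h e) x <= c.
  move=> /andP[t0 ttau] /(exit_function_le1 _ _ _ _ _ _ kap0 eps_gt0)[]; rewrite -/mu.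
  set D := dev_x _ _ _ _ - _ => Dre Vke.
  have mut : `|mu * t| <= lam * K * T * eps.
    rewrite normrM (ger0_norm t0) (le_trans (ler_pM _ _ mu_le ttau))//.
    rewrite /tau le_eqVlt; apply/orP; left; apply/eqP; field.
    by rewrite gt_eqF.
  have xM : `|dev_x beta gamma h x| <= (rho + lam * K * T + K) * eps.
    have -> : dev_x beta gamma h x = D + mu * t by rewrite /D; ring.
    rewrite (le_trans (ler_normD _ _))//.
    have := mulr_gt0 K_gt0 eps_gt0; lra.
  have Ve : lyapunov beta gamma h e x <= eps ^+ 2.
    rewrite (le_trans Vke)// lerXn2r ?nnegrE ?(ltW ke0) ?(ltW eps_gt0)//.
    by rewrite ler_piMl// ltW.
  have HM : `|m_eta e : R| <= (rho + lam * K * T + K) * eps ^+ 2.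
    rewrite (le_trans HK)// ler_wpM2r ?sqr_ge0// lerDr.
    apply: addr_ge0 (ltW rho_gt0) _.
    exact: mulr_ge0 (mulr_ge0 (ltW lam_gt0) (ltW K_gt0)) (ltW T_gt0).
  have sm := region N e x eps eps01 epseps0 xM Ve HM.
  have {}driftv := driftv N e x eps N0 Neps eps01 sm.
  have {}driftx := driftx N e x eps N0 eps01 sm.
  have [zke _ _ _ _] := lyapunov_devs _ _ _ _ _ _ _ (ltW ke0) Vke.
  have lD : flip_lipschitz (Kx + 0) (fun y : state N => dev_x beta gamma h y - mu * t).
    by apply: flip_lipschitzD; [exact: lx|exact: flip_lipschitz_cst].
  have := generator_sqr beta gamma h e beta_gt0 gamma_gt0 h_gt0 N0 _ _ x lD.
  rewrite generatorD generator_cst !addr0 Neps -/D -/r.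
  move: driftx; rewrite -/lam -/mu.
  set LD := generator _ _ _ _ (dev_x beta gamma h) x => driftx LD2.
  have hx : `|LD - mu| <= Cx * eps ^+ 3 + Cx * kap * eps ^+ 2.
    rewrite (le_trans driftx)// lerD2l (_ : Cx * kap * _ = Cx * eps * (kap * eps)).
      by rewrite ler_wpM2l// mulr_ge0// ltW.
    by ring.
  have hDx : 2 * D * (LD - mu) <= 2 * (rho * eps * (Cx * eps ^+ 3 + Cx * kap * eps ^+ 2)).
    rewrite -mulrA ler_wpM2l// (le_trans (ler_norm _))// normrM.
    by rewrite ler_pM.
  set L2 := generator _ _ _ _ _ _ in LD2 *.
  have b1 : (rho * eps) ^- 2 * (L2 - 2 * mu * D) <= (rho * eps) ^- 2 *
     (2 * (rho * eps * (Cx * eps ^+ 3 + Cx * kap * eps ^+ 2)) + r * Kx ^+ 2 * eps ^+ 4).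
    by rewrite ler_wpM2l//; lra.
  have b2 := ler_wpM2l a0 driftv.
  apply: (le_trans (lerD b1 b2)).
  have e1 : (kap * eps) ^- 2 * (Cv * eps ^+ 4) <= `|Cv| * (eps ^+ 2 / kap ^+ 2).
    have -> : (kap * eps) ^- 2 * (Cv * eps ^+ 4) = Cv * (eps ^+ 2 / kap ^+ 2).
      by field; rewrite !gt_eqF.
    by rewrite ler_wpM2r ?ler_norm// divr_ge0 ?sqr_ge0.
  have e2 : (rho * eps) ^- 2 *
     (2 * (rho * eps * (Cx * eps ^+ 3 + Cx * kap * eps ^+ 2)) + r * Kx ^+ 2 * eps ^+ 4)
     = 2 * Cx / rho * (eps ^+ 2 + kap * eps) + r * Kx ^+ 2 / rho ^+ 2 * eps ^+ 2.
    by field; rewrite !gt_eqF.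
  rewrite e2 (le_trans (lerD (lexx _) e1))// /c /C0.
  have q1 := mulr_ge0 f1 s2; have q2 := mulr_ge0 f2 (addr_ge0 (ltW ke0) s2).
  have q3 := mulr_ge0 (normr_ge0 Cv) (addr_ge0 (ltW ke0) (sqr_ge0 eps)).
  lra.
have [B B0 QG] := quadratic_drift (generator beta gamma h e) (N%:R * r * 2)
  (generator_linear _ _ _ _) (generator_bound _ _ _ _ beta_gt0 gamma_gt0 h_gt0 N0)
  (generator_cst _ _ _ _) Lam0 _ _ mu _ _ c tau a00 a0 V0 drift.
have [mE mX rc _ fdd] := chain.
have c0 : 0 <= c.
  exact: mulr_ge0 C00 (addr_ge0 (addr_ge0 (ltW ke0) (sqr_ge0 _)) s2).
have cont x : continuous (fun t => exit_function rho kap eps e t x).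
  move=> t; apply: cvgD; last exact: cvg_cst.
  apply: cvgMr; rewrite -/mu; apply: (@cvg_comp _ _ _
    (fun s => dev_x beta gamma h x - mu * s) (fun y => y ^+ 2)).
    by apply: cvgB; [exact: cvg_cst|apply: cvgMr; exact: cvg_id].
  exact: exprn_continuous.
have G0 t x : 0 <= exit_function rho kap eps e t x.
  by rewrite addr_ge0// mulr_ge0// sqr_ge0.
have [D [mD PD] hD] := chain_maximal_inequality P [set w | eta w = e] X
  (transition beta gamma h e) (mE e) mX (fdd e)
  (exit_function rho kap eps e) tau c B rc tau0 c0 B0 G0 cont QG.
exists D => //; split => //; rewrite (le_trans PD)// lee_fin lerD2l.
rewrite ler_wpM2r ?fine_ge0// le_eqVlt; apply/orP; left; apply/eqP.
by rewrite /c /tau; field; rewrite !gt_eqF.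
Qed.

End exit_estimate.

(** * Mean squares at time zero *)

Section iid_average.
Context {R : realType} {X : finType} (mu : X -> R) {N : nat}.
Hypothesis mu_ge0 : forall x, 0 <= mu x.
Hypothesis mu_sum1 : \sum_x mu x = 1.

Let weight (f : {ffun 'I_N -> X}) : R := \prod_j mu (f j).

Lemma iid_sum1 : \sum_f weight f = 1.
Proof.
rewrite /weight -(bigA_distr_bigA (fun _ x => mu x)) big1//.
Qed.

(** Off the diagonal, the mean of g (f i) g (f k) factorises over the sites and contains the mean of
    g, which is zero. The N diagonal terms are at most B^2 each. *)
Lemma iid_average_sqr (g : X -> R) B : (0 < N)%N ->
  \sum_x mu x * g x = 0 -> (forall x, `|g x| <= B) ->
  \sum_f weight f * average (fun j => g (f j)) ^+ 2 <= B ^+ 2 / N%:R.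
Proof.
move=> N0 g0 gB.
have cross (i k : 'I_N) : \sum_f weight f * (g (f i) * g (f k)) <=
    if i == k then B ^+ 2 else 0.
  pose F j x := mu x * ((if j == i then g x else 1) * (if j == k then g x else 1)).
  have -> : \sum_f weight f * (g (f i) * g (f k)) = \prod_j \sum_x F j x.
    rewrite bigA_distr_bigA; apply: eq_bigr => f _.
    rewrite big_split/= big_split/= -!big_mkcond/= !big_pred1_eq//.
  rewrite (bigD1 i)//=; case: eqVneq => [ik|ik].
    rewrite [X in _ * X]big1 => [|j ji]; last first.
      rewrite -mu_sum1; apply: eq_bigr => x _.
      by rewrite /F -ik (negbTE ji) !mulr1.
    rewrite mulr1 -[leRHS]mul1r -mu_sum1 mulr_suml; apply: ler_sum => x _.
    rewrite /F -ik eqxx ler_wpM2l// -expr2 -[leLHS]real_normK ?num_real//.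
    by rewrite lerXn2r// nnegrE (le_trans (normr_ge0 _) (gB x)).
  have -> : \sum_x F i x = 0.
    rewrite -[RHS]g0; apply: eq_bigr => x _.
    by rewrite /F eqxx (negbTE ik) mulr1.
  by rewrite mul0r.
have sqrE f : weight f * average (fun j => g (f j)) ^+ 2 =
    N%:R ^- 2 * \sum_i \sum_k weight f * (g (f i) * g (f k)).
  rewrite /average exprMn exprVn [(\sum_j _) ^+ 2]expr2 big_distrlr/= mulrCA mulr_sumr.
  by congr (_ * _); apply: eq_bigr => i _; rewrite mulr_sumr.
under eq_bigr do rewrite sqrE.
rewrite -mulr_sumr exchange_big/=.
under eq_bigr do rewrite exchange_big/=.
apply: (@le_trans _ _ (N%:R ^- 2 * \sum_(i < N) \sum_(k < N) if i == k then B ^+ 2 else 0)).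
  by rewrite ler_wpM2l ?invr_ge0 ?sqr_ge0//; apply: ler_sum => i _; apply: ler_sum.
have -> : \sum_(i < N) \sum_(k < N) (if i == k then B ^+ 2 else 0) = N%:R * B ^+ 2.
  rewrite -[N in RHS]card_ord mulr_natl -sumr_const; apply: eq_bigr => i _.
  rewrite (bigD1 i)//= eqxx big1 ?addr0// => k ki.
  by rewrite eq_sym (negbTE ki).
rewrite le_eqVlt; apply/orP; left; apply/eqP; field.
by rewrite pnatr_eq0 -lt0n.
Qed.

End iid_average.

Section initial_fluctuations.
Context {R : realType} (beta gamma h : R) (mu : bool * bool * bool -> R).
Hypothesis mu_law : initial_law beta gamma h mu.

Definition start_weight {N} (x : state N) (e : config N) : R :=
  \prod_(j < N) mu (x.1 j, x.2 j, e j).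

Let unzip {N} (f : {ffun 'I_N -> bool * bool * bool}) : state N * config N :=
  (([ffun j => (f j).1.1], [ffun j => (f j).1.2]), [ffun j => (f j).2]).

Let zip {N} (y : state N * config N) : {ffun 'I_N -> bool * bool * bool} :=
  [ffun j => (y.1.1 j, y.1.2 j, y.2 j)].

(** A state together with an environment is a single configuration of triples, and in that form the
    start is i.i.d. *)
Let sum_unzip N (F : state N -> config N -> R) :
  \sum_e \sum_x F x e = \sum_f F (unzip f).1 (unzip f).2.
Proof.
rewrite exchange_big pair_big/= (reindex (@unzip N))//=.
exists (@zip N) => [f _|[[s o] e] _].
  by apply/ffunP => j; rewrite !ffunE; case: (f j) => [[]].
by congr (_, _, _); apply/ffunP => j; rewrite !ffunE.
Qed.

Lemma start_weight_sum1 N : \sum_(e : config N) \sum_x start_weight x e = 1.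
Proof.
rewrite sum_unzip -(@iid_sum1 _ _ mu N (initial_law_sum1 mu_law)).
apply: eq_bigr => f _; apply: eq_bigr => j _.
by rewrite !ffunE; case: (f j) => [[]].
Qed.

Lemma start_average_sqr (g : R -> R -> R -> R) : mean mu g = 0 ->
  exists2 B, 0 <= B & forall N, (0 < N)%N ->
  \sum_(e : config N) \sum_x start_weight x e *
    average (fun j => g (spin (x.1 j)) (spin (x.2 j)) (spin (e j))) ^+ 2 <= B / N%:R.
Proof.
move=> g0; pose g' (y : bool * bool * bool) := g (spin y.1.1) (spin y.1.2) (spin y.2).
have [B B0 gB] := fun_bounded g'.
exists (B ^+ 2) => [|N N0]; first exact: sqr_ge0.
rewrite sum_unzip.
have := @iid_average_sqr R _ mu N (initial_law_ge0 mu_law) (initial_law_sum1 mu_law) g' B N0 g0 gB.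
apply: le_trans; rewrite le_eqVlt; apply/orP; left; apply/eqP.
apply: eq_bigr => f _; congr (_ * _ ^+ 2).
  by apply: eq_bigr => j _; rewrite !ffunE; case: (f j) => [[]].
by apply: eq_average => j; rewrite !ffunE.
Qed.

Let mean_lin (c1 c2 c3 : R) (f g : R -> R -> R -> R) :
  mean mu (fun s o e => c1 * f s o e + c2 * g s o e + c3) =
  c1 * mean mu f + c2 * mean mu g + c3.
Proof.
rewrite /mean -[X in _ = _ + X]mulr1 -[X in _ = _ + _ * X](initial_law_sum1 mu_law).
rewrite !mulr_sumr -!big_split/=; apply: eq_bigr => x _; ring.
Qed.

Lemma m_eta_sqr : exists2 B, 0 <= B & forall N, (0 < N)%N ->
  \sum_(e : config N) \sum_x start_weight x e * m_eta e ^+ 2 <= B / N%:R.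
Proof.
apply: (start_average_sqr (fun _ _ e => e)).
have -> : mean mu (fun _ _ e => e) = \sum_c \sum_y mu (y, c) * spin c.
  rewrite /mean exchange_big pair_bigA; apply: eq_bigr => -[[a b] c] _ /=.
  by [].
have E c : \sum_y mu (y, c) * spin c = spin c / 2.
  rewrite -mulr_suml [LHS]mulrC; congr (_ * _).
  rewrite -[RHS]div1r -(initial_law_eta mu_law c) pair_bigA.
  by apply: eq_bigr => -[a b] _.
under eq_bigr do rewrite E.
by rewrite big_bool/= mulN1r addrC mul1r addNr.
Qed.

Let start_linear_sqr (c1 c2 c3 : R) (f1 f2 : R -> R -> R -> R)
    (F : forall N, config N -> state N -> R) :
  c1 * mean mu f1 + c2 * mean mu f2 + c3 = 0 ->
  (forall N (e : config N) (x : state N), F N e x =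
    c1 * average (fun j => f1 (spin (x.1 j)) (spin (x.2 j)) (spin (e j))) +
    c2 * average (fun j => f2 (spin (x.1 j)) (spin (x.2 j)) (spin (e j))) + c3) ->
  exists2 B, 0 <= B & forall N, (0 < N)%N ->
  \sum_(e : config N) \sum_x start_weight x e * F N e x ^+ 2 <= B / N%:R.
Proof.
rewrite -mean_lin => /start_average_sqr[B B0 H] FE.
exists B => // N N0; apply: le_trans (H N N0).
rewrite le_eqVlt; apply/orP; left; apply/eqP.
apply: eq_bigr => e _; apply: eq_bigr => x _; congr (_ * _ ^+ 2).
by rewrite !averageD !averageZ average_cst// FE.
Qed.

Let means := (initial_law_sigma mu_law, initial_law_omega mu_law,
  initial_law_sigma_omega mu_law, initial_law_sigma_eta mu_law,
  initial_law_omega_eta mu_law, initial_law_sigma_omega_eta mu_law).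

Lemma dev_x_sqr : exists2 B, 0 <= B & forall N, (0 < N)%N ->
  \sum_(e : config N) \sum_x start_weight x e * dev_x beta gamma h x ^+ 2 <= B / N%:R.
Proof.
apply: (start_linear_sqr (cosh (gamma * h)) (sinh beta) (0 : R) (fun s o e : R => s)
  (fun s o e : R => o)
    (fun _ _ x => dev_x beta gamma h x)) => [|N e x]; first by rewrite !means; ring.
by rewrite addr0.
Qed.

Lemma dev_v_sqr : exists2 B, 0 <= B & forall N, (0 < N)%N ->
  \sum_(e : config N) \sum_x start_weight x e * dev_v beta x ^+ 2 <= B / N%:R.
Proof.
apply: (start_linear_sqr (cosh beta) (- sinh beta) (0 : R) (fun s o e : R => s)
  (fun s o e : R => o)
    (fun _ _ x => dev_v beta x)) => [|N e x]; first by rewrite !means; ring.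
by rewrite addr0 mulNr.
Qed.

Lemma dev_z_sqr : exists2 B, 0 <= B & forall N, (0 < N)%N ->
  \sum_(e : config N) \sum_x start_weight x e * dev_z gamma h e x ^+ 2 <= B / N%:R.
Proof.
apply: (start_linear_sqr (1 : R) (0 : R) (- tanh (gamma * h)) (fun s o e : R => o * e)
  (fun s o e : R => o)
    (fun _ e x => dev_z gamma h e x)) => [|N e x]; first by rewrite !means; ring.
by rewrite mul1r mul0r addr0.
Qed.

Lemma dev_p_sqr : exists2 B, 0 <= B & forall N, (0 < N)%N ->
  \sum_(e : config N) \sum_x start_weight x e * dev_p beta gamma h e x ^+ 2 <= B / N%:R.
Proof.
apply: (start_linear_sqr (1 : R) (0 : R) (- (tanh beta * tanh (gamma * h))) (fun s o e : R => s * e)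
  (fun s o e : R => o)
    (fun _ e x => dev_p beta gamma h e x)) => [|N e x]; first by rewrite !means; ring.
by rewrite mul1r mul0r addr0.
Qed.

Lemma dev_q_sqr : exists2 B, 0 <= B & forall N, (0 < N)%N ->
  \sum_(e : config N) \sum_x start_weight x e * dev_q beta gamma h x ^+ 2 <= B / N%:R.
Proof.
apply: (start_linear_sqr (1 : R) (0 : R)
  (- ((tanh beta * tanh (gamma * h) * sinh (gamma * h) + sinh beta) /
     (cosh beta + cosh (gamma * h))))
  (fun s o e : R => s * o) (fun s o e : R => o)
    (fun _ _ x => dev_q beta gamma h x)) => [|N e x]; first by rewrite !means; ring.
by rewrite mul1r mul0r addr0.
Qed.

Lemma dev_w_sqr : exists2 B, 0 <= B & forall N, (0 < N)%N ->
  \sum_(e : config N) \sum_x start_weight x e * dev_w beta gamma h e x ^+ 2 <= B / N%:R.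
Proof.
apply: (start_linear_sqr (- tanh beta * sinh (gamma * h) * (cosh beta + 2 * cosh (gamma * h)))
  ((cosh beta + cosh (gamma * h)) ^+ 2) (0 : R)
  (fun s o e : R => o) (fun s o e : R => s * o * e)
    (fun _ e x => dev_w beta gamma h e x)) => [|N e x]; first by rewrite !means; ring.
by rewrite addr0.
Qed.

(** Each deviation is the average of a centred function of the triples, so its mean square is O(1/N)
    = O(eps^4); the prefactors of the exit function leave eps^2. *)
Lemma start_exit_function : exists2 B, 0 <= B & forall N rho kap eps,
  (0 < N)%N -> N%:R^-1 = eps ^+ 4 -> 0 < eps -> 0 < rho -> 0 < kap ->
  \sum_(e : config N) \sum_x start_weight x e *
    exit_function beta gamma h rho kap eps e 0 x <=
  B * (eps ^+ 2 / rho ^+ 2 + eps ^+ 2 / kap ^+ 2).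
Proof.
have [Bx Bx0 Hx] := dev_x_sqr; have [Bv Bv0 Hv] := dev_v_sqr.
have [Bz Bz0 Hz] := dev_z_sqr; have [Bp Bp0 Hp] := dev_p_sqr.
have [Bq Bq0 Hq] := dev_q_sqr; have [Bw Bw0 Hw] := dev_w_sqr.
pose wp := 1 + 2 * sinh (gamma * h) ^+ 2.
pose wv := 1 + (2 * sinh (gamma * h) * (cosh beta + 2 * cosh (gamma * h))) ^+ 2.
pose wz := 1 + 2 * wp * sinh beta ^+ 2.
have wp0 : 0 <= wp by rewrite addr_ge0// mulr_ge0// sqr_ge0.
have wv0 : 0 <= wv by rewrite addr_ge0// sqr_ge0.
have wz0 : 0 <= wz by rewrite addr_ge0// mulr_ge0 ?sqr_ge0// mulr_ge0.
pose BV := wz * Bz + wv * Bv + wp * Bp + Bq + Bw.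
have BV0 : 0 <= BV by rewrite !addr_ge0// mulr_ge0.
exists (Bx + BV); first exact: addr_ge0.
move=> N rho kap eps N0 Neps eps0 rho0 kap0.
pose S (F : config N -> state N -> R) := \sum_e \sum_x start_weight x e * F e x.
have SD F1 F2 : S (fun e x => F1 e x + F2 e x) = S F1 + S F2.
  rewrite /S -big_split/=; apply: eq_bigr => e _; rewrite -big_split/=.
  by apply: eq_bigr => x _; rewrite mulrDr.
have SZ c F : S (fun e x => c * F e x) = c * S F.
  rewrite /S mulr_sumr; apply: eq_bigr => e _; rewrite mulr_sumr.
  by apply: eq_bigr => x _; rewrite mulrCA.
have {}Hx := Hx N N0; have {}Hv := Hv N N0; have {}Hz := Hz N N0.
have {}Hp := Hp N N0; have {}Hq := Hq N N0; have {}Hw := Hw N N0.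
rewrite -/(S (fun e x => dev_x beta gamma h x ^+ 2)) in Hx.
rewrite -/(S (fun e x => dev_v beta x ^+ 2)) in Hv.
rewrite -/(S (fun e x => dev_z gamma h e x ^+ 2)) in Hz.
rewrite -/(S (fun e x => dev_p beta gamma h e x ^+ 2)) in Hp.
rewrite -/(S (fun e x => dev_q beta gamma h x ^+ 2)) in Hq.
rewrite -/(S (fun e x => dev_w beta gamma h e x ^+ 2)) in Hw.
rewrite Neps in Hx Hv Hz Hp Hq Hw.
have -> : \sum_(e : config N) \sum_x start_weight x e *
    exit_function beta gamma h rho kap eps e 0 x =
    (rho * eps) ^- 2 * S (fun e x => dev_x beta gamma h x ^+ 2) +
    (kap * eps) ^- 2 * (wz * S (fun e x => dev_z gamma h e x ^+ 2) +
      wv * S (fun e x => dev_v beta x ^+ 2) +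
      wp * S (fun e x => dev_p beta gamma h e x ^+ 2) +
      S (fun e x => dev_q beta gamma h x ^+ 2) +
      S (fun e x => dev_w beta gamma h e x ^+ 2)).
  rewrite -!SZ -!SD -!SZ -SD /S; apply: eq_bigr => e _; apply: eq_bigr => x _.
  by rewrite /exit_function mulr0 subr0.
have a1 : 0 <= (rho * eps) ^- 2 by rewrite invr_ge0 sqr_ge0.
have a2 : 0 <= (kap * eps) ^- 2 by rewrite invr_ge0 sqr_ge0.
have h1 := ler_wpM2l a1 Hx.
have h2 : wz * S (fun e x => dev_z gamma h e x ^+ 2) +
      wv * S (fun e x => dev_v beta x ^+ 2) +
      wp * S (fun e x => dev_p beta gamma h e x ^+ 2) +
      S (fun e x => dev_q beta gamma h x ^+ 2) +
      S (fun e x => dev_w beta gamma h e x ^+ 2) <= BV * eps ^+ 4.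
  have := ler_wpM2l wz0 Hz; have := ler_wpM2l wv0 Hv; have := ler_wpM2l wp0 Hp.
  by rewrite /BV; lra.
have {}h2 := ler_wpM2l a2 h2.
apply: (le_trans (lerD h1 h2)).
have -> : (rho * eps) ^- 2 * (Bx * eps ^+ 4) = Bx * (eps ^+ 2 / rho ^+ 2).
  by field; rewrite !gt_eqF.
have -> : (kap * eps) ^- 2 * (BV * eps ^+ 4) = BV * (eps ^+ 2 / kap ^+ 2).
  by field; rewrite !gt_eqF.
have b1 : 0 <= eps ^+ 2 / rho ^+ 2 by rewrite divr_ge0 ?sqr_ge0.
have b2 : 0 <= eps ^+ 2 / kap ^+ 2 by rewrite divr_ge0 ?sqr_ge0.
have := mulr_ge0 Bx0 b2; have := mulr_ge0 BV0 b1; lra.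
Qed.

End initial_fluctuations.

(** * Uniform approximation on the rescaled time interval *)

Section fourth_root.
Context {R : realType}.
Implicit Types N : nat.

Lemma fourth_root_ge1 N : (0 < N)%N -> 1 <= N%:R `^ (1 / 4) :> R.
Proof.
move=> N0; have := @ge0_ler_powR R (1 / 4) _ 1 N%:R.
by rewrite powR1 !nnegrE; apply; rewrite ?divr_ge0// ler1n.
Qed.

Lemma fourth_root_exp N k : (N%:R `^ (1 / 4) : R) ^+ k = N%:R `^ (k%:R / 4).
Proof. by rewrite -powR_mulrn ?powR_ge0// -powRrM; congr (_ `^ _); field. Qed.

Lemma fourth_root_exp4 N : (N%:R `^ (1 / 4) : R) ^+ 4 = N%:R.
Proof. by rewrite fourth_root_exp divff// powRr1. Qed.

Lemma fourth_root_sqr N : (N%:R `^ (1 / 4) : R) ^+ 2 = N%:R `^ (1 / 2).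
Proof. by rewrite fourth_root_exp; congr (_ `^ _); field. Qed.

Lemma fourth_root_inv_small (a : R) : 0 < a ->
  \forall N \near \oo, (N%:R `^ (1 / 4))^-1 <= a.
Proof.
move=> a0; near=> N.
have N0 : (0 < N)%N by near: N; exact: nbhs_infty_gt.
have r0 : 0 < N%:R `^ (1 / 4) :> R by rewrite powR_gt0// ltr0n.
rewrite -[leRHS]invrK lef_pV2 ?posrE ?invr_gt0//.
rewrite -(@ler_pXn2r _ 4)// ?nnegrE ?invr_ge0 ?(ltW a0) ?(ltW r0)//.
rewrite fourth_root_exp4; near: N; exact: nbhs_infty_ger.
Unshelve. all: by end_near. Qed.

End fourth_root.

Lemma measure_bigU_le {R : realType} {S : finType} {d} {Omega : measurableType d}
    (mu : {measure set Omega -> \bar R}) (A : pred S) (F : S -> set Omega) :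
  (forall i, A i -> measurable (F i)) ->
  (mu (\big[setU/set0]_(i | A i) F i) <= \sum_(i | A i) mu (F i))%E.
Proof.
move=> mF; suff [] : measurable (\big[setU/set0]_(i | A i) F i) /\
  (mu (\big[setU/set0]_(i | A i) F i) <= \sum_(i | A i) mu (F i))%E by [].
apply: (big_ind2 (fun x (y : \bar R) => measurable x /\ mu x <= y)%E) => //.
- by rewrite measure0.
- move=> x1 y1 x2 y2 [m1 l1] [m2 l2]; split; first exact: measurableU.
  by rewrite (le_trans (measureU2 _ m1 m2))// leeD.
- by move=> i Ai; split => //; exact: mF.
Qed.

Section uniform_approximation.
Context {R : realType} (beta gamma h T : R).
Hypothesis beta_gt0 : 0 < beta.
Hypothesis gamma_gt0 : 0 < gamma.
Hypothesis h_gt0 : 0 < h.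
Hypothesis critical : gamma = cosh (gamma * h) ^+ 2 / tanh beta.
Hypothesis T_gt0 : 0 < T.
Variable mu : bool * bool * bool -> R.
Hypothesis mu_law : initial_law beta gamma h mu.

Section start.
Variables (N : nat) (d : measure_display) (Omega : measurableType d)
  (P : probability Omega R) (eta : Omega -> config N) (X : R -> Omega -> state N).
Hypothesis chain : spin_chain beta gamma h P eta X.
Hypothesis start : iid_start mu P eta X.

Lemma startE e x :
  P [set w | eta w = e /\ X 0 w = x] = (start_weight mu x e)%:E.
Proof.
rewrite -start; congr (P _); apply/seteqP.
by case: x => s o; split=> w [].
Qed.

Lemma envE e : P [set w | eta w = e] = (\sum_x start_weight mu x e)%:E.
Proof.
have mX x := spin_chain_measurable chain x (lexx 0).
have := total_measure _ mX P xpredT _ (spin_chain_env_measurable chain e).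
rewrite (_ : [set _ : Omega | true] = setT) ?setIT; last by apply/seteqP.
move=> ->; rewrite -sumEFin; apply: eq_bigr => x _.
exact: startE.
Qed.

End start.

Let lam := 2 * sinh beta * sinh (gamma * h).

(** Environments with |m_eta| > K eps^2 are discarded by Chebyshev's inequality. Every other
    environment has its own exceptional set; their union remains small although there are
    exponentially many, because each bound carries the weight of its environment and these weights
    add up to at most 1. *)
Lemma uniform_approximation (rho zeta : R) : 0 < rho -> 0 < zeta ->
  \forall N \near \oo, forall (d : measure_display) (Omega : measurableType d)
    (P : probability Omega R) (eta : Omega -> config N) (X : R -> Omega -> state N),
  spin_chain beta gamma h P eta X -> iid_start mu P eta X ->
  exists2 D : set Omega, measurable D /\ (P D <= zeta%:E)%E &
  forall w t, ~ D w -> 0 <= t <= T ->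
    let x := X (N%:R `^ (1 / 4) * t) w in
    let e := eta w in
    `|fluct_x beta gamma h x - lam * fluct_r e * t| <= rho /\
    [/\ N%:R `^ (1 / 4) * `|dev_z gamma h e x| <= rho,
        N%:R `^ (1 / 4) * `|dev_v beta x| <= rho,
        N%:R `^ (1 / 4) * `|dev_p beta gamma h e x| <= rho,
        N%:R `^ (1 / 4) * `|dev_q beta gamma h x| <= rho &
        N%:R `^ (1 / 4) * `|dev_w beta gamma h e x| <= rho].
Proof.
move=> rho0 zeta0.
have [Be Be0 He] := m_eta_sqr beta gamma h mu mu_law.
(* Of zeta, a quarter goes to the discarded environments, a quarter to C kap, and a half to the
   terms that vanish with eps. [K] comes before [C], which depends on it, then kap is chosen from
   [C], and finally N from all of them. The condition kap <= rho gives the bounds on the contracted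
   deviations. *)
pose K := 1 + 4 * Be / zeta.
have K1 : 1 <= K by rewrite lerDl divr_ge0 ?mulr_ge0// ltW.
have K0 : 0 < K by exact: lt_le_trans K1.
have BeK : Be / K ^+ 2 <= zeta / 4.
  rewrite ler_pdivrMr ?exprn_gt0//.
  have : Be <= zeta / 4 * K.
    have -> : zeta / 4 * K = zeta / 4 + Be by rewrite /K; field; rewrite gt_eqF.
    by rewrite lerDr divr_ge0// ltW.
  move=> /le_trans; apply; rewrite ler_wpM2l ?divr_ge0 ?(ltW zeta0)//.
  by rewrite expr2 ler_peMr ?(ltW K0).
have [C [eps0 [C0 eps00 exitC]]] := exit_bound beta gamma h beta_gt0 gamma_gt0 h_gt0
  critical T rho K T_gt0 rho0 K0.
have [B B0 HG] := start_exit_function beta gamma h mu mu_law.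
pose kap := Num.min 1 (Num.min rho (zeta / (4 * (C + 1)))).
have kap0 : 0 < kap.
  by rewrite !lt_min ltr01 rho0 divr_gt0// mulr_gt0// ltr_wpDl.
have kap1 : kap <= 1 by rewrite ge_min lexx.
have kaprho : kap <= rho by rewrite !ge_min lexx orbT.
have Ckap : C * kap <= zeta / 4.
  have kz : kap <= zeta / (4 * (C + 1)) by rewrite !ge_min lexx !orbT.
  rewrite (le_trans (ler_wpM2l C0 kz))//.
  rewrite mulrA ler_pdivrMr ?mulr_gt0 ?ltr_wpDl//.
  by have := zeta0; lra.
(* [A] collects the coefficients of eps: the mean exit function at time zero, where eps^2 <= eps,
   and the last two terms of [exit_bound]. *)
pose A := B * (rho ^- 2 + kap ^- 2) + C * (1 + kap ^- 2).
have A0 : 0 <= A.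
  by rewrite addr_ge0// mulr_ge0// addr_ge0// invr_ge0 sqr_ge0.
near=> N => d Omega P eta X chain start.
have N0 : (0 < N)%N by near: N; exact: nbhs_infty_gt.
pose eps : R := (N%:R `^ (1 / 4))^-1.
have rge1 : 1 <= N%:R `^ (1 / 4) :> R by exact: fourth_root_ge1.
have r0 : 0 < N%:R `^ (1 / 4) :> R by exact: lt_le_trans rge1.
have epsgt0 : 0 < eps by rewrite invr_gt0.
have eps1 : eps <= 1 by rewrite invf_le1.
have eps01 : 0 < eps <= 1 by rewrite epsgt0.
have Neps : N%:R^-1 = eps ^+ 4 by rewrite /eps exprVn fourth_root_exp4.
have epse0 : eps <= eps0 by rewrite /eps; near: N; exact: fourth_root_inv_small.
have epsA : eps <= zeta / (2 * (A + 1)).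
  rewrite /eps; near: N; apply: fourth_root_inv_small.
  by rewrite divr_gt0// mulr_gt0// ltr_wpDl.
have Aeps : A * eps <= zeta / 2.
  rewrite (le_trans (ler_wpM2l A0 epsA))// mulrA ler_pdivrMr ?mulr_gt0 ?ltr_wpDl//.
  by have := zeta0; lra.
pose good (e : config N) := `|m_eta e : R| <= K * eps ^+ 2.
have kap01 : 0 < kap <= 1 by rewrite kap0.
have : forall e, exists D : set Omega, good e -> measurable D /\
    (P D <= (\sum_x start_weight mu x e * exit_function beta gamma h rho kap eps e 0 x
       + C * (kap + eps + eps / kap ^+ 2) * \sum_x start_weight mu x e)%:E)%E /\
    forall w t, eta w = e -> 0 <= t <= T / eps ->
      1 < exit_function beta gamma h rho kap eps e t (X t w) -> D w.
  move=> e; have [ge|] := boolP (good e); last by exists set0.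
  have [D [mD PD] hD] :=
    exitC N e eps kap d Omega P eta X N0 Neps eps01 epse0 kap01 ge chain.
  exists D => _; split => //; split => //; move: PD.
  rewrite (envE _ _ _ _ _ _ chain start)/=.
  under eq_bigr do rewrite (startE _ _ _ _ _ _ start)/=.
  by [].
move=> /choice[F HF].
have mF e : good e -> measurable (F e) by move=> /HF[].
pose Bad : set Omega := [set w | ~~ good (eta w)].
have mBad : measurable Bad.
  exact: (preimage_measurable eta (spin_chain_env_measurable chain) (fun e => ~~ good e)).
have w0 (x : state N) e : 0 <= start_weight mu x e.
  by apply: prodr_ge0 => j _; exact: initial_law_ge0 mu_law _.
have PBad : (P Bad <= (zeta / 4)%:E)%E.
  have := total_measure _ (spin_chain_env_measurable chain) P
    (fun e => ~~ good e) _ measurableT.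
  rewrite setTI => ->.
  rewrite (eq_bigr (fun e => (\sum_x start_weight mu x e)%:E)) => [|e _]; last first.
    by rewrite setTI; exact: envE chain start _.
  rewrite sumEFin lee_fin; apply: le_trans BeK.
  apply: (@le_trans _ _ (\sum_(e : config N) (\sum_x start_weight mu x e * m_eta e ^+ 2)
      / (K * eps ^+ 2) ^+ 2)).
    rewrite [leRHS](bigID good)/= ler_wpDl//.
      apply: sumr_ge0 => e _; rewrite divr_ge0 ?sqr_ge0//.
      by apply: sumr_ge0 => x _; rewrite mulr_ge0// sqr_ge0.
    apply: ler_sum => e; rewrite /good -ltNge => He'.
    rewrite ler_pdivlMr ?exprn_gt0 ?mulr_gt0 ?exprn_gt0// mulr_suml.
    apply: ler_sum => x _; rewrite ler_wpM2l//.
    rewrite -[leRHS]real_normK ?num_real// lerXn2r ?nnegrE ?(ltW He')//.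
    by rewrite mulr_ge0 ?sqr_ge0// ltW.
  rewrite -mulr_suml (le_trans (ler_wpM2r _ (He N N0)))//.
    by rewrite invr_ge0 sqr_ge0.
  rewrite Neps le_eqVlt; apply/orP; left; apply/eqP; field.
  by rewrite !gt_eqF.
exists (Bad `|` \big[setU/set0]_(e | good e) F e).
  have mU : measurable (\big[setU/set0]_(e | good e) F e).
    by apply: bigsetU_measurable => e; exact: mF.
  split; first exact: measurableU.
  rewrite (le_trans (measureU2 _ mBad mU))//.
  have -> : zeta = zeta / 4 + (zeta / 2 + zeta / 4) by field.
  rewrite EFinD leeD// (le_trans (measure_bigU_le P good F mF))//.
  apply: (@le_trans _ _ (\sum_(e | good e) ((\sum_x start_weight mu x e *
      exit_function beta gamma h rho kap eps e 0 x
       + C * (kap + eps + eps / kap ^+ 2) * \sum_x start_weight mu x e)%:E))%E).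
    by apply: lee_sum => e /HF[_ []].
  rewrite sumEFin lee_fin.
  have G0 (x : state N) e : 0 <= exit_function beta gamma h rho kap eps e 0 x.
    by rewrite addr_ge0// mulr_ge0 ?invr_ge0 ?sqr_ge0// lyapunov_ge0.
  have Ck0 : 0 <= C * (kap + eps + eps / kap ^+ 2).
    rewrite mulr_ge0// !addr_ge0 ?(ltW kap0) ?(ltW epsgt0)//.
    by rewrite divr_ge0 ?sqr_ge0 ?(ltW epsgt0).
  apply: (@le_trans _ _ (\sum_(e : config N) (\sum_x start_weight mu x e *
      exit_function beta gamma h rho kap eps e 0 x
       + C * (kap + eps + eps / kap ^+ 2) * \sum_x start_weight mu x e))).
    rewrite [leRHS](bigID good)/= lerDl; apply: sumr_ge0 => e _.
    apply: addr_ge0; first by apply: sumr_ge0 => x _; exact: mulr_ge0.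
    by apply: mulr_ge0 => //; apply: sumr_ge0.
  rewrite big_split/= -mulr_sumr (start_weight_sum1 beta gamma h)// mulr1.
  have := HG N rho kap eps N0 Neps epsgt0 rho0 kap0.
  have e2 : eps ^+ 2 <= eps by rewrite expr2 ler_piMr// ltW.
  have Ar : 0 <= rho ^- 2 + kap ^- 2 by rewrite addr_ge0// invr_ge0 sqr_ge0.
  have := ler_wpM2l (mulr_ge0 B0 Ar) e2.
  move: Aeps; rewrite /A; lra.
move=> w t; rewrite -[~ _]/((~` (Bad `|` _)) w) setCU => -[/= nBad nF] /andP[t0 tT].
have gw : good (eta w) by apply: contrapT => /negP; exact: nBad.
have [_ [_ hD]] := HF _ gw.
have nFw : ~ F (eta w) w.
  by move=> Fw; apply: nF; rewrite -bigcup_seq_cond; exists (eta w) => //=;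
    rewrite mem_index_enum gw.
set s := N%:R `^ (1 / 4) * t; set x := X s w; set e := eta w.
have s0 : 0 <= s by rewrite mulr_ge0// ltW.
have sT : s <= T / eps by rewrite /eps invrK /s [leLHS]mulrC ler_wpM2r// ltW.
have : exit_function beta gamma h rho kap eps e s x <= 1.
  by rewrite leNgt; apply/negP => /hD H; apply: nFw; apply: H; rewrite // s0.
move=> /(exit_function_le1 _ _ _ _ rho0 _ _ _ _ _ _ kap0 epsgt0)[Dx Vx].
have ke0 : 0 <= kap * eps by rewrite mulr_ge0 ?ltW.
have [z1 v1 p1 q1 w1] := lyapunov_devs _ _ _ _ _ _ _ ke0 Vx.
have scale (y : R) : `|y| <= kap * eps -> N%:R `^ (1 / 4) * `|y| <= rho.
  move=> ye; rewrite (le_trans (ler_wpM2l (ltW r0) ye))//.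
  by rewrite mulrCA mulfV ?gt_eqF// mulr1.
split; last by split; exact: scale.
have -> : fluct_x beta gamma h x - lam * fluct_r e * t =
    N%:R `^ (1 / 4) * (dev_x beta gamma h x - lam * m_eta e * s).
  by rewrite /fluct_x /fluct_r /dev_x /s -fourth_root_sqr; ring.
rewrite normrM (gtr0_norm r0) (le_trans (ler_wpM2l (ltW r0) Dx))//.
by rewrite mulrCA mulfV ?gt_eqF// mulr1.
Unshelve. all: by end_near. Qed.

End uniform_approximation.

(** * Central limit theorem for the environment *)

Section gaussian.
Context {R : realType} {d : measure_display} {Omega : measurableType d}.
Variables (P : probability Omega R) (H : {RV P >-> R}).
Hypothesis H_gauss : forall A : set R, measurable A ->
  distribution P H A = normal_prob 0 1 A.
Local Notation leb := (@lebesgue_measure R).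
Local Notation phi := (@normal_pdf R 0 1).

Let phiE x : phi x = normal_peak 1 * expR (- (x ^+ 2 / 2)).
Proof.
by rewrite normal_pdfE// /normal_fun subr0 expr1n -mulr_natr mul1r mulNr.
Qed.

(* The same map, with the copy of R on which the Lebesgue measure lives as codomain. *)
Let HR : Omega -> measurableTypeR R := H.
Let mHR : measurable_fun setT HR.
Proof. exact: (@measurable_funPT _ _ _ _ H). Qed.
Let HM : {mfun Omega >-> measurableTypeR R} :=
  HB.pack HR (isMeasurableFun.Build _ _ _ _ HR mHR).

(** The change of variables involves the Radon-Nikodym derivative of the law, which agrees almost
    everywhere with the Gaussian density since both have the same integral over every measurable
    set. *)
Lemma gaussian_ge0_expectation (f : R -> R) :
  measurable_fun setT f -> (forall x, 0 <= f x) ->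
  (\int[P]_w (f (H w))%:E = \int[leb]_x (f x * phi x)%:E)%E.
Proof.
move=> mf f0; pose Ef : measurableTypeR R -> \bar R := EFin \o f.
have mEf : measurable_fun setT Ef by exact/measurable_EFinP.
have f0' x : (0 <= Ef x)%E by rewrite lee_fin.
have -> : (\int[P]_w (f (H w))%:E = \int[pushforward P HM]_y Ef y)%E.
  by rewrite (ge0_integral_pushforward mHR)// => y _.
rewrite (eq_measure_integral (normal_prob 0 1)); last first.
  by move=> A mA _; exact: H_gauss.
have dom := @normal_prob_dominates R 0 1.
rewrite -(Radon_Nikodym_SigmaFinite.change_of_variables dom f0' measurableT mEf).
rewrite /Ef.
apply: ae_eq_integral => //.
- apply: emeasurable_funM => //.
  exact: measurable_int (Radon_Nikodym_SigmaFinite.f_integrable dom).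
- apply/measurable_EFinP; apply: measurable_funM => //.
  exact: measurable_normal_pdf.
- under [X in ae_eq _ _ _ X]eq_fun do rewrite EFinM.
  apply: ae_eqe_mul2l.
  apply: integral_ae_eq => //.
  + exact: Radon_Nikodym_SigmaFinite.f_integrable.
  + by apply/measurable_EFinP; exact: measurable_normal_pdf.
  + by move=> E _ mE; rewrite -Radon_Nikodym_SigmaFinite.f_integral.
Qed.

Lemma gaussian_integrable (f : R -> R) : measurable_fun setT f ->
  leb.-integrable setT (fun x => (f x * phi x)%:E) ->
  P.-integrable setT (fun w => (f (H w))%:E).
Proof.
move=> mf /integrableP[_ fin]; apply/integrableP; split.
  by apply/measurable_EFinP; exact: measurableT_comp.
apply: le_lt_trans fin.
under eq_integral do rewrite abse_EFin.
rewrite (@gaussian_ge0_expectation (fun x => `|f x|))//; last exact: measurableT_comp.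
rewrite le_eqVlt; apply/orP; left; apply/eqP; apply: eq_integral => x _.
by rewrite abse_EFin normrM (ger0_norm (normal_pdf_ge0 _ _ _)).
Qed.

Lemma gaussian_expectation (f : R -> R) : measurable_fun setT f ->
  leb.-integrable setT (fun x => (f x * phi x)%:E) ->
  (\int[P]_w (f (H w))%:E = \int[leb]_x (f x * phi x)%:E)%E.
Proof.
move=> mf intf.
pose fp x := Num.max (f x) 0; pose fn x := Num.max (- f x) 0.
have mfp : measurable_fun setT fp by apply: measurable_maxr.
have mfn : measurable_fun setT fn by apply: measurable_maxr => //; exact: measurableT_comp.
rewrite [LHS]integralE [RHS]integralE.
have -> : ((fun w : Omega => (f (H w))%:E)^\+)%E = fun w => (fp (H w))%:E.
  by apply/funext => w; rewrite funeposE -EFin_max.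
have -> : ((fun w : Omega => (f (H w))%:E)^\-)%E = fun w => (fn (H w))%:E.
  by apply/funext => w; rewrite funenegE -EFin_max.
rewrite !gaussian_ge0_expectation//; try by move=> x; rewrite le_max lexx orbT.
congr (_ - _)%E; apply: eq_integral => x _.
  by rewrite funeposE -EFin_max maxr_pMl ?normal_pdf_ge0// mul0r.
by rewrite funenegE -EFinN -EFin_max -mulNr maxr_pMl ?normal_pdf_ge0// mul0r.
Qed.

(** From x^2 / 4 <= exp (x^2 / 4) one gets x^2 exp (- x^2 / 2) <= 4 exp (- x^2 / 4), a multiple of
    the density of variance 2; hence the standard deviation sqrt 2. *)
Let integrable_sqr_phi : leb.-integrable setT (fun x => (x ^+ 2 * phi x)%:E).
Proof.
pose s : R := Num.sqrt 2.
have s2 : s ^+ 2 = 1 + 1 by rewrite sqr_sqrtr.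
have s0 : s != 0 by rewrite gt_eqF// sqrtr_gt0.
have ms0 : normal_peak s != 0 by rewrite gt_eqF// normal_peak_gt0.
apply: (@le_integrable _ _ _ leb _ measurableT _
  (fun x => (4 * normal_peak 1 / normal_peak s)%:E * (normal_pdf 0 s x)%:E)%E).
- apply/measurable_EFinP; apply: measurable_funM; last exact: measurable_normal_pdf.
  exact: measurable_funX.
- move=> x _; rewrite -EFinM !abse_EFin lee_fin.
  rewrite ger0_norm; last exact: mulr_ge0 (sqr_ge0 x) (normal_pdf_ge0 0 1 x).
  apply: le_trans (ler_norm _).
  rewrite phiE (normal_pdfE _ s0) /normal_fun subr0 s2 mulr2n.
  rewrite (_ : _ * (normal_peak s * _) =
    normal_peak 1 * (4 * expR (- x ^+ 2 / (1 + 1 + (1 + 1))))); last first.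
    by field.
  rewrite (_ : 1 + 1 + (1 + 1) = 2 * 2); last by ring.
  rewrite mulrCA ler_wpM2l ?normal_peak_ge0//.
  have -> : - (x ^+ 2 / 2) = - x ^+ 2 / (2 * 2) + - x ^+ 2 / (2 * 2) by field.
  rewrite expRD mulrA ler_wpM2r ?expR_ge0//.
  have := expR_ge1Dx (x ^+ 2 / (2 * 2)).
  have -> : - x ^+ 2 / (2 * 2) = - (x ^+ 2 / (2 * 2)) by rewrite mulNr.
  rewrite expRN -ler_pdivlMr ?invr_gt0 ?expR_gt0// invrK.
  by move: (expR _) => e; lra.
- apply: integrableZl => //; exact: integrable_normal_pdf.
Qed.

Lemma integrable_quadratic_phi (f : R -> R) A B : measurable_fun setT f ->
  (forall x, `|f x| <= A + B * x ^+ 2) ->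
  leb.-integrable setT (fun x => (f x * phi x)%:E).
Proof.
move=> mf fAB.
apply: (@le_integrable _ _ _ leb _ measurableT _
  (fun x => (A%:E * (phi x)%:E + B%:E * (x ^+ 2 * phi x)%:E))%E).
- apply/measurable_EFinP; apply: measurable_funM => //; exact: measurable_normal_pdf.
- move=> x _; rewrite -!EFinM -EFinD !abse_EFin lee_fin normrM.
  rewrite (ger0_norm (normal_pdf_ge0 _ _ _)) (le_trans _ (ler_norm _))//.
  by rewrite mulrA -mulrDl ler_wpM2r ?normal_pdf_ge0.
- by apply: integrableD => //; apply: integrableZl => //; exact: integrable_normal_pdf.
Qed.

Let is_derive_phi x : is_derive x (1 : R) phi (- x * phi x).
Proof.
have -> : phi = fun x => normal_peak 1 * expR (- (x ^+ 2 / 2)).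
  by apply/funext => y; exact: phiE.
by apply: is_derive_eq; rewrite /GRing.scale/=; field.
Qed.

(** A crude consequence of exp u >= 1 + u. A decay in 1/n suffices for the boundary terms of the
    integration by parts. *)
Let phi_bound n : phi n.+1%:R <= normal_peak 1 * 2 * n.+1%:R^-1.
Proof.
rewrite phiE -mulrA ler_wpM2l ?normal_peak_ge0//.
have n1 : 1 <= n.+1%:R :> R by rewrite ler1n.
move: n.+1%:R n1 => x x1; have x0 : 0 < x by lra.
rewrite expRN -[leRHS]invrK invfM invrK lef_pV2 ?posrE ?expR_gt0 ?mulr_gt0 ?invr_gt0//.
have := expR_ge1Dx (x ^+ 2 / 2); nra.
Qed.

Let phiN x : phi (- x) = phi x.
Proof. by rewrite !phiE sqrrN. Qed.

(** The integrand is the derivative of g phi. Its integral over [-n-1, n+1] is a boundary term that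
    tends to 0, and dominated convergence gives the whole line. *)
Lemma stein_density (g dg : R -> R) B :
  (forall x, is_derive x (1 : R) g (dg x)) -> continuous dg ->
  (forall x, `|g x| <= B) -> (forall x, `|dg x| <= B) ->
  (\int[leb]_x ((dg x - x * g x) * phi x)%:E = 0)%E.
Proof.
move=> ddg cdg gB dgB.
have B0 : 0 <= B := le_trans (normr_ge0 _) (gB 0).
have cg : continuous g.
  by move=> x; apply: differentiable_continuous; apply/derivable1_diffP.
have cphi : continuous phi by exact: continuous_normal_pdf.
pose F x := g x * phi x; pose f x := (dg x - x * g x) * phi x.
have dF x : is_derive x (1 : R) F (f x).
  have ? := ddg x; have ? := is_derive_phi x; apply: is_derive_eq.
  by rewrite /f /GRing.scale/=; ring.
have cF : continuous F by move=> x; apply: cvgM; [exact: cg|exact: cphi].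
have cf : continuous f.
  move=> x; apply: cvgM; last exact: cphi.
  by apply: cvgB; [exact: cdg|apply: cvgM; [exact: cvg_id|exact: cg]].
pose D n := [set` `[- n.+1%:R : R, n.+1%:R]].
have FTC n : (\int[leb]_(x in D n) (f x)%:E = (F n.+1%:R - F (- n.+1%:R))%:E)%E.
  rewrite /D EFinB; apply: continuous_FTC2.
  - by rewrite gtrN// ltr0n.
  - exact: continuous_subspaceT.
  - split => [x _||]; first exact: ex_derive.
    + by apply: cvg_within_filter; exact: cF.
    + by apply: cvg_within_filter; exact: cF.
  - by move=> x _; rewrite derive1E; exact: derive_val.
have mf : measurable_fun setT f by exact: continuous_measurable_fun.
have intf : leb.-integrable setT (EFin \o f).
  apply: (@integrable_quadratic_phi (fun x => dg x - x * g x) (2 * B) B).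
    apply: continuous_measurable_fun => x.
    by apply: cvgB; [exact: cdg|apply: cvgM; [exact: cvg_id|exact: cg]].
  move=> x; rewrite (le_trans (ler_normB _ _))// normrM.
  have h1 := ler_wpM2l (normr_ge0 x) (gB x).
  have h2 := dgB x.
  have h3 : `|x| * B <= B + B * x ^+ 2.
    have := sqr_ge0 (`|x| - 1); rewrite -[x ^+ 2]real_normK ?num_real//; nra.
  lra.
have mD n : measurable (D n) by exact: measurable_itv.
have [|||||_ _ lim1] := @dominated_convergence _ _ _ leb setT measurableT
  (fun n => (EFin \o f) \_ (D n)) (EFin \o f) (fun x => `|(EFin \o f) x|%E).
- move=> n; apply/(measurable_restrictT _ (mD n)).
  by apply/measurable_EFinP; apply: measurable_funTS.
- exact/measurable_EFinP.
- apply: aeW => x _; apply: cvg_near_cst; near=> n; rewrite patchE ifT//.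
  apply/mem_set; rewrite /D/= in_itv/= -ler_norml; near: n.
  have := nbhs_infty_ger `|x|; apply: filterS => n /le_trans; apply.
  by rewrite ler_nat.
- exact: integrable_abse.
- apply: aeW => x n _; rewrite patchE; case: ifP => // _.
  by rewrite abse0 abse_ge0.
apply: (cvg_unique _ lim1); first exact: ereal_hausdorff.
rewrite (_ : (fun n => _) = (fun n => (F n.+1%:R - F (- n.+1%:R))%:E)); last first.
  by apply/funext => n; rewrite -FTC -integral_mkcond.
apply: cvg_EFin; first by near=> n.
rewrite /comp/=; apply/norm_cvg0P.
apply: (@squeeze_cvgr _ _ _ _ (fun=> 0) (fun n => 4 * B * normal_peak 1 * harmonic n)).
- near=> n; rewrite normr_ge0/= (le_trans (ler_normB _ _))// !normrM phiN.
  rewrite (ger0_norm (normal_pdf_ge0 0 1 n.+1%:R)) -mulrDl.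
  have h1 := gB n.+1%:R; have h2 := gB (- n.+1%:R).
  rewrite (le_trans (ler_wpM2r (normal_pdf_ge0 _ _ _) (lerD h1 h2)))//.
  have := ler_wpM2l B0 (phi_bound n).
  by move: (phi _) (n.+1%:R^-1) (normal_peak 1) => a b c; lra.
- exact: cvg_cst.
- rewrite -[X in _ --> X](mulr0 (4 * B * normal_peak 1)).
  by apply: cvgMr; exact: cvg_harmonic.
Unshelve. all: by end_near. Qed.

Lemma gaussian_bounded_integrable (f : R -> R) B : measurable_fun setT f ->
  (forall x, `|f x| <= B) -> P.-integrable setT (fun w => (f (H w))%:E).
Proof.
move=> mf fB; apply: gaussian_integrable => //.
by apply: (integrable_quadratic_phi f B 0) => // x; rewrite mul0r addr0.
Qed.

Lemma gaussian_quadratic_integrable (f : R -> R) A B : measurable_fun setT f ->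
  (forall x, `|f x| <= A + B * x ^+ 2) -> P.-integrable setT (fun w => (f (H w))%:E).
Proof.
move=> mf fB; apply: gaussian_integrable => //.
exact: (integrable_quadratic_phi f A B).
Qed.

Lemma gaussian_stein (g dg : R -> R) B :
  (forall x, is_derive x (1 : R) g (dg x)) -> continuous dg ->
  (forall x, `|g x| <= B) -> (forall x, `|dg x| <= B) ->
  (\int[P]_w (H w * g (H w)) = \int[P]_w dg (H w))%R.
Proof.
move=> ddg cdg gB dgB.
have cg : continuous g.
  by move=> x; apply: differentiable_continuous; apply/derivable1_diffP.
have mg : measurable_fun setT (fun x : R => x * g x).
  apply: continuous_measurable_fun => x.
  by apply: cvgM; [exact: cvg_id|exact: cg].
have mdg : measurable_fun setT dg by exact: continuous_measurable_fun.
have xgB x : `|x * g x| <= B + B * x ^+ 2.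
  rewrite normrM; have := ler_wpM2l (normr_ge0 x) (gB x).
  have := sqr_ge0 (`|x| - 1); rewrite -[x ^+ 2]real_normK ?num_real//.
  have := le_trans (normr_ge0 _) (gB 0); nra.
have i1 := gaussian_quadratic_integrable _ _ _ mg xgB.
have i2 := gaussian_bounded_integrable _ _ mdg dgB.
apply/eqP; rewrite eq_sym -subr_eq0 -RintegralB//; apply/eqP.
rewrite /Rintegral (gaussian_expectation (fun x => dg x - x * g x)).
- by rewrite (stein_density g dg B).
- exact: measurable_funB.
- apply: (integrable_quadratic_phi _ (B + B) B); first exact: measurable_funB.
  move=> x; rewrite (le_trans (ler_normB _ _))//.
  by have := xgB x; have := dgB x; lra.
Qed.

End gaussian.

(** * Gaussian smoothing and Lindeberg's exchange *)

Lemma is_derive_quadratic {R : realType} (g : R -> R) (x l C : R) :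
  (forall t, `|g (x + t) - g x - t * l| <= C * t ^+ 2) -> is_derive x (1 : R) g l.
Proof.
move=> gC; have C0 : 0 <= C.
  by have := le_trans (normr_ge0 _) (gC 1); rewrite expr1n mulr1.
have cv : h^-1 *: (g (h *: 1 + x) - g x) @[h --> 0^'] --> l.
  apply/cvgrPdist_le => e e0; near=> h.
  have h0 : h != 0 by near: h; exact: nbhs_dnbhs_neq.
  have he : `|h| <= e / (C + 1).
    near: h; apply: dnbhs0_le; by rewrite divr_gt0// ltr_wpDl.
  rewrite /GRing.scale/= mulr1 distrC.
  have -> : h^-1 * (g (h + x) - g x) - l = h^-1 * (g (x + h) - g x - h * l).
    by rewrite [x + h]addrC; field.
  rewrite normrM normfV mulrC ler_pdivrMr ?normr_gt0// (le_trans (gC h))//.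
  rewrite -[h ^+ 2]real_normK ?num_real// expr2 mulrA ler_wpM2r//.
  move: he; rewrite ler_pdivlMr ?ltr_wpDl// => he.
  by have := normr_ge0 h; nra.
have dg : derivable g x 1 by apply/cvg_ex; exists l.
apply: DeriveDef => //; exact: cvg_lim cv.
Unshelve. all: by end_near. Qed.

Section lindeberg_step.
Context {R : realType} {d : measure_display} {Omega : measurableType d}.
Variables (P : probability Omega R) (H : {RV P >-> R}).
Hypothesis H_gauss : forall A : set R, measurable A ->
  distribution P H A = normal_prob 0 1 A.

Let Ex (phi : R -> R) : R := (\int[P]_w phi (H w))%R.

(** A class stable under the operations used below, in which integrability under the Gaussian law is
    automatic. *)
Let quad (phi : R -> R) := measurable_fun setT phi /\
  exists A B, forall x, `|phi x| <= A + B * x ^+ 2.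

Let quad_integrable phi : quad phi -> P.-integrable setT (fun w => (phi (H w))%:E).
Proof. by move=> [m [A [B b]]]; exact: gaussian_quadratic_integrable H_gauss _ _ _ m b. Qed.

Let quadD f g : quad f -> quad g -> quad (fun x => f x + g x).
Proof.
move=> [mf [A [B fb]]] [mg [A' [B' gb]]]; split; first exact: measurable_funD.
exists (A + A'), (B + B') => x.
by rewrite (le_trans (ler_normD _ _))// mulrDl addrACA lerD.
Qed.

Let quadZ c f : quad f -> quad (fun x => c * f x).
Proof.
move=> [mf [A [B fb]]]; split; first exact: measurable_funM.
exists (`|c| * A), (`|c| * B) => x.
by rewrite normrM -mulrA -mulrDr ler_wpM2l.
Qed.

Let quad_bounded f B : continuous f -> (forall x, `|f x| <= B) -> quad f.
Proof.
move=> cf fB; split; first exact: continuous_measurable_fun.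
by exists B, 0 => x; rewrite mul0r addr0.
Qed.

Let quad_sqr : quad (fun x => x ^+ 2).
Proof.
split; first by apply: continuous_measurable_fun; exact: exprn_continuous.
by exists 0, 1 => x; rewrite add0r mul1r ger0_norm ?sqr_ge0.
Qed.

Let quad_norm : quad (fun x => `|x|).
Proof.
split; first by apply: continuous_measurable_fun; exact: norm_continuous.
exists 1, 1 => x; rewrite normr_id mul1r -[x ^+ 2]real_normK ?num_real//.
by have := sqr_ge0 (`|x| - 1); nra.
Qed.

Let ExD f g : quad f -> quad g -> Ex (fun x => f x + g x) = Ex f + Ex g.
Proof. by move=> qf qg; rewrite /Ex RintegralD//; exact: quad_integrable. Qed.

Let ExZ c f : quad f -> Ex (fun x => c * f x) = c * Ex f.
Proof. by move=> qf; rewrite /Ex RintegralZl//; exact: quad_integrable. Qed.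

Let Ex_le f g : quad f -> quad g -> (forall x, `|f x| <= g x) -> `|Ex f| <= Ex g.
Proof.
move=> qf qg fg; rewrite /Ex (le_trans (le_normr_Rintegral _ _))//.
  exact: quad_integrable.
apply: le_Rintegral => //.
- exact/integrable_norm/quad_integrable.
- exact: quad_integrable.
Qed.

Let m1 := Ex (fun x => `|x|).
Let m2 := Ex (fun x => x ^+ 2).

Variables (f f1 f2 f3 : R -> R) (B : R).
Hypothesis df : forall x, is_derive x (1 : R) f (f1 x).
Hypothesis df1 : forall x, is_derive x (1 : R) f1 (f2 x).
Hypothesis df2 : forall x, is_derive x (1 : R) f2 (f3 x).
Hypothesis fB : forall x, `|f x| <= B.
Hypothesis f1B : forall x, `|f1 x| <= B.
Hypothesis f2B : forall x, `|f2 x| <= B.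
Hypothesis f3B : forall x, `|f3 x| <= B.

Let B0 : 0 <= B. Proof. exact: le_trans (normr_ge0 _) (fB 0). Qed.

Let cts (g dg : R -> R) : (forall x, is_derive x (1 : R) g (dg x)) -> continuous g.
Proof.
by move=> dgx x; apply: differentiable_continuous; apply/derivable1_diffP.
Qed.

Let quad_affine (g : R -> R) (y s : R) : continuous g -> (forall x, `|g x| <= B) ->
  quad (fun z => g (y + s * z)).
Proof.
move=> cg gB; apply: quad_bounded => // z.
apply: (@cvg_comp _ _ _ (fun z => y + s * z) g); last exact: cg.
by apply: cvgD; [exact: cvg_cst|apply: cvgMr; exact: cvg_id].
Qed.

(** The heat semigroup at time s^2 applied to g. *)
Definition gauss_smooth (g : R -> R) s y : R := (\int[P]_w g (y + s * H w))%R.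

Let qf y s := quad_affine f y s (cts f f1 df) fB.
Let qf1 y s := quad_affine f1 y s (cts f1 f2 df1) f1B.
Let qf2 y s := quad_affine f2 y s (cts f2 f3 df2) f2B.

Let quad_Hf1 y s : quad (fun z => z * f1 (y + s * z)).
Proof.
have [m _] := qf1 y s; split.
  by apply: measurable_funM => //; exact: measurable_id.
exists B, B => x; rewrite normrM.
have := ler_wpM2l (normr_ge0 x) (f1B (y + s * x)).
rewrite -[x ^+ 2]real_normK ?num_real//.
have := sqr_ge0 (`|x| - 1); have := B0; nra.
Qed.

(** The heat equation in the standard deviation r. The derivative is the mean of H f1 (y + r H),
    which Stein's identity turns into r times that of f2. Instead of differentiating under the
    integral, a Taylor bound is integrated, and [is_derive_quadratic] concludes. *)
Lemma is_derive_gauss_smooth y r :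
  is_derive r (1 : R) (fun r => gauss_smooth f r y) (r * gauss_smooth f2 r y).
Proof.
have -> : r * gauss_smooth f2 r y = Ex (fun z => z * f1 (y + r * z)).
  have -> : r * gauss_smooth f2 r y = Ex (fun z => r * f2 (y + r * z)) by rewrite ExZ.
  apply/esym; rewrite /Ex.
  apply: (gaussian_stein P H H_gauss (fun z => f1 (y + r * z))
    (fun z => r * f2 (y + r * z)) (B + `|r| * B)) => z.
  - have d1 : is_derive z (1 : R) (fun z => y + r * z) r.
      by apply: is_derive_eq; rewrite /GRing.scale/=; ring.
    have d2 := df1 (y + r * z).
    have := @is_derive1_comp R f1 (fun z => y + r * z) z _ _ d2 d1.
    by rewrite [r * f2 _]mulrC.
  - apply: cvgMr; apply: (@cvg_comp _ _ _ (fun z => y + r * z) f2).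
      by apply: cvgD; [exact: cvg_cst|apply: cvgMr; exact: cvg_id].
    exact: cts df2 _.
  - by rewrite (le_trans (f1B _))// lerDl mulr_ge0.
  - by rewrite normrM (le_trans (ler_wpM2l _ (f2B _)))// lerDr.
apply: (is_derive_quadratic _ _ _ (B * m2)) => t.
have -> : gauss_smooth f (r + t) y - gauss_smooth f r y
    - t * Ex (fun z => z * f1 (y + r * z)) =
  Ex (fun z => f (y + (r + t) * z) + (-1 * f (y + r * z) + - t * (z * f1 (y + r * z)))).
  by rewrite !ExD ?ExZ//; [rewrite /Ex /gauss_smooth; ring|..];
    do ?[exact: quadZ|exact: quadD|apply: quadD].
have -> : B * m2 * t ^+ 2 = Ex (fun z => B * t ^+ 2 * z ^+ 2).
  by rewrite ExZ// /m2; ring.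
apply: Ex_le.
- by apply: quadD => //; apply: quadD; exact: quadZ.
- exact: quadZ.
- move=> z; have := taylor2_bound f f1 f2 B (y + r * z) (t * z) df df1 f2B.
  rewrite (_ : y + r * z + t * z = y + (r + t) * z); last by ring.
  rewrite (_ : B * (t * z) ^+ 2 = B * t ^+ 2 * z ^+ 2); last by ring.
  by apply: le_trans; rewrite le_eqVlt; apply/orP; left; apply/eqP; congr `|_|; ring.
Qed.

Let gauss_smooth2_lipschitz y r s :
  `|gauss_smooth f2 r y - gauss_smooth f2 s y| <= B * `|r - s| * m1.
Proof.
have -> : gauss_smooth f2 r y - gauss_smooth f2 s y =
    Ex (fun z => f2 (y + r * z) + -1 * f2 (y + s * z)).
  by rewrite ExD ?ExZ//; [rewrite /Ex /gauss_smooth; ring|exact: quadZ].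
rewrite /m1 -ExZ//; apply: Ex_le.
- by apply: quadD => //; exact: quadZ.
- exact: quadZ.
- move=> z; have := le_norm_MVT f2 f3 B (y + s * z) ((r - s) * z) df2 (fun t _ => f3B t).
  rewrite (_ : y + s * z + _ = y + r * z); last by ring.
  by rewrite normrM mulrA mulN1r.
Qed.

(** With its second order term removed, the smoothing has derivative r times a difference of
    smoothings of f2, at most s' B dd m1 on the interval. Since (s' + s) dd = a^2 and dd <= a, the
    product s' dd^2 is at most a^3, also when s = 0. *)
Let gauss_smooth_time (y s s' a : R) : 0 <= s -> s <= s' -> 0 <= a ->
  s' ^+ 2 = s ^+ 2 + a ^+ 2 ->
  `|gauss_smooth f s' y - gauss_smooth f s y - a ^+ 2 / 2 * gauss_smooth f2 s y| <=
  B * m1 * a ^+ 3.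
Proof.
move=> s0 ss' a0 s'E; pose dd := s' - s.
have dd0 : 0 <= dd by rewrite subr_ge0.
have m10 : 0 <= m1 by apply: Rintegral_ge0.
pose th r := gauss_smooth f r y - r ^+ 2 / 2 * gauss_smooth f2 s y.
have -> : gauss_smooth f s' y - gauss_smooth f s y - a ^+ 2 / 2 * gauss_smooth f2 s y =
    th (s + dd) - th s.
  have -> : a ^+ 2 = s' ^+ 2 - s ^+ 2 by rewrite s'E; ring.
  by rewrite /th /dd subrKC; ring.
have := @le_norm_MVT R th (fun r => r * (gauss_smooth f2 r y - gauss_smooth f2 s y))
  (s' * (B * dd * m1)) s dd _ _.
move=> /(_ _ _)/le_trans; apply.
- move=> r; have ? := is_derive_gauss_smooth y r; rewrite /th; apply: is_derive_eq.
  by rewrite /GRing.scale/=; field.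
- move=> r; rewrite (ger0_norm dd0) => rs; rewrite normrM ler_pM//.
    move: rs; rewrite ler_norml => /andP[r1 r2]; rewrite ler_norml.
    by rewrite /dd in r1 r2; apply/andP; split; lra.
  rewrite (le_trans (gauss_smooth2_lipschitz _ _ _))// ler_wpM2r// ler_wpM2l//.
rewrite (ger0_norm dd0).
have dda : dd <= a.
  have s'0 := le_trans s0 ss'.
  rewrite /dd lerBlDl -(@ler_pXn2r _ 2)// ?nnegrE ?(addr_ge0 s0 a0)//.
  by rewrite s'E; have := mulr_ge0 s0 a0; nra.
have sdd : s' * dd <= a ^+ 2.
  have : (s' + s) * dd = a ^+ 2 by rewrite /dd mulrC -subr_sqr s'E; ring.
  by have := mulr_ge0 s0 dd0; lra.
have -> : s' * (B * dd * m1) * dd = B * m1 * ((s' * dd) * dd) by ring.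
rewrite ler_wpM2l ?mulr_ge0// [leRHS]exprSr ler_pM// mulr_ge0//.
exact: le_trans ss'.
Qed.

Let gauss_smooth_space (y s a : R) : 0 <= a ->
  `|(gauss_smooth f s (y + a) + gauss_smooth f s (y - a)) / 2 - gauss_smooth f s y
    - a ^+ 2 / 2 * gauss_smooth f2 s y| <= B * a ^+ 3.
Proof.
move=> a0.
have Ex1 : Ex (fun=> 1) = 1.
  have -> : Ex (fun=> 1) = 1 * fine (P setT) by exact: Rintegral_cst.
  by rewrite probability_setT mulr1.
have q1 : quad (fun=> 1) by apply: (quad_bounded _ 1) => x; [exact: cvg_cst|rewrite normr1].
have -> : (gauss_smooth f s (y + a) + gauss_smooth f s (y - a)) / 2 - gauss_smooth f s y
    - a ^+ 2 / 2 * gauss_smooth f2 s y =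
    Ex (fun z => 2^-1 * f (y + a + s * z) + (2^-1 * f (y - a + s * z) +
      (-1 * f (y + s * z) + - (a ^+ 2 / 2) * f2 (y + s * z)))).
  by rewrite !ExD ?ExZ//; [rewrite /Ex /gauss_smooth; field|..];
    do ?[exact: quadZ|exact: quadD|apply: quadD].
have -> : B * a ^+ 3 = Ex (fun=> B * a ^+ 3 * 1) by rewrite ExZ// Ex1 mulr1.
apply: Ex_le.
- by do ?[exact: quadZ|exact: quadD|apply: quadD].
- exact: quadZ.
- move=> z; have t1 := taylor3_bound f f1 f2 f3 B (y + s * z) a df df1 df2 f3B.
  have t2 := taylor3_bound f f1 f2 f3 B (y + s * z) (- a) df df1 df2 f3B.
  rewrite (ger0_norm a0) in t1; rewrite normrN sqrrN (ger0_norm a0) in t2; rewrite mulr1.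
  rewrite (_ : y + a + s * z = y + s * z + a); last by ring.
  rewrite (_ : y - a + s * z = y + s * z + - a); last by ring.
  rewrite ler_norml; move: t1 t2; rewrite !ler_norml => /andP[? ?] /andP[? ?].
  apply/andP; split; lra.
Qed.

(** Adding a sign of size a and increasing the variance by a^2 both add a^2 / 2 times the smoothing
    of f2, up to order a^3. The Gaussian increment is absorbed into the variance, so a single
    Gaussian variable H serves for all exchanges. *)
Lemma lindeberg_step (y s s' a : R) : 0 <= s -> s <= s' -> 0 <= a ->
  s' ^+ 2 = s ^+ 2 + a ^+ 2 ->
  `|(gauss_smooth f s (y + a) + gauss_smooth f s (y - a)) / 2 - gauss_smooth f s' y| <=
  (B + B * (\int[P]_w `|H w|)%R) * a ^+ 3.
Proof.
move=> s0 ss' a0 s'E.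
have h1 := gauss_smooth_space y s a a0.
have h2 := gauss_smooth_time y s s' a s0 ss' a0 s'E.
rewrite -/(Ex (fun x => `|x|)) -/m1 [(B + _) * _]mulrDl.
apply: le_trans (lerD h1 h2); rewrite -[X in _ <= _ + X]normrN.
rewrite (le_trans _ (ler_normD _ _))// le_eqVlt; apply/orP; left; apply/eqP.
by congr `|_|; ring.
Qed.

End lindeberg_step.

Section configuration_means.
Context {R : realType} {N : nat}.
Implicit Types (e : config N) (F : config N -> R).

Definition config_mean F : R := (1 / 2) ^+ N * \sum_e F e.

Lemma flip_involutive k : involutive (@flip N k).
Proof. by move=> e; apply/ffunP => j; rewrite !ffunE; case: eqP => // _; rewrite negbK. Qed.

Lemma config_mean_flip k F : config_mean F = config_mean (fun e => (F e + F (flip k e)) / 2).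
Proof.
rewrite /config_mean -mulr_suml big_split/=.
rewrite [X in _ + X](_ : _ = \sum_e F e); last first.
  by rewrite [RHS](reindex_inj (inv_inj (flip_involutive k))).
by field.
Qed.

Lemma config_mean_cst (c : R) : config_mean (fun=> c) = c.
Proof.
rewrite /config_mean sumr_const.
rewrite (_ : #|_| = 2 ^ N)%N; last by rewrite card_ffun card_bool card_ord.
by rewrite -(mulr_natr c) natrX mulrCA -exprMn (_ : 1 / 2 * 2 = 1) ?expr1n ?mulr1//; field.
Qed.

Lemma config_meanD F G : config_mean (fun e => F e + G e) = config_mean F + config_mean G.
Proof. by rewrite /config_mean big_split/= mulrDr. Qed.

Lemma config_meanZ c F : config_mean (fun e => c * F e) = c * config_mean F.
Proof. by rewrite /config_mean -mulr_sumr mulrCA. Qed.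

Lemma config_meanB_le F G D : (forall e, `|F e - G e| <= D e) ->
  `|config_mean F - config_mean G| <= config_mean D.
Proof.
move=> FGD; rewrite /config_mean -mulrBr -sumrB normrM ger0_norm ?exprn_ge0//.
by rewrite ler_wpM2l ?exprn_ge0// (le_trans (ler_norm_sum _ _ _))// ler_sum.
Qed.

End configuration_means.

Section lindeberg.
Context {R : realType} {d : measure_display} {Omega : measurableType d}.
Variables (P : probability Omega R) (H : {RV P >-> R}).
Hypothesis H_gauss : forall A : set R, measurable A ->
  distribution P H A = normal_prob 0 1 A.
Variables (f f1 f2 f3 : R -> R) (B : R).
Hypothesis df : forall x, is_derive x (1 : R) f (f1 x).
Hypothesis df1 : forall x, is_derive x (1 : R) f1 (f2 x).
Hypothesis df2 : forall x, is_derive x (1 : R) f2 (f3 x).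
Hypothesis fB : forall x, `|f x| <= B.
Hypothesis f1B : forall x, `|f1 x| <= B.
Hypothesis f2B : forall x, `|f2 x| <= B.
Hypothesis f3B : forall x, `|f3 x| <= B.

(* The spins are exchanged one by one for Gaussian variables of the same
   variance: hybrid k has already exchanged the first k of them. *)
Lemma lindeberg : exists2 C, 0 <= C & forall N, (0 < N)%N ->
  `|config_mean (fun e : config N => f (fluct_r e)) - \int[P]_w f (H w)| <=
  C / Num.sqrt N%:R.
Proof.
exists (B + B * (\int[P]_w `|H w|)%R).
  have B0 : 0 <= B by exact: le_trans (normr_ge0 _) (fB 0).
  by rewrite addr_ge0// mulr_ge0// Rintegral_ge0.
move=> N N0; set C := B + _; pose a : R := (Num.sqrt N%:R)^-1.
have a0 : 0 <= a by rewrite invr_ge0 sqrtr_ge0.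
pose S k (e : config N) := a * \sum_(j < N | (k <= j)%N) spin (e j).
pose A k := config_mean (fun e => gauss_smooth P H f (a * Num.sqrt k%:R) (S k e)).
have step k : (k < N)%N -> `|A k - A k.+1| <= C * a ^+ 3.
  move=> kN; pose k' := Ordinal kN.
  have Sk e : S k e = a * spin (e k') + S k.+1 e.
    rewrite /S (bigD1 k') ?leqnn//= mulrDr; congr (_ + a * _).
    by apply: eq_bigl => j; rewrite [RHS]ltn_neqAle [RHS]andbC eq_sym.
  have SkF e : S k.+1 (flip k' e) = S k.+1 e.
    congr (a * _); apply: eq_bigr => j kj; rewrite ffunE ifN//.
    by apply: contraTN kj => /eqP ->; rewrite -leqNgt.
  rewrite {1}/A (config_mean_flip k') -[leRHS](config_mean_cst (N := N)).
  apply: config_meanB_le => e.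
  have s0 : 0 <= a * Num.sqrt k%:R by rewrite mulr_ge0 ?sqrtr_ge0.
  have ss : a * Num.sqrt k%:R <= a * Num.sqrt k.+1%:R.
    by rewrite ler_wpM2l// ler_wsqrtr// ler_nat.
  have := lindeberg_step P H H_gauss f f1 f2 f3 B df df1 df2 fB f1B f2B f3B
    (S k.+1 e) _ _ a s0 ss a0.
  rewrite !exprMn !sqr_sqrtr// -[k.+1]addn1 natrD mulrDr mulr1 addn1 => /(_ erefl).
  apply: le_trans; rewrite le_eqVlt; apply/orP; left; apply/eqP; congr (`|_ / 2 - _|).
  rewrite (Sk (flip k' e)) SkF Sk ffunE eqxx spinN mulrN.
  rewrite [a * _ + _]addrC [- _ + _]addrC /spin.
  case: (e k'); first by rewrite !mulr1.
  by rewrite !mulrN1 opprK; exact: addrC.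
have AN : A N = \int[P]_w f (H w).
  rewrite /A -[RHS](config_mean_cst (N := N)); congr config_mean; apply/funext => e.
  rewrite /gauss_smooth /a mulVf ?gt_eqF ?sqrtr_gt0 ?ltr0n//.
  rewrite /S big1 ?mulr0; first by apply: eq_Rintegral => w _; rewrite add0r mul1r.
  by move=> j; rewrite leqNgt ltn_ord.
have A0 : A 0%N = config_mean (fun e : config N => f (fluct_r e)).
  congr config_mean; apply/funext => e; rewrite /gauss_smooth sqrtr0 mulr0.
  have -> : S 0%N e = fluct_r e.
    rewrite /S /fluct_r div1r powR12_sqrt// /m_eta /average mulrA; congr (_ * _).
      rewrite /a -[in X in _ = _ / X](@sqr_sqrtr _ N%:R)// expr2 invfM mulrA divff ?mul1r//.
      by rewrite gt_eqF// sqrtr_gt0 ltr0n.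
  rewrite (_ : (fun _ => _) = (fun=> f (fluct_r e))).
    have -> : (\int[P]_(_ in setT) f (fluct_r e))%R = f (fluct_r e) * fine (P setT).
      exact: Rintegral_cst.
    by rewrite probability_setT mulr1.
  by apply/funext => w; rewrite mul0r addr0.
have total k : (k <= N)%N -> `|A 0%N - A k| <= k%:R * (C * a ^+ 3).
  elim: k => [_|k IHk kN]; first by rewrite subrr normr0 mul0r.
  rewrite -(subrKA (A k)) (le_trans (ler_normD _ _))// -natr1 mulrDl mul1r.
  exact: lerD (IHk (ltnW kN)) (step k kN).
have := total N (leqnn _); rewrite A0 AN => /le_trans; apply.
rewrite le_eqVlt; apply/orP; left; apply/eqP.
rewrite -[X in X * _](@sqr_sqrtr _ N%:R)// /a.
have : Num.sqrt N%:R != 0 :> R by rewrite gt_eqF// sqrtr_gt0 ltr0n.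
by move: (Num.sqrt _) => s s0; field.
Qed.

End lindeberg.

(** * Smooth approximation of continuous functions *)

Section sliding_averages.
Context {R : realType}.
Local Notation leb := (@lebesgue_measure R).

Lemma antiderivative_left_vanishing (f : R -> R) (a B : R) : continuous f ->
  (forall x, `|f x| <= B) -> (forall x, x <= a -> f x = 0) ->
  exists G, forall x, is_derive x (1 : R) G (f x).
Proof.
move=> cf fB f0; exists (fun x => \int[leb]_(t in `]-oo, x]) f t)%R => x.
have mf : measurable_fun setT f by exact: continuous_measurable_fun.
have intf : leb.-integrable `]-oo, x + 1] (EFin \o f).
  apply: (@le_integrable _ _ _ leb _ _ _ (fun y => (B * \1_(`[a, x + 1] : set R) y)%:E)) => //.
  - by apply/measurable_EFinP; exact: measurable_funTS.
  - move=> y /=; rewrite in_itv/= => yx; rewrite lee_fin.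
    have B0 : 0 <= B by exact: le_trans (normr_ge0 _) (fB 0).
    rewrite indicE; have [ya|ay] := leP y a.
      by rewrite f0// normr0.
    by rewrite mem_set/= ?in_itv/= ?(ltW ay)// mulr1 (le_trans (fB y))// ler_norm.
  - apply: (@integrableS _ _ _ leb setT) => //.
    rewrite (_ : (fun _ => _) = fun y => (B%:E * (\1_(`[a, x + 1] : set R) y)%:E)%E); last first.
      by apply/funext => y; rewrite EFinM.
    apply: integrableZl => //.
    exact: (@integrable_indic_itv R a (x + 1) true false).
have xx1 : x < x + 1 by rewrite ltrDl.
have [dG dGE] := continuous_FTC1 xx1 intf (ltNyr x) (cf x).
by apply: DeriveDef => //; rewrite -derive1E.
Qed.

(** The average of f over [x, x + delta] is recorded as a value of f on that interval: bounds,
    vanishing on the left and closeness to f all pass to it without further integrals. *)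
Lemma sliding_average (f : R -> R) (a B delta : R) : 0 < delta -> continuous f ->
  (forall x, `|f x| <= B) -> (forall x, x <= a -> f x = 0) ->
  exists2 F : R -> R,
    forall x, is_derive x (1 : R) F (delta^-1 * (f (x + delta) - f x)) &
    forall x, exists2 c, x <= c <= x + delta & F x = f c.
Proof.
move=> delta0 cf fB f0.
have [G dG] := antiderivative_left_vanishing f a B cf fB f0.
exists (fun x => delta^-1 * (G (x + delta) - G x)) => x.
  have d1 : is_derive x (1 : R) (fun y => G (y + delta)) (f (x + delta)).
    have ds : is_derive x (1 : R) (fun y => y + delta) (1 : R).
      by apply: is_derive_eq; rewrite addr0.
    by have := @is_derive1_comp R G (fun y => y + delta) x _ _ (dG (x + delta)) ds; rewrite mulr1.
  have d2 := dG x.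
  by apply: is_derive_eq; rewrite /GRing.scale/=.
have cG : continuous G.
  by move=> y; apply: differentiable_continuous; apply/derivable1_diffP; have [] := dG y.
have xd : x < x + delta by rewrite ltrDl.
have [c cx Gc] := @MVT R G f x (x + delta) xd (fun y _ => dG y) (continuous_subspaceT cG).
exists c; first by move: cx; rewrite in_itv/= => /andP[/ltW -> /ltW ->].
by rewrite Gc addrAC subrr add0r mulrCA mulVf ?mulr1// gt_eqF.
Qed.

Lemma uniform_modulus (f : R -> R) (a b eta : R) : continuous f -> 0 < eta ->
  exists2 delta : R, 0 < delta & forall x c, a <= x <= b -> x <= c <= x + delta ->
    `|f c - f x| <= eta.
Proof.
move=> cf eta0.
pose bad (delta x : R) := forall c, x <= c <= x + delta -> `|f c - f x| <= eta.
have : \forall delta \near (0 : R)^'+, (`[a, b] `<=` bad delta)%classic.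
  have := (compact_near_coveringP `[a, b]%classic).1 (@segment_compact R a b) R (0 : R)^'+ bad.
  apply => x _.
  have [r /= r0 fr] : \forall y \near x, `|f y - f x| < eta / 2.
    have := cf x; move=> /cvgrPdist_lt /(_ (eta / 2)); rewrite divr_gt0// => /(_ isT).
    by apply: filterS => y; rewrite distrC.
  have r2 : 0 < r / 2 by rewrite divr_gt0.
  exists (ball x (r / 2), [set delta | delta < r / 2]).
    by split => /=; [exact: nbhsx_ballx|exact: nbhs_right_lt].
  move=> [y delta] [/= xy dr] c /andP[yc cy].
  have h1 : `|f y - f x| < eta / 2.
    by apply: fr; move: xy; rewrite /ball/= => xy; lra.
  have h2 : `|f c - f x| < eta / 2.
    apply: fr; move: xy; rewrite /ball/= !ltr_norml => /andP[? ?].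
    by apply/andP; split; lra.
  rewrite -(subrKA (f x)) (le_trans (ler_normD _ _))// [`|f x - f y|]distrC.
  by rewrite [eta]splitr ltW// ltrD.
move=> near0.
have [delta [delta0 dP]] : exists delta, 0 < delta /\ (`[a, b] `<=` bad delta)%classic.
  by apply: (@filter_ex _ (0 : R)^'+); apply: filterS2 near0 (nbhs_right_gt _).
by exists delta => // x c xab; apply: dP; rewrite /= in_itv.
Qed.

(* Three successive sliding averages of f give a function with three bounded
   derivatives.  Replacing f by a constant on the left half line makes its
   antiderivative an integral from minus infinity. *)
Lemma smooth_approximation (f : R -> R) (M K eta : R) : continuous f ->
  (forall x, `|f x| <= M) -> 0 < K -> 0 < eta ->
  exists g g1 g2 g3 B, [/\ forall x, is_derive x (1 : R) g (g1 x),
    forall x, is_derive x (1 : R) g1 (g2 x), forall x, is_derive x (1 : R) g2 (g3 x),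
    forall x, [/\ `|g x| <= B, `|g1 x| <= B, `|g2 x| <= B & `|g3 x| <= B] &
    forall x, `|g x| <= 3 * M /\ (`|x| <= K -> `|g x - f x| <= eta)].
Proof.
move=> cf fM K0 eta0.
(* This is max (x, -K), written so that continuity is immediate. *)
pose m x : R := (x - K + `|x + K|) / 2.
have mr x : - K <= x -> m x = x.
  by move=> Kx; rewrite /m ger0_norm; [field|lra].
have ml x : x <= - K -> m x = - K.
  by move=> Kx; rewrite /m ler0_norm; [field|lra].
have cm : continuous m.
  move=> x; apply: cvgMl; apply: cvgD; first by apply: cvgB; [exact: cvg_id|exact: cvg_cst].
  by apply: cvg_norm; apply: cvgD; [exact: cvg_id|exact: cvg_cst].
pose f0 x := f (m x) - f (- K).
have cf0 : continuous f0.
  move=> x; apply: cvgB; last exact: cvg_cst.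
  by apply: (@cvg_comp _ _ _ m f); [exact: cm|exact: cf].
have f0B x : `|f0 x| <= 2 * M.
  by rewrite (le_trans (ler_normB _ _))// mulr2n mulrDl mul1r lerD.
have f0l x : x <= - K -> f0 x = 0 by move=> Kx; rewrite /f0 ml// subrr.
have [delta delta0 dP] := uniform_modulus f0 (- K) K eta cf0 eta0.
(* Each of the three averages moves the argument by at most s, hence by at most delta in total. *)
pose s := delta / 3.
have s0 : 0 < s by rewrite divr_gt0.
have cts (F dF : R -> R) : (forall x, is_derive x (1 : R) F (dF x)) -> continuous F.
  by move=> dFx x; apply: differentiable_continuous; apply/derivable1_diffP; have [] := dFx x.
have vanish (F G : R -> R) a : (forall x, exists2 c, x <= c <= x + s & F x = G c) ->
    (forall x, x <= a -> G x = 0) -> forall x, x <= a - s -> F x = 0.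
  move=> FG G0 x xa; have [c /andP[_ cx] ->] := FG x; apply: G0; lra.
have bounded (F G : R -> R) : (forall x, exists2 c, x <= c <= x + s & F x = G c) ->
    (forall x, `|G x| <= 2 * M) -> forall x, `|F x| <= 2 * M.
  by move=> FG GM x; have [c _ ->] := FG x.
have [F1 d1 i1] := sliding_average f0 _ _ s s0 cf0 f0B f0l.
have F1B := bounded _ _ i1 f0B; have F1l := vanish _ _ _ i1 f0l.
have [F2 d2 i2] := sliding_average F1 _ _ s s0 (cts _ _ d1) F1B F1l.
have F2B := bounded _ _ i2 F1B; have F2l := vanish _ _ _ i2 F1l.
have [F3 d3 i3] := sliding_average F2 _ _ s s0 (cts _ _ d2) F2B F2l.
have F3B := bounded _ _ i3 F2B.
pose D (F : R -> R) x := s^-1 * (F (x + s) - F x).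
have dD (F dF : R -> R) : (forall x, is_derive x (1 : R) F (dF x)) ->
    forall x, is_derive x (1 : R) (D F) (D dF x).
  move=> dFx x; have e1 : is_derive x (1 : R) (fun y => F (y + s)) (dF (x + s)).
    have ds : is_derive x (1 : R) (fun y => y + s) (1 : R).
      by apply: is_derive_eq; rewrite addr0.
    by have := @is_derive1_comp R F (fun y => y + s) x _ _ (dFx (x + s)) ds; rewrite mulr1.
  have e2 := dFx x.
  by rewrite /D; apply: is_derive_eq; rewrite /GRing.scale/=.
pose q := s^-1 * 2; have q0 : 0 <= q by rewrite mulr_ge0// invr_ge0 ltW.
have DB (F : R -> R) C : (forall x, `|F x| <= C) -> forall x, `|D F x| <= q * C.
  move=> FC x; rewrite /q -mulrA /D normrM ger0_norm ?invr_ge0 ?(ltW s0)//.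
  rewrite ler_wpM2l ?invr_ge0 ?(ltW s0)//.
  by rewrite (le_trans (ler_normB _ _))// mulr2n mulrDl mul1r lerD.
have M0 : 0 <= M by exact: le_trans (normr_ge0 _) (fM 0).
have gM x : `|F3 x + f (- K)| <= 3 * M.
  rewrite (le_trans (ler_normD _ _))//; have := F3B x; have := fM (- K); lra.
(* The derivative of a sliding average is the difference quotient [D] of the function averaged, and
   [D] commutes with differentiation; every derivative is thus an iterated [D] of a bounded
   function. *)
exists (fun x => F3 x + f (- K)), (D F2), (D (D F1)), (D (D (D f0))).
exists (3 * M + q * (2 * M) + q * (q * (2 * M)) + q * (q * (q * (2 * M)))).
have q1 : 0 <= q * (2 * M) by rewrite mulr_ge0// mulr_ge0.
have q2 : 0 <= q * (q * (2 * M)) by rewrite mulr_ge0.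
have q3 : 0 <= q * (q * (q * (2 * M))) by rewrite mulr_ge0.
split.
- by move=> x; have ? := d3 x; apply: is_derive_eq; rewrite addr0.
- exact: dD.
- by apply: dD; exact: dD.
- move=> x; split.
  + by have := gM x; lra.
  + have := DB _ _ F2B x; lra.
  + have := DB _ _ (DB _ _ F1B) x; lra.
  + have := DB _ _ (DB _ _ (DB _ _ f0B)) x; lra.
- move=> x; split => //; rewrite ler_norml => /andP[Kx xK].
  have [c3 /andP[a3 b3] E3] := i3 x; have [c2 /andP[a2 b2] E2] := i2 c3.
  have [c1 /andP[a1 b1] E1] := i1 c2.
  have := dP x c1; rewrite Kx xK => /(_ isT).
  have -> : f0 x = f x - f (- K) by rewrite /f0 mr.
  rewrite E3 E2 E1 opprB addrA; apply.
  by apply/andP; split; [lra|rewrite /s in b1 b2 b3; lra].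
Qed.

End sliding_averages.

Section central_limit_theorem.
Context {R : realType} {d : measure_display} {Omega : measurableType d}.
Variables (P : probability Omega R) (H : {RV P >-> R}).
Hypothesis H_gauss : forall A : set R, measurable A ->
  distribution P H A = normal_prob 0 1 A.

Lemma fluct_r_sqr N : (0 < N)%N ->
  config_mean (fun e : config N => fluct_r e ^+ 2) <= 1 :> R.
Proof.
move=> N0; have half0 (b : bool) : 0 <= 1 / 2 :> R by rewrite divr_ge0.
have half1 : \sum_(b : bool) 1 / 2 = 1 :> R by rewrite big_bool/=; field.
have mean0 : \sum_(b : bool) 1 / 2 * spin b = 0 :> R by rewrite big_bool/= /spin; field.
have spin1 (b : bool) : `|spin b : R| <= 1 by rewrite spin_norm.
have := iid_average_sqr (fun=> 1 / 2) half0 half1 spin 1 N0 mean0 spin1.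
rewrite expr1n => le1.
have N0' : 0 < N%:R :> R by rewrite ltr0n.
rewrite -[leRHS](mulfV (lt0r_neq0 N0')) -[N%:R^-1]mul1r; apply: le_trans (ler_wpM2l (ltW N0') le1).
rewrite le_eqVlt; apply/orP; left; apply/eqP.
rewrite /config_mean mulr_sumr [RHS]mulr_sumr; apply: eq_bigr => e _.
rewrite prodr_const card_ord /fluct_r (exprMn 2) -[(_ `^ _) ^+ 2]powR_mulrn ?powR_ge0// -powRrM.
rewrite (_ : 1 / 2 * 2 = 1); last by field.
by rewrite powRr1// mulrCA.
Qed.

(** The smooth approximation is close to f only on [-K, K]. Outside, the difference is at most 3 M +
    M, hence at most 4 M x^2 / K^2, and the second moments of both laws make this small for large
    K. *)
Lemma fluct_r_clt (f : R -> R) (M : R) : continuous f -> (forall x, `|f x| <= M) ->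
  config_mean (fun e : config N => f (fluct_r e)) @[N --> \oo] --> (\int[P]_w f (H w))%R.
Proof.
move=> cf fM; apply/cvgrPdist_le => eps eps0.
have M0 : 0 <= M by exact: le_trans (normr_ge0 _) (fM 0).
pose m2 := (\int[P]_w (H w ^+ 2))%R.
have m20 : 0 <= m2 by apply: Rintegral_ge0 => w _; exact: sqr_ge0.
have [q qE] : exists q, q = 4 * M * (1 + m2) by eexists.
have q0 : 0 <= q by rewrite qE; apply: mulr_ge0; [exact: mulr_ge0|exact: addr_ge0].
have [K KE0] : exists K, K = 1 + q * (4 / eps) by eexists.
have K1 : 1 <= K.
  by rewrite KE0 lerDl; apply: mulr_ge0 => //; rewrite divr_ge0// ltW.
have K0 : 0 < K by exact: lt_le_trans K1.
have KE : 4 * M / K ^+ 2 * (1 + m2) <= eps / 4.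
  rewrite mulrAC -qE ler_pdivrMr ?exprn_gt0// (@le_trans _ _ (eps / 4 * K))//.
    rewrite (_ : eps / 4 * K = eps / 4 + q); last by rewrite KE0; field; rewrite gt_eqF.
    by rewrite lerDr divr_ge0// ltW.
  by rewrite ler_wpM2l ?divr_ge0 ?(ltW eps0)// expr2 ler_peMl// ltW.
have eta0 : 0 < eps / 8 by rewrite divr_gt0.
have [g [g1 [g2 [g3 [B [dg dg1 dg2 gB gf]]]]]] :=
  smooth_approximation f M K (eps / 8) cf fM K0 eta0.
have [C C0 CP] := lindeberg P H H_gauss g g1 g2 g3 B dg dg1 dg2
  (fun x => let: And4 a _ _ _ := gB x in a)
  (fun x => let: And4 _ a _ _ := gB x in a) (fun x => let: And4 _ _ a _ := gB x in a)
  (fun x => let: And4 _ _ _ a := gB x in a).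
have [c cE] : exists c, c = 4 * M / K ^+ 2 by eexists.
have c0 : 0 <= c by rewrite cE divr_ge0 ?mulr_ge0 ?exprn_ge0 ?(ltW K0).
have fg x : `|g x - f x| <= eps / 8 + c * x ^+ 2.
  have [xK|Kx] := leP `|x| K.
    by rewrite (le_trans ((gf x).2 xK))// lerDl mulr_ge0 ?sqr_ge0.
  apply: (@le_trans _ _ (4 * M)).
    by rewrite (le_trans (ler_normB _ _))//; have := (gf x).1; have := fM x; lra.
  apply: (@le_trans _ _ (c * x ^+ 2)); last by rewrite lerDr ltW.
  rewrite cE mulrAC ler_pdivlMr ?exprn_gt0// ler_wpM2l ?mulr_ge0//.
  rewrite -[x ^+ 2]real_normK ?num_real// ler_pXn2r ?nnegrE ?(ltW K0)//.
  exact: ltW.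
have cg : continuous g.
  by move=> x; apply: differentiable_continuous; apply/derivable1_diffP; have [] := dg x.
have ig := gaussian_bounded_integrable P H H_gauss g (3 * M) (continuous_measurable_fun cg)
  (fun x => (gf x).1).
have if_ := gaussian_bounded_integrable P H H_gauss f M (continuous_measurable_fun cf) fM.
have gaussian_error : `|\int[P]_w g (H w) - \int[P]_w f (H w)| <= eps / 8 + c * m2.
  have msqr : measurable_fun setT (fun x : R => x ^+ 2).
    by apply: continuous_measurable_fun; exact: exprn_continuous.
  have is_ : P.-integrable setT (fun w => (H w ^+ 2)%:E).
    apply: (gaussian_quadratic_integrable P H H_gauss (fun x => x ^+ 2) 0 1) => // x.
    by rewrite add0r mul1r ger0_norm ?sqr_ge0.
  have ic : P.-integrable setT (fun w => (c * H w ^+ 2)%:E).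
    apply: (gaussian_quadratic_integrable P H H_gauss (fun x => c * x ^+ 2) 0 c).
      exact: measurable_funM.
    by move=> x; rewrite add0r (ger0_norm (mulr_ge0 c0 (sqr_ge0 x))).
  have i1 : P.-integrable setT (fun=> (eps / 8)%:E).
    by apply: finite_measure_integrable_cst.
  have -> : eps / 8 + c * m2 = \int[P]_w (eps / 8 + c * H w ^+ 2).
    rewrite RintegralD// RintegralZl//; congr (_ + _); apply/esym.
    have -> : \int[P]_(x in setT) (eps / 8) = eps / 8 * fine (P setT) by exact: Rintegral_cst.
    by rewrite probability_setT mulr1.
  rewrite -RintegralB// (le_trans (le_normr_Rintegral _ _))//.
    exact: (integrableB _ ig if_).
  apply: le_Rintegral => //.
  - by apply: integrable_norm => //; exact: (integrableB _ ig if_).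
  - exact: (integrableD _ i1 ic).
near=> N.
have N0 : (0 < N)%N by near: N; exact: nbhs_infty_gt.
have CN : C / Num.sqrt N%:R <= eps / 4.
  have N1 : (4 * C / eps + 1) ^+ 2 <= N%:R by near: N; exact: nbhs_infty_ger.
  have p1 : 0 <= 4 * C / eps by rewrite divr_ge0 ?mulr_ge0// ltW.
  have : 4 * C / eps + 1 <= Num.sqrt N%:R.
    have := ler_wsqrtr N1; rewrite sqrtr_sqr; exact: le_trans (ler_norm _).
  rewrite ler_pdivrMr ?sqrtr_gt0 ?ltr0n// => N2.
  rewrite -ler_pdivrMl ?divr_gt0// (le_trans _ N2)// invf_div.
  by rewrite (_ : 4 / eps * C = 4 * C / eps) ?lerDl//; ring.
have config_error : `|config_mean (fun e : config N => g (fluct_r e)) -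
    config_mean (fun e : config N => f (fluct_r e))| <= eps / 8 + c.
  apply: (@le_trans _ _ (config_mean (fun e : config N => eps / 8 + c * fluct_r e ^+ 2))).
    exact: config_meanB_le.
  rewrite config_meanD config_meanZ config_mean_cst lerD2l.
  by rewrite -[leRHS]mulr1 ler_wpM2l// fluct_r_sqr.
have := CP N N0; rewrite -cE in KE; move: gaussian_error config_error CN KE.
rewrite mulrDr mulr1.
rewrite !ler_norml => /andP[? ?] /andP[? ?] ? ? /andP[? ?].
by apply/andP; split; lra.
Unshelve. all: by end_near. Qed.

End central_limit_theorem.

(** * Weak convergence *)

Section expectation_bounds.
Context {R : realType} {d : measure_display} {Omega : measurableType d}.

(* No measurability is needed, since the integral of a nonnegative function is
   a supremum over the simple functions below it. *)
Lemma le_integral_nonmeasurable (mu : {measure set Omega -> \bar R})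
    (f g : Omega -> \bar R) : (forall x, f x <= g x)%E ->
  (\int[mu]_x f x <= \int[mu]_x g x)%E.
Proof.
move=> fg; rewrite (integralE _ _ f) (integralE _ _ g).
have mono (f1 f2 : Omega -> \bar R) : (forall x, 0 <= f1 x)%E ->
    (forall x, f1 x <= f2 x)%E -> (\int[mu]_x f1 x <= \int[mu]_x f2 x)%E.
  move=> f10 f12; have f20 x : (0 <= f2 x)%E by exact: le_trans (f12 x).
  rewrite !ge0_integralTE//; apply: le_ereal_sup => _ [s sf <-]; exists s => // x.
  exact: le_trans (sf x) (f12 x).
apply: leeB; apply: mono => x.
- exact: funepos_ge0.
- by rewrite !funeposE ge_max !le_max fg lexx orbT.
- exact: funeneg_ge0.
- by rewrite !funenegE ge_max !le_max leeN2 fg lexx orbT.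
Qed.

Lemma le_expectation_nonmeasurable (P : probability Omega R) (f g : Omega -> R) :
  (forall w, f w <= g w) -> ('E_P[f] <= 'E_P[g])%E.
Proof.
by move=> fg; rewrite unlock; apply: le_integral_nonmeasurable => w; rewrite lee_fin.
Qed.

Variables (P : probability Omega R) (N : nat) (eta : Omega -> config N).
Hypothesis m_env : forall e, measurable [set w | eta w = e].
Hypothesis env_law : forall e, P [set w | eta w = e] = ((1 / 2) ^+ N)%:E.

(** Functions of the environment plus a multiple of an indicator are the integrands whose
    expectation is computed; a functional of the paths is only compared with them. *)
Lemma expectation_env (phi : config N -> R) (C : R) (D : set Omega) : measurable D ->
  ('E_P[(fun w => phi (eta w) + C * \1_D w)%R] = (config_mean phi)%:E + C%:E * P D)%E.
Proof.
move=> mD; rewrite unlock.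
have -> : (fun w => (phi (eta w) + C * \1_D w)%:E) = fun w =>
    (\sum_(e <- index_enum (config N)) (phi e)%:E * (\1_[set w | eta w = e] w)%:E +
     C%:E * (\1_D w)%:E)%E.
  apply/funext => w; rewrite EFinD EFinM; congr (_ + _)%E.
  rewrite (bigD1 (eta w))//= indicE mem_set// mule1 big1 ?adde0// => e ew.
  by rewrite indicE memNset ?mule0//= => /esym/eqP; rewrite (negbTE ew).
have ii (A : set Omega) c : measurable A -> P.-integrable setT (fun w => c%:E * (\1_A w)%:E)%E.
  by move=> mA; apply: integrableZl => //; exact: integrable_indic.
have iiE (A : set Omega) c : measurable A -> (\int[P]_w (c%:E * (\1_A w)%:E) = c%:E * P A)%E.
  move=> mA; rewrite integralZl//; last exact: integrable_indic.
  by rewrite integral_indic// setIT.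
rewrite integralD//; [|by apply: integrable_sum => // e _; exact: ii|exact: ii].
rewrite iiE//; congr (_ + _)%E.
rewrite integral_sum//; last by move=> e; exact: ii.
rewrite /config_mean mulr_sumr -sumEFin; apply: eq_bigr => e _.
by rewrite iiE// env_law -EFinM mulrC.
Qed.

End expectation_bounds.

Section environment_law.
Context {R : realType} (beta gamma h : R).
Variable mu : bool * bool * bool -> R.
Hypothesis mu_law : initial_law beta gamma h mu.

Lemma start_weight_env N (e : config N) : \sum_x start_weight mu x e = (1 / 2) ^+ N.
Proof.
transitivity (\sum_(s : config N) \sum_(o : config N) \prod_(j < N) mu (s j, o j, e j)).
  by rewrite pair_bigA.
transitivity (\sum_(s : config N) \prod_(j < N) \sum_b mu (s j, b, e j)).
  by apply: eq_bigr => s _; rewrite (bigA_distr_bigA (fun j b => mu (s j, b, e j))).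
rewrite -(bigA_distr_bigA (fun j a => \sum_b mu (a, b, e j))).
rewrite (eq_bigr (fun=> 1 / 2)); first by rewrite prodr_const card_ord.
by move=> j _; exact: initial_law_eta mu_law (e j).
Qed.

End environment_law.

Section slopes.
Context {R : realType} (lam T : R).
Hypothesis T_gt0 : 0 < T.

Lemma skorokhod_dist_le_sup (x y : R -> R) (eps : R) :
  (forall t, 0 <= t <= T -> `|x t - y t| <= eps) -> (skorokhod_dist T x y <= eps%:E)%E.
Proof.
move=> xy; have eps0 : 0 <= eps.
  by have := xy 0; rewrite lexx ltW// => /(_ isT); exact: le_trans.
apply: ereal_inf_lbound; exists eps => //; exists id; last first.
  by move=> t tT; split; [rewrite subrr normr0|exact: xy].
split=> //.
by apply: continuous_subspaceT => t; exact: cvg_id.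
Qed.

Lemma linear_cadlag (a : R) : cadlag T (fun t => a * t).
Proof.
have c t : (fun s => a * s) @ t --> a * t by apply: cvgMr; exact: cvg_id.
split=> t _; first exact: cvg_within_filter (c t).
by apply/cvg_ex; exists (a * t); exact: cvg_within_filter (c t).
Qed.

Variable F : (R -> R) -> R.
Hypothesis F_cont : skorokhod_continuous T F.

Let g a := F (fun t => lam * a * t).

(** The identity time change bounds the Skorokhod distance by the uniform one, which splits into the
    distance from y to the line of slope lam a' and that between two lines. *)
Let slope_local (a eps : R) : 0 < eps -> exists2 delta : R, 0 < delta &
  forall a' y, `|a - a'| < delta -> cadlag T y ->
    (forall t, 0 <= t <= T -> `|y t - lam * a' * t| <= delta) -> `|F y - g a| < eps.
Proof.
move=> eps0; have [delta delta0 FP] := F_cont _ (linear_cadlag (lam * a)) _ eps0.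
have K0 : 0 < `|lam| * T + 2 by rewrite ltr_wpDl// mulr_ge0// ltW.
(* The two distances add up to |lam| T + 1 times this quantity; the 2 makes the result strictly less
   than delta. *)
exists (delta / (`|lam| * T + 2)); first by rewrite divr_gt0.
move=> a' y aa' cy ya'; rewrite distrC; apply: FP => //.
apply: (@le_lt_trans _ _ (delta / (`|lam| * T + 2) * (`|lam| * T + 1))%:E); last first.
  by rewrite lte_fin mulrAC ltr_pdivrMr// ltr_pM2l// ltrD2l ltr1n.
apply: skorokhod_dist_le_sup => t tT.
rewrite -(subrKA (lam * a' * t)) (le_trans (ler_normD _ _))//.
rewrite mulrDr mulr1 lerD//; last by rewrite distrC; exact: ya'.
move: tT => /andP[t0 tT]; move: (delta / _) aa' {ya'} => q aq.
rewrite -mulrBl -mulrBr !normrM mulrC (ger0_norm t0) mulrA [leRHS]mulrC [`|lam| * T]mulrC.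
by apply: ler_pM => //; [exact: mulr_ge0|exact: ler_wpM2r|exact: ltW].
Qed.

Lemma slope_continuous : continuous g.
Proof.
move=> a; apply/cvgrPdist_lt => eps eps0.
have [delta delta0 gP] := slope_local a _ eps0.
exists delta => //= a' aa'; rewrite distrC; apply: (gP a') => //.
- exact: linear_cadlag.
- by move=> t _; rewrite subrr normr0 ltW.
Qed.

(** [F] is only known to be continuous path by path. Compactness of [-K, K] makes the modulus of
    continuity along the linear paths uniform in the slope. *)
Lemma slope_uniform (K eps : R) : 0 < eps -> exists2 rho : R, 0 < rho &
  forall a y, `|a| <= K -> cadlag T y ->
    (forall t, 0 <= t <= T -> `|y t - lam * a * t| <= rho) -> `|F y - g a| <= eps.
Proof.
move=> eps0; pose close (rho a : R) := forall y, cadlag T y ->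
  (forall t, 0 <= t <= T -> `|y t - lam * a * t| <= rho) -> `|F y - g a| <= eps.
have : \forall rho \near (0 : R)^'+, (`[- K, K] `<=` close rho)%classic.
  have := (compact_near_coveringP `[- K, K]%classic).1 (@segment_compact R (- K) K)
    R (0 : R)^'+ close.
  apply => a _.
  have [delta delta0 gP] := slope_local a (eps / 2) (divr_gt0 eps0 (ltr0n _ 2)).
  exists (ball a delta, [set rho | rho < delta]).
    by split => /=; [exact: nbhsx_ballx|exact: nbhs_right_lt].
  move=> [a' rho] [/= aa' rd] y cy yr.
  have h1 : `|F y - g a| < eps / 2.
    by apply: (gP a') => // t tT; exact: le_trans (yr t tT) (ltW rd).
  have h2 : `|g a' - g a| < eps / 2.
    by apply: (gP a') => // [|t _]; [exact: linear_cadlag|rewrite subrr normr0 ltW].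
  rewrite -(subrKA (g a)) (le_trans (ler_normD _ _))// [`|g a - g a'|]distrC.
  by rewrite [eps]splitr ltW// ltrD.
move=> near0; have [rho [rho0 rP]] : exists rho, 0 < rho /\ (`[- K, K] `<=` close rho)%classic.
  by apply: (@filter_ex _ (0 : R)^'+); apply: filterS2 near0 (nbhs_right_gt _).
exists rho => // a y aK; apply: rP; move: aK.
by rewrite /= in_itv/= ler_norml.
Qed.

End slopes.

Section rescaled_paths.
Context {R : realType} (beta gamma h T : R).
Hypothesis T_gt0 : 0 < T.
Variables (N : nat) (d : measure_display) (Omega : measurableType d)
  (P : probability Omega R) (eta : Omega -> config N) (X : R -> Omega -> state N).
Hypothesis N_gt0 : (0 < N)%N.
Hypothesis chain : spin_chain beta gamma h P eta X.

Let c : R := N%:R `^ (1 / 4).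
Let c_gt0 : 0 < c. Proof. by rewrite powR_gt0// ltr0n. Qed.

Let rescaled_right w (t : R) : 0 <= t -> exists2 r : R, 0 < r &
  forall s, t < s < t + r -> X (c * s) w = X (c * t) w.
Proof.
move=> t0; have [r /= r0 rX] := spin_chain_right_continuous chain w (mulr_ge0 (ltW c_gt0) t0).
exists (r / c); first exact: divr_gt0.
move=> s /andP[ts sr]; apply: rX; last by rewrite ltr_pM2l.
rewrite /ball/= -mulrBr normrM (gtr0_norm c_gt0) -ltr_pdivlMl// mulrC distrC gtr0_norm ?subr_gt0//.
by rewrite ltrBlDl.
Qed.

Let rescaled_left w (t : R) : 0 < t -> exists x, exists2 r : R, 0 < r &
  forall s, t - r < s < t -> X (c * s) w = x.
Proof.
move=> t0; have [x [r /= r0 rX]] := spin_chain_left_limits chain w (mulr_gt0 c_gt0 t0).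
exists x, (r / c); first exact: divr_gt0.
move=> s /andP[ts sr]; apply: rX; last by rewrite ltr_pM2l.
rewrite /ball/= -mulrBr normrM (gtr0_norm c_gt0) -ltr_pdivlMl// mulrC gtr0_norm ?subr_gt0//.
by rewrite ltrBlDr -ltrBlDl.
Qed.

Lemma rescaled_cadlag (q : state N -> R) w : cadlag T (fun t => q (X (c * t) w)).
Proof.
split=> t /andP[t0 tT].
  have [r r0 rX] := rescaled_right w t t0.
  apply: cvg_near_cst; near=> s; congr q; apply: rX.
  by apply/andP; split; near: s; [exact: nbhs_right_gt|apply: nbhs_right_lt; rewrite ltrDl].
have [x [r r0 rX]] := rescaled_left w t t0.
apply/cvg_ex; exists (q x); apply: cvg_near_cst; near=> s; congr q; apply: rX.
by apply/andP; split; near: s; [apply: nbhs_left_gt; rewrite ltrBlDr ltrDl|exact: nbhs_left_lt].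
Unshelve. all: by end_near. Qed.

(** By right continuity, a supremum over [0, T] that exceeds eps does so at T or at a rational time,
    which leaves a countable union. *)
Lemma sup_norm_measurable (q : config N -> state N -> R) (eps : R) :
  measurable [set w | (eps%:E < sup_norm T (fun t => q (eta w) (X (c * t) w)))%E].
Proof.
have m1 t : 0 <= t -> measurable [set w | eps < `|q (eta w) (X (c * t) w)|].
  move=> t0; rewrite (_ : [set _ | _] = \bigcup_(ex in [set ex : config N * state N |
      eps < `|q ex.1 ex.2|]) ([set w | eta w = ex.1] `&` [set w | X (c * t) w = ex.2])).
    apply: fin_bigcup_measurable => [|ex _]; first exact: finite_finset.
    apply: measurableI; first exact: spin_chain_env_measurable chain _.
    by apply: (spin_chain_measurable chain); exact: mulr_ge0 (ltW c_gt0) t0.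
  apply/seteqP; split=> w /=.
    by move=> qw; exists (eta w, X (c * t) w).
  by move=> [[e x] /= qex [-> ->]].
(* Rationals outside [0, T] are sent to T, so that the endpoint, possibly irrational, is among the
   times enumerated. *)
pose time (r : rat) : R := if 0 <= (ratr r : R) <= T then ratr r else T.
have time0 r : 0 <= time r <= T by rewrite /time; case: ifPn => // _; rewrite ltW//=.
rewrite (_ : [set _ | _] = \bigcup_r [set w | eps < `|q (eta w) (X (c * time r) w)|]).
  by apply: bigcupT_measurable_rat => r; apply: m1; have /andP[] := time0 r.
apply/seteqP; split=> w /=; last first.
  move=> [r _ /= lt]; apply: (@lt_le_trans _ _ `|q (eta w) (X (c * time r) w)|%:E).
    by rewrite lte_fin.
  by apply: ereal_sup_ubound; exists (time r) => //=; rewrite in_itv/=; exact: time0.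
move=> /ereal_sup_gt[_ [t /= + <-]]; rewrite in_itv/= lte_fin => /andP[t0 tT] lt.
move: tT; rewrite le_eqVlt => /predU1P[tT|tT].
  have [r rP] : exists r, time r = T.
    have TT : T < T + 1 by rewrite ltrDl.
    have [r] := rat_in_itvoo TT.
    rewrite in_itv/= => /andP[Tr _]; exists r; rewrite /time ifN//.
    by rewrite negb_and -!ltNge Tr orbT.
  by exists r => //=; rewrite rP -tT.
have [r r0 rX] := rescaled_right w t t0.
have tm : t < Num.min T (t + r) by rewrite lt_min tT ltrDl.
have [s] := rat_in_itvoo tm; rewrite in_itv/= lt_min => /and3P[ts sT sr].
exists s => //=; rewrite /time ifT; last by rewrite (le_trans t0 (ltW ts)) ltW.
by rewrite (rX (ratr s)) ?ts.
Qed.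

End rescaled_paths.

Section convergence.
Context {R : realType} (beta gamma h T : R).
Hypothesis beta_gt0 : 0 < beta.
Hypothesis gamma_gt0 : 0 < gamma.
Hypothesis h_gt0 : 0 < h.
Hypothesis critical : gamma = cosh (gamma * h) ^+ 2 / tanh beta.
Hypothesis T_gt0 : 0 < T.
Variable mu : bool * bool * bool -> R.
Hypothesis mu_law : initial_law beta gamma h mu.
Variables (d : nat -> measure_display) (Omega : forall N, measurableType (d N))
  (P : forall N, probability (Omega N) R)
  (eta : forall N, Omega N -> config N)
  (X : forall N, R -> Omega N -> state N).
Hypothesis X_chain : forall N, (0 < N)%N -> spin_chain beta gamma h (P N) (eta N) (X N).
Hypothesis X_start : forall N, (0 < N)%N -> iid_start mu (P N) (eta N) (X N).

Let env_law N (e : config N) : (0 < N)%N ->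
  P N [set w | eta N w = e] = ((1 / 2) ^+ N)%:E.
Proof.
move=> N0; rewrite (envE _ _ _ _ _ _ _ _ _ _ (X_chain N N0) (X_start N N0)).
by rewrite (start_weight_env _ _ _ _ mu_law).
Qed.

Lemma collapse_combination (c1 c2 c3 c4 c5 : R)
    (q : forall N, config N -> state N -> R) :
  (forall N (e : config N) (x : state N), q N e x = N%:R `^ (1 / 4) *
    (c1 * dev_z gamma h e x + c2 * dev_v beta x + c3 * dev_p beta gamma h e x +
     c4 * dev_q beta gamma h x + c5 * dev_w beta gamma h e x)) ->
  collapses_to_zero T P (fun N t w => q N (eta N w) (X N (N%:R `^ (1 / 4) * t) w)).
Proof.
move=> qE eps eps0.
have [c cE] : exists c, c = `|c1| + `|c2| + `|c3| + `|c4| + `|c5| by eexists.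
have c0 : 0 <= c by rewrite cE !addr_ge0.
have c1_gt0 : 0 < c + 1 by rewrite ltr_wpDl.
pose A N := [set w : Omega N | (eps%:E < sup_norm T
  (fun t => q N (eta N w) (X N (N%:R `^ (1 / 4) * t) w)))%E].
have mA N : (0 < N)%N -> measurable (A N).
  move=> N0; exact: (sup_norm_measurable beta gamma h T T_gt0 N _ _ (P N) (eta N)
    (X N) N0 (X_chain N N0)).
apply: cvg_EFin.
  near=> N; apply: fin_num_measure; apply: mA.
  by near: N; exact: nbhs_infty_gt.
apply/cvgrPdist_le => zeta zeta0.
have := uniform_approximation beta gamma h T beta_gt0 gamma_gt0 h_gt0 critical T_gt0 mu mu_law
  (eps / (c + 1)) zeta (divr_gt0 eps0 c1_gt0) zeta0.
apply: filter_app; near=> N => /(_ _ _ _ _ _ (X_chain N _) (X_start N _)).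
have N0 : (0 < N)%N by near: N; exact: nbhs_infty_gt.
move=> /(_ N0 N0) [D [mD PD] DP].
rewrite sub0r normrN ger0_norm; last by apply: fine_ge0; exact: measure_ge0.
rewrite -lee_fin /= fineK; last by apply: fin_num_measure; exact: mA.
apply: le_trans PD; apply: le_measure; rewrite ?inE//; first exact: mA.
move=> w; apply: contraPP => Dw /=; apply/negP; rewrite -leNgt.
apply: ge_ereal_sup => _ [t /= + <-]; rewrite in_itv/= => tT.
have [_ []] := DP w t Dw tT; set x := X N _ w; set e := eta N w.
have r0 : 0 <= N%:R `^ (1 / 4) :> R by exact: powR_ge0.
move: (dev_z gamma h e x) (dev_v beta x) (dev_p beta gamma h e x) (dev_q beta gamma h x)
  (dev_w beta gamma h e x) (qE N e x) r0 => z v p y u -> {qE}.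
move: (N%:R `^ _) (eps / (c + 1)) (divfK (lt0r_neq0 c1_gt0) eps) => r rho rhoE r0 hz hv hp hy hu.
rewrite lee_fin normrM (ger0_norm r0).
have rho0 : 0 <= rho by rewrite (le_trans _ hz)// mulr_ge0.
apply: (@le_trans _ _ (c * rho)); last by rewrite -rhoE mulrC ler_wpM2l// lerDl.
have tri : `|c1 * z + c2 * v + c3 * p + c4 * y + c5 * u| <=
    `|c1| * `|z| + `|c2| * `|v| + `|c3| * `|p| + `|c4| * `|y| + `|c5| * `|u|.
  by rewrite -!normrM; do 4![rewrite (le_trans (ler_normD _ _))// lerD2r].
apply: le_trans (ler_wpM2l r0 tri) _; rewrite !mulrDr cE !mulrDl.
by rewrite !(mulrCA r); do !apply: lerD => //; exact: ler_wpM2l.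
Unshelve. all: by end_near. Qed.

Variables (d' : measure_display) (Omega' : measurableType d')
  (P' : probability Omega' R) (H : {RV P' >-> R}).
Hypothesis H_gauss : forall A : set R, measurable A ->
  distribution P' H A = normal_prob 0 1 A.

Let gauss_expectation (f : R -> R) (M : R) : continuous f -> (forall x, `|f x| <= M) ->
  'E_P'[fun w => f (H w)]%E = (\int[P']_w f (H w))%:E.
Proof.
move=> cf fM; rewrite unlock /Rintegral fineK//.
apply: integrable_fin_num => //.
exact: (gaussian_bounded_integrable P' H H_gauss f M (continuous_measurable_fun cf) fM).
Qed.

Lemma fluct_r_cvg_in_law : cvg_in_law P (fun N w => fluct_r (eta N w)) P' H.
Proof.
move=> f cf [M fM]; rewrite (gauss_expectation f M)//.
apply: (@cvg_trans _ ((fun N => (config_mean (fun e : config N => f (fluct_r e)))%:E) @ \oo)).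
  apply: near_eq_cvg; near=> N.
  have N0 : (0 < N)%N by near: N; exact: nbhs_infty_gt.
  have := expectation_env (P N) N (eta N) (spin_chain_env_measurable (X_chain N N0))
    (fun e => env_law N e N0) (fun e => f (fluct_r e)) 0 set0 measurable0.
  rewrite measure0 mule0 adde0 => <-; congr expectation.
  by apply/funext => w; rewrite mul0r addr0.
apply: cvg_EFin; first by near=> N.
exact: fluct_r_clt H_gauss f M cf fM.
Unshelve. all: by end_near. Qed.

(** With r the value of [fluct_r], the difference between F at the path and g r is at most eps/4
    when |r| <= K outside the exceptional set D, and at most 2 M always; the latter is dominated by
    c r^2 when |r| > K and by 2 M times the indicator on D. As F of the random path is not known to
    be measurable, its expectation is squeezed between two computable ones, and the limit theorem
    for r applies to g. *)
Lemma fluct_x_weak_cvg : weak_cvg T P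
  (fun N t w => fluct_x beta gamma h (X N (N%:R `^ (1 / 4) * t) w)) P'
  (fun t w => 2 * H w * sinh beta * sinh (gamma * h) * t).
Proof.
move=> F F_cont [M FM].
pose lam := 2 * sinh beta * sinh (gamma * h).
pose g a := F (fun t => lam * a * t).
have cg : continuous g by exact: slope_continuous lam T T_gt0 F F_cont.
have gM a : `|g a| <= M by apply: FM; exact: linear_cadlag.
have M0 : 0 <= M by exact: le_trans (normr_ge0 _) (gM 0).
have -> : (fun w => F (fun t => 2 * H w * sinh beta * sinh (gamma * h) * t)) = fun w => g (H w).
  apply/funext => w; congr F; apply/funext => t; congr (_ * t); rewrite /lam; ring.
rewrite (gauss_expectation g M)//.
pose Y N (w : Omega N) t := fluct_x beta gamma h (X N (N%:R `^ (1 / 4) * t) w).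
have YM N w : (0 < N)%N -> `|F (Y N w)| <= M.
  move=> N0; apply: FM.
  exact: (rescaled_cadlag beta gamma h T N _ _ (P N) (eta N) (X N) N0 (X_chain N N0)).
have clt := fluct_r_clt P' H H_gauss g M cg gM.
have close (eps : R) : 0 < eps -> \forall N \near \oo,
    (((\int[P']_w g (H w)) - eps)%:E <= 'E_(P N)[fun w => F (Y N w)] <=
     ((\int[P']_w g (H w)) + eps)%:E)%E.
  move=> eps0.
  have [K KE] : exists K, K = 1 + 8 * M / eps by eexists.
  have K1 : 1 <= K by rewrite KE lerDl divr_ge0 ?mulr_ge0// ltW.
  have K0 : 0 < K by exact: lt_le_trans K1.
  have [c cE] : exists c, c = 2 * M / K ^+ 2 by eexists.
  have c0 : 0 <= c by rewrite cE divr_ge0 ?mulr_ge0 ?exprn_ge0 ?(ltW K0).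
  have ceps : c <= eps / 4.
    rewrite cE ler_pdivrMr ?exprn_gt0// (@le_trans _ _ (eps / 4 * K))//.
      rewrite KE (_ : eps / 4 * _ = eps / 4 + 2 * M); last by field; rewrite gt_eqF.
      by rewrite lerDr divr_ge0// ltW.
    by rewrite ler_wpM2l ?divr_ge0 ?(ltW eps0)// expr2 ler_peMl// ltW.
  have eps4 : 0 < eps / 4 by rewrite divr_gt0.
  have [rho rho0 rhoP] := slope_uniform lam T T_gt0 F F_cont K (eps / 4) eps4.
  have zeta0 : 0 < eps / 4 / (2 * M + 1) by rewrite divr_gt0// ltr_wpDl// mulr_ge0.
  have := uniform_approximation beta gamma h T beta_gt0 gamma_gt0 h_gt0 critical T_gt0 mu mu_law
    rho _ rho0 zeta0.
  move/cvgrPdist_le : clt => /(_ _ eps4).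
  apply: filter_app2; near=> N => cltN /(_ _ _ _ _ _ (X_chain N _) (X_start N _)).
  have N0 : (0 < N)%N by near: N; exact: nbhs_infty_gt.
  move=> /(_ N0 N0) [D [mD PD] DP].
  have bound w : `|F (Y N w) - g (fluct_r (eta N w))| <=
      eps / 4 + c * fluct_r (eta N w) ^+ 2 + 2 * M * \1_D w.
    set r := fluct_r _.
    have cr : 0 <= c * r ^+ 2 by rewrite mulr_ge0 ?sqr_ge0.
    have triv : `|F (Y N w) - g r| <= 2 * M.
      by rewrite (le_trans (ler_normB _ _))// mulr2n mulrDl mul1r lerD// YM.
    have [Dw|Dw] := pselect (D w).
      rewrite indicE mem_set// mulr1 (le_trans triv)// lerDr addr_ge0// ltW//.
    rewrite indicE memNset// mulr0 addr0.
    have [rK|Kr] := leP `|r| K.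
      rewrite (@le_trans _ _ (eps / 4))// ?lerDl//; apply: rhoP => //.
        exact: (rescaled_cadlag beta gamma h T N _ _ (P N) (eta N) (X N) N0 (X_chain N N0)).
      by move=> t tT; have [] := DP w t Dw tT.
    apply: (@le_trans _ _ (c * r ^+ 2)); last by rewrite lerDr ltW.
    rewrite (le_trans triv)// cE mulrAC ler_pdivlMr ?exprn_gt0// ler_wpM2l ?mulr_ge0//.
    rewrite -[r ^+ 2]real_normK ?num_real// ler_pXn2r ?nnegrE ?(ltW K0)//.
    exact: ltW.
  have mc : config_mean (fun e : config N => eps / 4 + c * fluct_r e ^+ 2) <= eps / 2.
    rewrite config_meanD config_mean_cst config_meanZ.
    have := ler_wpM2l c0 (fluct_r_sqr N N0); rewrite mulr1; lra.
  have Dbound : 2 * M * fine (P N D) <= eps / 4.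
    have fD : fine (P N D) <= eps / 4 / (2 * M + 1).
      by rewrite -lee_fin fineK// fin_num_measure.
    have fD0 : 0 <= fine (P N D) by rewrite fine_ge0.
    rewrite (@le_trans _ _ ((2 * M + 1) * fine (P N D)))//.
      by rewrite ler_wpM2r// lerDl.
    by rewrite mulrC -ler_pdivlMr// ltr_wpDl// mulr_ge0.
  have EE := expectation_env (P N) N (eta N) (spin_chain_env_measurable (X_chain N N0))
    (fun e => env_law N e N0).
  have PDE : P N D = (fine (P N D))%:E by rewrite fineK// fin_num_measure.
  move: cltN; rewrite ler_norml => /andP[clt1 clt2].
  apply/andP; split.
    apply: (@le_trans _ _ ('E_(P N)[(fun w => (g (fluct_r (eta N w)) +
        -1 * (eps / 4 + c * fluct_r (eta N w) ^+ 2)) + - (2 * M) * \1_D w)%R])%E).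
      rewrite (EE (fun e => g (fluct_r e) + -1 * (eps / 4 + c * fluct_r e ^+ 2)))//.
      rewrite PDE -EFinM -EFinD lee_fin config_meanD config_meanZ; lra.
    apply: le_expectation_nonmeasurable => w.
    have := bound w; rewrite ler_norml => /andP[? ?]; lra.
  apply: (@le_trans _ _ ('E_(P N)[(fun w => (g (fluct_r (eta N w)) +
        (eps / 4 + c * fluct_r (eta N w) ^+ 2)) + 2 * M * \1_D w)%R])%E).
    apply: le_expectation_nonmeasurable => w.
    have := bound w; rewrite ler_norml => /andP[? ?]; lra.
  rewrite (EE (fun e => g (fluct_r e) + (eps / 4 + c * fluct_r e ^+ 2)))//.
  rewrite PDE -EFinM -EFinD lee_fin config_meanD; lra.
apply/fine_cvgP; split.
  have := close 1 ltr01; apply: filterS => N /andP[l u].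
  by rewrite fin_numElt (lt_le_trans _ l) ?ltNyr// (le_lt_trans u)// ltry.
apply/cvgrPdist_le => eps eps0.
have := close eps eps0; apply: filterS => N /andP[l u] /=.
have : 'E_(P N)[fun w => F (Y N w)]%E \is a fin_num.
  by rewrite fin_numElt (lt_le_trans _ l) ?ltNyr// (le_lt_trans u)// ltry.
move=> /fineK EE; move: l u; rewrite -EE !lee_fin => l u.
by rewrite ler_norml; apply/andP; split; lra.
Unshelve. all: by end_near. Qed.

End convergence.

Theorem theorem4p3 (R : realType) (beta gamma h T : R)
    (beta_gt0 : 0 < beta) (gamma_gt0 : 0 < gamma) (h_gt0 : 0 < h)
    (critical : gamma = cosh (gamma * h) ^+ 2 / tanh beta) (T_gt0 : 0 < T)
    (mu : bool * bool * bool -> R) (mu_law : initial_law beta gamma h mu)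
    (d : nat -> measure_display) (Omega : forall N, measurableType (d N))
    (P : forall N, probability (Omega N) R)
    (eta : forall N, Omega N -> config N)
    (X : forall N, R -> Omega N -> state N)
    (X_chain : forall N, (0 < N)%N -> spin_chain beta gamma h (P N) (eta N) (X N))
    (X_start : forall N, (0 < N)%N -> iid_start mu (P N) (eta N) (X N))
    (d' : measure_display) (Omega' : measurableType d')
    (P' : probability Omega' R) (H : {RV P' >-> R})
    (H_gauss : forall A : set R, measurable A ->
       distribution P' H A = normal_prob 0 1 A) :
  let rescaled (q : forall N, config N -> state N -> R) :=
    fun (N : nat) (t : R) (w : Omega N) =>
      q N (eta N w) (X N (N%:R `^ (1 / 4) * t) w) in
  [/\ cvg_in_law P (fun N w => fluct_r (eta N w)) P' H,
      [/\ collapses_to_zero T P (rescaled (fun N e x => fluct_y beta gamma h e x)),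
          collapses_to_zero T P (rescaled (fun N e x => fluct_z gamma h e x)),
          collapses_to_zero T P (rescaled (fun N e x => fluct_u beta gamma h e x)),
          collapses_to_zero T P (rescaled (fun N e x => fluct_v beta gamma h x)) &
          collapses_to_zero T P (rescaled (fun N e x => fluct_w beta gamma h e x))] &
      weak_cvg T P
        (rescaled (fun N e x => fluct_x beta gamma h x)) P'
        (fun t w => 2 * H w * sinh beta * sinh (gamma * h) * t)].
Proof.
move=> rescaled.
have collapse := collapse_combination beta gamma h T beta_gt0 gamma_gt0 h_gt0 critical T_gt0
  mu mu_law d Omega P eta X X_chain X_start.
pose ch := cosh (gamma * h); pose sh := sinh (gamma * h); pose th := tanh (gamma * h).
pose cb := cosh beta; pose sb := sinh beta; pose tb := tanh beta.
split.
- exact: (fluct_r_cvg_in_law beta gamma h mu mu_law d Omega P eta X X_chain X_start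
    d' Omega' P' H H_gauss).
- split.
  + apply: (collapse sb 0 (ch - cb) 0 0) => N e x.
    by rewrite /fluct_y /dev_z /dev_p; congr (_ * _); rewrite /ch /cb /sb; ring.
  + apply: (collapse 1 0 0 0 0) => N e x.
    by rewrite /fluct_z /dev_z; congr (_ * _); ring.
  (* The constants contributed by [dev_p] and [dev_z] are tb th^2 with opposite signs and cancel, so
     only the one of [dev_q] remains. *)
  + apply: (collapse (tb * th) 0 (- th) 1 0) => N e x.
    by rewrite /fluct_u /dev_z /dev_p /dev_q; congr (_ * _); rewrite /tb /th; ring.
  + apply: (collapse 0 (2 * sh * (cb + 2 * ch)) 0 0 0) => N e x.
    by rewrite /fluct_v /dev_v; congr (_ * _); rewrite /sh /cb /ch; ring.
  + apply: (collapse 0 0 0 0 1) => N e x.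
    by rewrite /fluct_w /dev_w; congr (_ * _); ring.
- exact: (fluct_x_weak_cvg beta gamma h T beta_gt0 gamma_gt0 h_gt0 critical T_gt0
    mu mu_law d Omega P eta X X_chain X_start d' Omega' P' H H_gauss).
Qed.
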